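(* Let $\ell$ be a positive integer and let $P$ be a finite set of points in the plane $\mathbb{R}^2$. If $P$ contains at least $328\ell^2$ points, then $P$ contains an empty pentagon or $\ell$ collinear points.
   Context: For a set $X\subseteq\mathbb{R}^2$, $\operatorname{conv}(X)$ denotes its convex hull. A point $x$ of a point set $X$ is a corner of $X$ if $\operatorname{conv}(X\setminus\{x\})\neq\operatorname{conv}(X)$. The set $X$ is in strictly convex position if every point of $X$ is a corner of $X$. A strictly convex $k$-gon is a set of $k$ (distinct) points in strictly convex position. A subset $X$ of a point set $P$ is an empty $k$-gon in $P$ if $X$ is a strictly convex $k$-gon and $P\cap\operatorname{conv}(X)=X$; an empty pentagon is an empty $5$-gon. ''$P$ contains $\ell$ collinear points'' means that there are $\ell$ distinct points of $P$ lying on a common line. *)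

(* Defs.v *)
From HB Require Import structures.
From mathcomp Require Export all_boot all_order all_algebra finmap.
From mathcomp Require Export boolp classical_sets reals convex.

Set Implicit Arguments.
Unset Strict Implicit.
Unset Printing Implicit Defensive.

Import Order.TTheory GRing.Theory Num.Theory.

Local Open Scope classical_set_scope.
Local Open Scope ring_scope.

Definition convex_hull (R : realType) (M : lmodType R) (X : set M) : set M :=
  smallest (@convex_set R M) X.

Definition corner (R : realType) (M : lmodType R) (X : set M) (x : M) : Prop :=
  X x /\ convex_hull (X `\ x) <> convex_hull X.

Definition strictly_convex_position (R : realType) (M : lmodType R)
    (X : set M) : Prop :=
  forall x : M, X x -> corner X x.

Definition strictly_convex_gon (R : realType) (M : lmodType R) (k : nat)
    (X : {fset M}) : Prop :=
  #|` X| = k /\ strictly_convex_position [set` X].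

Definition empty_gon (R : realType) (M : lmodType R) (k : nat)
    (P X : {fset M}) : Prop :=
  [/\ (X `<=` P)%fset, strictly_convex_gon k X &
      [set` P] `&` convex_hull [set` X] = [set` X]].

Definition is_line (R : realType) (M : lmodType R) (L : set M) : Prop :=
  exists p v : M, v != 0 /\ L = [set p + t *: v | t in [set: R]].

Definition contains_collinear (R : realType) (M : lmodType R) (l : nat)
    (P : {fset M}) : Prop :=
  exists S : {fset M},
    [/\ (S `<=` P)%fset, #|` S| = l &
        exists L : set M, is_line L /\ [set` S] `<=` L].

(* Main.v *)
Require Import Defs.
From mathcomp Require Import all_boot all_order all_algebra finmap.
From mathcomp Require Import boolp classical_sets reals convex.
From mathcomp Require Import unstable interval_inference zify ring lra.
From mathcomp Require Import fintype finset fingraph.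

Set Implicit Arguments.
Unset Strict Implicit.
Unset Printing Implicit Defensive.

Import Order.TTheory GRing.Theory Num.Theory.
Local Open Scope ring_scope.

(** Let P be the given set, assume that it has no empty pentagon and at most
    M = l - 1 points on every line, and call Q, a subset of P, closed when every
    other point of P is strictly separated from Q by a line.  The points of Q
    split into bnd Q, those on the boundary of the convex hull of Q, and inner Q;
    the set inner Q is closed again, so Q peels off into layers.

    Pentagons.  Five points, each strictly separated from the other four, such
    that no point of P is in the open interior of their hull yield an empty
    pentagon: as long as a point of P lies on an edge of the hull, it may replace
    an end of that edge (five_interior).  Two consequences carry the geometry.
    The points of Q beyond a line that supports inner Q and contains two points
    of inner Q are collinear (collinear_beyond_support), and the region beyond a
    side of an empty strictly convex quadrilateral, between the two adjacent
    sides, contains no point of P (quad_no_point_beyond).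

    Layers.  Seen from a point z in the innermost layer, the hull edges of
    inner Q divide the plane into sectors.  An open sector contains at most one
    point of bnd Q (sector_unique); a half-open one, with the ray of its first
    vertex w, may contain two, and w is then called unflanked.  In that case a
    quadrilateral spanned by the two layers sees no point of the next layer, so
    the next layer has an unflanked vertex on the same ray (unflanked_step).
    The ray thus meets every layer, there are at most M layers, and Q has at most
    K * M points when no closed set has more than K boundary points
    (unflanked_card).

    Cuts.  Removing the points beyond a set of edges of inner Q leaves a closed
    set whose boundary consists of the remaining points of bnd Q and the ends of
    these edges (gain).  For a smallest closed set with more than 24 * M boundary
    points every cut removes more points than it exposes.  The edges of inner Q
    then form runs, the points beyond each run being collinear; of two
    consecutive runs one contains an unflanked vertex, and the unflanked vertices
    lie on at most six supporting lines (unflanked_cover), each of which meets at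
    most two runs.  So there are at most 24 runs, hence K = 24 * M is possible
    (boundary_bound).

    Pinned sets.  If no cut of Q exposes more points than it removes, and there
    is no unflanked vertex in either orientation, then every sector contains
    exactly one point of bnd Q.  Either all these points are aligned with the
    vertices of inner Q, or none is, and in both cases the quadrilaterals between
    the two layers have regions beyond their outer sides that fill the outside of
    Q up to as many lines as Q has boundary points.  All points of P outside Q
    are on these lines (stuck_pinned), so there are at most M times #|bnd Q| of
    them.

    Count.  Take a smallest closed set Q that is pinned in this sense and go on
    with inner Q, which has as many boundary points; if there is no pinned set,
    start from P.  Cuts that expose more than they remove enlarge the boundary
    from b to K at most and remove at most b + (b + 1) + ... + (K - 1) points in
    total; when they stop, an unflanked vertex leaves at most K * M points.  With
    K = 24 * M the sum is smaller than 328 * l ^ 2 (card_bound). *)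

(** * Determinants and linear functionals *)

Section PlaneAlgebra.
Variable R : realFieldType.
Local Notation pt := (R * R)%type.
Implicit Types (u n o a b d p q r : pt).

Definition det3 p q r : R :=
  (q.1 - p.1) * (r.2 - p.2) - (q.2 - p.2) * (r.1 - p.1).

Definition lf u p : R := u.1 * p.1 + u.2 * p.2.

Definition rot u : pt := (- u.2, u.1).

(** The functional lf (nrm a b) vanishes on the direction of the line a b; it
    is det3 a b up to a constant. *)
Definition nrm a b : pt := (a.2 - b.2, b.1 - a.1).

Lemma det3E p q r : det3 p q r =
  (q.1 - p.1) * (r.2 - p.2) - (q.2 - p.2) * (r.1 - p.1).
Proof. by []. Qed.

Lemma det3_cyc p q r : det3 p q r = det3 q r p.
Proof. by rewrite /det3; ring. Qed.

Lemma det3_swap p q r : det3 p q r = - det3 q p r.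
Proof. by rewrite /det3; ring. Qed.

Lemma det3_swapr p q r : det3 p q r = - det3 p r q.
Proof. by rewrite /det3; ring. Qed.

Lemma det3_eql p q : det3 p p q = 0.
Proof. by rewrite /det3; ring. Qed.

Lemma det3_eqr p q : det3 p q q = 0.
Proof. by rewrite /det3; ring. Qed.

Lemma det3_eqm p q : det3 p q p = 0.
Proof. by rewrite /det3; ring. Qed.

Lemma det3_split o p q r : det3 p q r = det3 o p q + det3 o q r + det3 o r p.
Proof. by rewrite /det3; ring. Qed.

Lemma plucker o p q r s :
  det3 o p q * det3 o r s - det3 o p r * det3 o q s
    + det3 o p s * det3 o q r = 0.
Proof. by rewrite /det3; ring. Qed.

Lemma lf_bary u a b d q :
  det3 b d q * lf u a + det3 d a q * lf u b + det3 a b q * lf u d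
    = det3 a b d * lf u q.
Proof. by rewrite /det3 /lf; ring. Qed.

Lemma det3_bary a b d q s r :
  det3 b d q * det3 s r a + det3 d a q * det3 s r b + det3 a b q * det3 s r d
    = det3 a b d * det3 s r q.
Proof. by rewrite /det3; ring. Qed.

Lemma det3_bary1 a b d q :
  det3 b d q + det3 d a q + det3 a b q = det3 a b d.
Proof. by rewrite /det3; ring. Qed.

Lemma lf_nrm a b p : lf (nrm a b) p - lf (nrm a b) a = det3 a b p.
Proof. by rewrite /det3 /lf /nrm /=; ring. Qed.

Lemma lfN u p : lf (- u) p = - lf u p.
Proof. by rewrite /lf /=; ring. Qed.

Lemma lfDZ u n e p : lf (u.1 + e * n.1, u.2 + e * n.2) p = lf u p + e * lf n p.
Proof. by rewrite /lf /=; ring. Qed.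

Lemma pt_neq0 u : u != 0 -> 0 < u.1 ^+ 2 + u.2 ^+ 2.
Proof.
case: u => x y; rewrite -[(x, y) == 0]/((x == 0) && (y == 0)) negb_and /=.
by case/orP => h; [rewrite ltr_pwDl // ?sqr_ge0 // exprn_even_gt0
                  |rewrite ltr_wpDl // ?sqr_ge0 // exprn_even_gt0].
Qed.

Lemma sqr_pt_neq0 u : 0 < u.1 ^+ 2 + u.2 ^+ 2 -> u != 0.
Proof.
apply: contraTneq => ->; by rewrite /= expr0n /= addr0 ltxx.
Qed.

Lemma nrm_neq0 a b : a != b -> nrm a b != 0.
Proof.
apply: contra; case: a b => [a1 a2] [b1 b2].
rewrite -[nrm _ _ == 0]/((a2 - b2 == 0) && (b1 - a1 == 0)) !subr_eq0 => /andP[/eqP-> /eqP->].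
by [].
Qed.

Lemma lf_rot_inj u p q : u != 0 -> lf u p = lf u q ->
  lf (rot u) p = lf (rot u) q -> p = q.
Proof.
move=> /pt_neq0 h; case: p q u h => [p1 p2] [q1 q2] [u1 u2]; rewrite /lf /rot /= => h h1 h2.
have e1 : (u1 ^+ 2 + u2 ^+ 2) * (p1 - q1) = 0.
  have -> : (u1 ^+ 2 + u2 ^+ 2) * (p1 - q1) =
    u1 * ((u1 * p1 + u2 * p2) - (u1 * q1 + u2 * q2))
    - u2 * ((- u2 * p1 + u1 * p2) - (- u2 * q1 + u1 * q2)) by ring.
  by rewrite h1 h2; ring.
have e2 : (u1 ^+ 2 + u2 ^+ 2) * (p2 - q2) = 0.
  have -> : (u1 ^+ 2 + u2 ^+ 2) * (p2 - q2) =
    u2 * ((u1 * p1 + u2 * p2) - (u1 * q1 + u2 * q2))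
    + u1 * ((- u2 * p1 + u1 * p2) - (- u2 * q1 + u1 * q2)) by ring.
  by rewrite h1 h2; ring.
move/eqP: e1; move/eqP: e2; rewrite !mulf_eq0 gt_eqF //= !subr_eq0.
by move=> /eqP-> /eqP->.
Qed.

Lemma lf_level_det u p q r : u != 0 -> lf u q = lf u p -> lf u r = lf u p ->
  det3 p q r = 0.
Proof.
move=> /pt_neq0 h; case: p q r u h => [p1 p2] [q1 q2] [r1 r2] [u1 u2].
rewrite /lf /det3 /= => h h1 h2.
suff : (u1 ^+ 2 + u2 ^+ 2) * ((q1 - p1) * (r2 - p2) - (q2 - p2) * (r1 - p1)) = 0.
  by move/eqP; rewrite mulf_eq0 gt_eqF //= => /eqP.
have h1' : u1 * (q1 - p1) + u2 * (q2 - p2) = 0 by rewrite !mulrBr; lra.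
have h2' : u1 * (r1 - p1) + u2 * (r2 - p2) = 0 by rewrite !mulrBr; lra.
move: h1' h2'; set x := q1 - p1; set y := q2 - p2; set z := r1 - p1; set t := r2 - p2.
move=> e1 e2.
have -> : (u1 ^+ 2 + u2 ^+ 2) * (x * t - y * z) =
  (u1 * x + u2 * y) * (u1 * t - u2 * z) - (u1 * z + u2 * t) * (u1 * y - u2 * x)
    by ring.
by rewrite e1 e2; ring.
Qed.

(** Strict betweenness, stated through functionals because only their values
    are ever used. *)
Definition btw p a b :=
  exists2 l : R, 0 < l < 1 & forall u, lf u p = (1 - l) * lf u a + l * lf u b.

Lemma btw_level u p a b : u != 0 -> lf u a = lf u p -> lf u b = lf u p ->
  lf (rot u) a < lf (rot u) p < lf (rot u) b -> btw p a b.
Proof.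
move=> /pt_neq0 hu ha hb /andP[h1 h2].
set t := rot u in h1 h2.
have hab : 0 < lf t b - lf t a by lra.
exists ((lf t p - lf t a) / (lf t b - lf t a)).
  rewrite divr_gt0 /= ?ltr_pdivrMr //; lra.
move=> w; set l := _ / _.
have hl : l * (lf t b - lf t a) = lf t p - lf t a.
  by rewrite /l divfK // gt_eqF.
have key x : (u.1 ^+ 2 + u.2 ^+ 2) * lf w x =
    (w.1 * u.1 + w.2 * u.2) * lf u x + (w.2 * u.1 - w.1 * u.2) * lf t x.
  by rewrite /lf /t /rot /=; ring.
apply: (@mulfI _ (u.1 ^+ 2 + u.2 ^+ 2)); first by rewrite gt_eqF.
have -> : (u.1 ^+ 2 + u.2 ^+ 2) * ((1 - l) * lf w a + l * lf w b) =
  (1 - l) * ((u.1 ^+ 2 + u.2 ^+ 2) * lf w a) + l * ((u.1 ^+ 2 + u.2 ^+ 2) * lf w b) by ring.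
rewrite !key ha hb.
have -> : lf t p = lf t a + l * (lf t b - lf t a) by rewrite hl; ring.
ring.
Qed.

End PlaneAlgebra.

Lemma card_bigcup_le (I T : finType) (P : pred I) (F : I -> {set T}) :
  (#|\bigcup_(i | P i) F i| <= \sum_(i | P i) #|F i|)%N.
Proof.
elim/big_rec2: _ => [|i m A _ le]; first by rewrite cards0.
by apply: leq_trans (leq_card_setU _ _) _; rewrite leq_add2l.
Qed.

(** * Separation and empty pentagons *)

Section Separation.
Variable R : realFieldType.
Local Notation pt := (R * R)%type.
Variables (T : finType) (c : T -> pt).
Implicit Types (Q S : {set T}) (p o : pt).

(** Membership in the closed complement of the interior of the hull of Q: some
    line through p has Q on one side.  On a point of Q it says that p is on
    the boundary of the hull. *)
Definition wsep Q p : Prop :=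
  exists2 u : pt, u != 0 & forall q, q \in Q -> lf u (c q) <= lf u p.

Definition ssep Q p : Prop :=
  exists u : pt, forall q, q \in Q -> lf u (c q) < lf u p.

Lemma ssepS S Q p : S \subset Q -> ssep Q p -> ssep S p.
Proof. by move=> /subsetP h [u hu]; exists u => q /h; exact: hu. Qed.

Lemma wsepS S Q p : S \subset Q -> wsep Q p -> wsep S p.
Proof. by move=> /subsetP h [u u0 hu]; exists u => // q /h; exact: hu. Qed.

Lemma wsep0 p : wsep set0 p.
Proof.
exists (1, 0); last by move=> q; rewrite inE.
by rewrite -[_ == _]/((1 == 0 :> R) && (0 == 0 :> R)) oner_eq0.
Qed.

Lemma ssep_wsep Q p : ssep Q p -> wsep Q p.
Proof.
have [->|[q hq]] := set_0Vmem Q; first by move=> _; apply: wsep0.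
move=> [u hu]; exists u; last by move=> r /hu /ltW.
apply: contraTneq (hu q hq) => ->; by rewrite /lf /= !mul0r ltxx.
Qed.

Lemma wsep_det Q p a b : a != b ->
  (forall q, q \in Q -> det3 a b p <= det3 a b (c q)) -> wsep Q p.
Proof.
move=> ab h; exists (- nrm a b).
  by rewrite oppr_eq0 nrm_neq0.
move=> q /h; rewrite -!lf_nrm !lfN; lra.
Qed.

Lemma ssep_det Q p a b :
  (forall q, q \in Q -> det3 a b p < det3 a b (c q)) -> ssep Q p.
Proof.
move=> h; exists (- nrm a b) => q /h; rewrite -!lf_nrm !lfN; lra.
Qed.

(** A lexicographic comparison of finitely many pairs is realised by one
    positive perturbation. *)
Lemma small_eps (s : seq (R * R)) :
  (forall x, x \in s -> 0 < x.1 \/ (x.1 = 0 /\ 0 < x.2)) ->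
  exists2 e : R, 0 < e & forall e', 0 < e' <= e -> forall x, x \in s -> 0 < x.1 + e' * x.2.
Proof.
elim: s => [|x s ih] h; first by exists 1.
have [|e e0 he] := ih; first by move=> y ys; apply: h; rewrite inE ys orbT.
have [x1|[x1 x2]] := h x (mem_head _ _); last first.
  exists e => // e' he' y; rewrite inE => /orP[/eqP->|]; last exact: he.
  by case/andP: he' => he' _; rewrite x1 add0r mulr_gt0.
pose d := x.1 / (1 + `|x.2|).
have d0 : 0 < d by rewrite divr_gt0 // ltr_pwDl.
exists (Num.min e d); first by rewrite lt_min e0 d0.
move=> e' /andP[e'0]; rewrite le_min => /andP[e'e e'd] y.
rewrite inE => /orP[/eqP->|]; last by apply: he; rewrite e'0.
have : e' * (1 + `|x.2|) <= x.1 by rewrite -ler_pdivlMr // ltr_pwDl.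
have : - x.2 <= `|x.2| by rewrite -normrN ler_norm.
nra.
Qed.

(** A supporting line at p is turned slightly about p; this is how every point
    is separated from a finite set below. *)
Lemma ssep_tilt Q p (n t : pt) :
  (forall q, q \in Q -> lf n (c q) < lf n p \/
     (lf n (c q) = lf n p /\ lf t (c q) < lf t p)) -> ssep Q p.
Proof.
move=> h.
pose f q : R * R := (lf n p - lf n (c q), lf t p - lf t (c q)).
have [|e e0 he] := @small_eps [seq f q | q <- enum Q].
  move=> x /mapP[q]; rewrite mem_enum => qQ ->; rewrite /f /=.
  by case: (h q qQ) => [h1|[h1 h2]]; [left|right]; lra.
exists (n.1 + e * t.1, n.2 + e * t.2) => q qQ; rewrite !lfDZ.
have := he e _ (f q) _; rewrite e0 lexx => /(_ isT) hh.
have := hh _; rewrite /f /=.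
have -> : (lf n p - lf n (c q), lf t p - lf t (c q)) \in [seq f q | q <- enum Q].
  by apply/mapP; exists q; rewrite ?mem_enum.
by move=> /(_ isT); lra.
Qed.

Lemma btw_not_ssep S p a b : a \in S -> b \in S -> btw p (c a) (c b) -> ~ ssep S p.
Proof.
move=> aS bS [l /andP[l0 l1] h] [u hu]; have := h u; have := hu _ aS; have := hu _ bS.
nra.
Qed.

Definition five_exposed S := #|S| = 5%N /\ forall x, x \in S -> ssep (S :\ x) (c x).

Hypothesis cI : injective c.
Hypothesis H5 : forall S, five_exposed S -> exists2 p : T, p \notin S & ~ ssep S (c p).

(** Otherwise choose such a five-point set with as few points of T in its hull
    as possible.  A point p of the hull outside the set is on an edge a b of
    the hull, strictly inside that edge, and replacing a by p gives a set
    whose hull is smaller and misses a. *)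
Lemma five_interior S : five_exposed S -> exists q, ~ wsep S (c q).
Proof.
pose N S := [set q | ~~ `[< ssep S (c q) >]].
have [n] := ubnP #|N S|; elim: n S => // n ih S hn HS; apply: contrapT => hw.
have {}hw (p : T) : wsep S (c p) by apply: contrapT => h; apply: hw; exists p.
have [p pS pn] := H5 HS; have [u u0 hu] := hw p.
have [S5 hS] := HS.
pose t := rot u.
have side (t' : pt) : (t' = t \/ t' = - t) ->
  exists2 b, b \in S & lf u (c b) = lf u (c p) /\ lf t' (c p) < lf t' (c b).
  move=> ht; apply: contrapT => hno; apply: pn; apply: (@ssep_tilt _ _ u t') => q qS.
  have := hu q qS; rewrite le_eqVlt => /orP[/eqP e|]; last by left.
  right; split=> //; rewrite ltNge le_eqVlt; apply/negP => /orP[/eqP e'|l].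
    suff E : p = q by rewrite E qS in pS.
    apply/cI/(lf_rot_inj u0); first by rewrite e.
    by case: ht e' => ->; rewrite ?lfN // => /oppr_inj.
  by apply: hno; exists q.
have [b bS [bu bt]] := side t (or_introl erefl).
have [a aS [au]] := side (- t) (or_intror erefl).
rewrite !lfN ltrN2 => at'.
have pab : btw (c p) (c a) (c b) by apply: (btw_level u0) => //; rewrite at' bt.
have ab : a != b by apply: contraTneq at' => ->; rewrite -leNgt ltW.
have pa : p != a by apply: contraNneq pS => ->.
pose S' := p |: (S :\ a).
have S'sub q : q \in S' -> q = p \/ (q \in S /\ q != a).
  by rewrite !inE => /orP[/eqP->|/andP[-> ->]]; [left|right].
have conv w : (lf w (c a) <= lf w (c p)) || (lf w (c b) <= lf w (c p)).
  case: pab => l /andP[l0 l1] /(_ w) h.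
  apply/orP; case: (lerP (lf w (c a)) (lf w (c p))) => ha; [by left|right]; nra.
have S'ss q : ssep S (c q) -> ssep S' (c q).
  move=> [w hw']; exists w => r /S'sub[->|[rS _]]; last exact: hw'.
  case: pab => l /andP[l0 l1] /(_ w) h; have := hw' a aS; have := hw' b bS; nra.
have HS' : five_exposed S'.
  split.
    rewrite cardsU1 !inE negb_and pS orbT /= add1n.
    by have := cardsD1 a S; rewrite aS S5 add1n => -[<-].
  move=> x /S'sub[->|[xS xa]].
    apply: (@ssep_tilt _ _ u (- t)) => q; rewrite !inE.
    move=> /andP[qp /orP[|/andP[qa qS]]]; first by rewrite (negbTE qp).
    have := hu q qS; rewrite le_eqVlt => /orP[/eqP e|]; last by left.
    right; split=> //; rewrite !lfN ltrN2 ltNge; apply/negP => le.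
    have lt_ : lf t (c q) < lf t (c p).
      rewrite lt_neqAle le andbT; apply: contra qp => /eqP e'.
      by apply/eqP/cI/(lf_rot_inj u0).
    have qb : q != b by apply: contraTneq lt_ => ->; rewrite -leNgt ltW.
    case: (ltgtP (lf t (c q)) (lf t (c a))) => hqa.
    - apply: (@btw_not_ssep (S :\ a) (c a) q b); rewrite ?inE ?qa ?qS ?bS ?andbT 1?eq_sym //.
        by apply: (btw_level u0); rewrite ?e ?bu ?au // hqa /=; apply: lt_trans bt.
      exact: hS.
    - apply: (@btw_not_ssep (S :\ q) (c q) a b); rewrite ?inE ?aS ?bS ?andbT 1?eq_sym //.
        by apply: (btw_level u0); rewrite ?e ?bu ?au // hqa /=; apply: lt_trans bt.
      exact: hS.
    - by case/eqP: qa; apply/cI/(lf_rot_inj u0); rewrite ?e ?au.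
  have [g hg] := hS x xS; exists g => q; rewrite !inE => /andP[qx].
  case/orP => [/eqP->|/andP[qa qS]]; last by apply: hg; rewrite !inE qx.
  case: pab => l /andP[l0 l1] /(_ g) ->.
  have ha : lf g (c a) < lf g (c x) by apply: hg; rewrite !inE eq_sym xa.
  case: (eqVneq b x) => [->|bx]; first by nra.
  have hb : lf g (c b) < lf g (c x) by apply: hg; rewrite !inE bx.
  nra.
have S'w q : wsep S' (c q).
  have [w w0 hw'] := hw q; exists w => // r /S'sub[->|[rS _]]; last exact: hw'.
  case: pab => l /andP[l0 l1] /(_ w) h; have := hw' a aS; have := hw' b bS; nra.
have [|q] := ih S' _ HS'; last by move/(_ (S'w q)).
rewrite -ltnS; apply: leq_trans hn; rewrite ltnS; apply: proper_card.
apply/properP; split.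
  apply/subsetP => q; rewrite !inE; apply: contra => /asboolP h; apply/asboolP; exact: S'ss.
exists a; rewrite !inE ?negbK.
  by apply/asboolP => -[w /(_ a aS)]; rewrite ltxx.
apply/asboolP; have [g hg] := hS a aS; exists g => q /S'sub[->|[qS qa]].
  have hb : lf g (c b) < lf g (c a) by apply: hg; rewrite !inE eq_sym ab.
  case: pab => l /andP[l0 l1] /(_ g) ->; nra.
by apply: hg; rewrite !inE qa.
Qed.

End Separation.

Ltac dbase := first [assumption | apply: ltW; assumption].
Ltac dcyc3 := first [dbase | rewrite det3_cyc; dbase | rewrite -det3_cyc; dbase].
Ltac dsgn := solve [dcyc3
  | rewrite det3_swap ?oppr_gt0 ?oppr_ge0 ?oppr_lt0 ?oppr_le0; dcyc3].

(** * Boundary points and inner points *)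

Section Interior.
Variable R : realFieldType.
Local Notation pt := (R * R)%type.
Variables (T : finType) (c : T -> pt).
Implicit Types (Q S : {set T}) (o : pt).
Local Notation "'D' p q r" := (det3 (c p) (c q) (c r))
  (at level 10, p, q, r at level 9).

Definition interior Q := [set z in Q | ~~ `[< wsep c Q (c z) >]].
Definition boundary Q := Q :\: interior Q.
(** The subsets of T that are traces of convex sets. *)
Definition convex_closed Q := forall p : T, p \notin Q -> ssep c Q (c p).
Local Notation inner := interior.
Local Notation bnd := boundary.
Local Notation closed := convex_closed.

Lemma innerP Q (z : T) : reflect (z \in Q /\ ~ wsep c Q (c z)) (z \in inner Q).
Proof.
rewrite inE; apply: (iffP andP) => -[zQ]; first by move/asboolP.
by move=> h; split=> //; apply/asboolP.
Qed.

Lemma bndE Q (z : T) : reflect (z \in Q /\ wsep c Q (c z)) (z \in bnd Q).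
Proof.
rewrite !inE; apply: (iffP andP).
  by rewrite negb_and negbK => -[/orP[/negbTE->//|/asboolP h] zQ].
by move=> [zQ h]; rewrite zQ /= negbK; split=> //; apply/asboolP.
Qed.

Lemma inner_sub Q : inner Q \subset Q.
Proof. by apply/subsetP => z /innerP[]. Qed.

Lemma bnd_sub Q : bnd Q \subset Q.
Proof. exact: subsetDl. Qed.

Lemma innerQ Q z : z \in inner Q -> z \in Q.
Proof. by case/innerP. Qed.

Lemma bndQ Q z : z \in bnd Q -> z \in Q.
Proof. by case/bndE. Qed.

Lemma inner_nwsep Q (z : T) : z \in inner Q -> ~ wsep c Q (c z).
Proof. by case/innerP. Qed.

Lemma bnd_inner Q z : z \in bnd Q -> z \in inner Q -> False.
Proof. by rewrite inE => /andP[/negP]. Qed.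

Lemma bnd_or Q z : z \in Q -> z \in bnd Q \/ z \in inner Q.
Proof. by move=> zQ; rewrite [z \in bnd Q]inE zQ andbT; case: (z \in inner Q); [right|left]. Qed.

Lemma card_bnd_inner Q : #|Q| = (#|bnd Q| + #|inner Q|)%N.
Proof.
by rewrite -(cardsID (inner Q) Q) (setIidPr (inner_sub Q)) addnC.
Qed.

Lemma bnd_support Q q : q \in bnd Q -> exists u : pt, [/\ u != 0,
  forall r, r \in Q -> lf u (c r) <= lf u (c q) &
  forall o, ~ wsep c Q o -> lf u o < lf u (c q)].
Proof.
move=> /bndE[qQ [u u0 hu]]; exists u; split=> // o ho.
rewrite ltNge; apply/negP => le; apply: ho; exists u => // r /hu h; exact: le_trans le.
Qed.

(** A line supporting Q at a boundary point p contains no inner point of Q, so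
    it separates p strictly from the inner points. *)
Lemma inner_closed Q : closed Q -> closed (inner Q).
Proof.
move=> hQ p pn; have [pQ|pQ] := boolP (p \in Q); last first.
  exact: ssepS (inner_sub Q) (hQ p pQ).
have /bnd_support[u [u0 _ hu]] : p \in bnd Q by rewrite inE pn.
by exists u => q /inner_nwsep; exact: hu.
Qed.

(** A functional maximal at q over Q is smaller at o, so q is no convex
    combination that gives o a positive weight. *)
Lemma bnd_not_in_triangle Q o q a b : ~ wsep c Q o -> q \in bnd Q -> a \in Q -> b \in Q ->
  0 <= det3 o (c a) (c q) -> 0 <= det3 o (c q) (c b) -> 0 < det3 o (c a) (c b) ->
  D a b q <= 0.
Proof.
move=> ho /bnd_support[u [u0 hu hu']] aQ bQ h1 h2 h3; rewrite leNgt; apply/negP => h.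
have e := lf_bary u o (c a) (c b) (c q).
have e1 := det3_bary1 o (c a) (c b) (c q).
move: e e1 (hu _ aQ) (hu _ bQ) (hu' _ ho) h1 h2 h3 h.
rewrite (det3_cyc (c b) o (c q)).
move: (D a b q) (det3 o (c q) (c b)) (det3 o (c a) (c q)) (det3 o (c a) (c b))
  (lf u o) (lf u (c a)) (lf u (c b)) (lf u (c q)) => A B C S fo fa fb fq.
move=> e e1 ha hb hoo hC hB hS hA; nra.
Qed.

(** Two boundary points on one ray from an interior point coincide; b only
    serves to tell the ray from its opposite. *)
Lemma bnd_same_ray Q o q q' (b : pt) : injective c -> ~ wsep c Q o -> q \in bnd Q -> q' \in bnd Q ->
  det3 o (c q) (c q') = 0 -> 0 < det3 o (c q) b -> 0 < det3 o (c q') b -> q = q'.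
Proof.
move=> cI ho qb q'b e h h'.
have key r s : det3 o (c r) (c s) = 0 -> 0 < det3 o (c r) b -> 0 < det3 o (c s) b ->
   forall u, det3 o (c r) b * (lf u (c s) - lf u o) = det3 o (c s) b * (lf u (c r) - lf u o).
  move=> e0 _ _ u.
  have -> : det3 o (c s) b * (lf u (c r) - lf u o) = det3 o (c r) b * (lf u (c s) - lf u o) 
     - det3 o (c r) (c s) * (lf u b - lf u o).
    by rewrite /det3 /lf; ring.
  by rewrite e0 mul0r subr0.
have le r s : r \in bnd Q -> s \in bnd Q -> det3 o (c r) (c s) = 0 -> 0 < det3 o (c r) b ->
   0 < det3 o (c s) b -> det3 o (c s) b <= det3 o (c r) b.
  move=> /bnd_support[u [u0 hu hu']] sb e0 hr hs.
  have := key _ _ e0 hr hs u; have := hu _ (bndQ sb); have := hu' _ ho; nra.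
have e' : det3 o (c q') (c q) = 0 by rewrite det3_swapr e oppr0.
have E : det3 o (c q) b = det3 o (c q') b by apply/le_anti; rewrite !le.
apply: cI; have k := key _ _ e h h'.
have k1 := k (1, 0); have k2 := k (0, 1).
move: k1 k2; rewrite E => /mulfI k1 /mulfI k2.
have {k1} := k1 (lt0r_neq0 h'); have {k2} := k2 (lt0r_neq0 h'); rewrite /lf /= => h1 h2.
by apply/eqP; rewrite -[_ == _]/((_ == _) && (_ == _)); apply/andP; split; apply/eqP; lra.
Qed.

Hypothesis cI : injective c.
Hypothesis H5 : forall S, five_exposed c S -> exists2 p : T, p \notin S & ~ ssep c S (c p).

Lemma D_neq a b d : D a b d != 0 -> [/\ a != b, b != d & a != d].
Proof.
by move=> h; split; apply: contraNneq h => ->; rewrite ?det3_eql ?det3_eqr ?det3_eqm.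
Qed.

(** Two points on a line are exposed by tilting that line, whatever lies
    strictly on one side. *)
Lemma five_exposed_cap (n : pt) k x y a b d :
  let S := [set x; y; a; b; d] in
  n != 0 -> x != y -> lf n (c x) = k -> lf n (c y) = k ->
  k < lf n (c a) -> k < lf n (c b) -> k < lf n (c d) ->
  a != b -> b != d -> a != d ->
  ssep c (S :\ a) (c a) -> ssep c (S :\ b) (c b) -> ssep c (S :\ d) (c d) ->
  five_exposed c S.
Proof.
move=> S n0 xy xk yk ka kb kd ab bd ad ea eb ed.
have outx z q : lf n (c z) = k -> k < lf n (c q) -> z != q.
  by move=> e; apply: contraTneq => <-; rewrite e ltxx.
split.
  rewrite /S -!setUA !cardsU1 cards1 !inE !negb_or.
  by rewrite xy ab bd ad !outx.
have exy z w : [set z; w] = [set x; y] -> z != w -> ssep c (S :\ z) (c z).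
  move=> E zw.
  have zS : z \in [set x; y] by rewrite -E !inE eqxx.
  have wS : w \in [set x; y] by rewrite -E !inE eqxx orbT.
  have zk : lf n (c z) = k by move: zS; rewrite !inE => /orP[]/eqP->.
  have wk : lf n (c w) = k by move: wS; rewrite !inE => /orP[]/eqP->.
  have mem q : q \in S :\ z -> q = w \/ k < lf n (c q).
    rewrite !inE => /andP[qz].
    have : (q == x) || (q == y) -> q = w.
      move=> qxy; have : q \in [set z; w] by rewrite E !inE.
      by rewrite !inE (negbTE qz) => /eqP.
    case: (q == x); first by move=> /(_ isT); left.
    case: (q == y); first by move=> /(_ isT); left.
    by move=> _ /= /orP[/orP[]|] /eqP->; right.
  have tn : lf (rot n) (c w) != lf (rot n) (c z).
    apply: contra zw => /eqP e; apply/eqP/cI/(lf_rot_inj n0) => //.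
    by rewrite zk wk.
  have [tl|tl] := ltP (lf (rot n) (c w)) (lf (rot n) (c z)).
    apply: (@ssep_tilt _ _ _ _ _ (- n) (rot n)) => q /mem[->|kq].
      by right; rewrite !lfN zk wk.
    by left; rewrite !lfN zk ltrN2.
  apply: (@ssep_tilt _ _ _ _ _ (- n) (- rot n)) => q /mem[->|kq].
    by right; rewrite !lfN zk wk ltrN2 lt_neqAle eq_sym tn tl.
  by left; rewrite !lfN zk ltrN2.
move=> z; rewrite [z \in S]inE !inE -!orbA => /or4P[/eqP->|/eqP->|/eqP->|/orP[]/eqP->] //.
- exact: (exy x y).
- by apply: (exy y x); rewrite 1?eq_sym // setUC.
Qed.

(** Three points beyond the line that are not collinear would form with x and
    y an exposed five-point set: at most one of the other two can share a
    supporting line with the third.  No point of T is interior to its hull,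
    since the inner points of Q are on the other side of the line. *)
Lemma collinear_beyond_support Q (n : pt) k x y a b d : closed Q ->
  (forall q, q \in inner Q -> lf n (c q) <= k) ->
  x \in inner Q -> y \in inner Q -> x != y -> lf n (c x) = k -> lf n (c y) = k ->
  a \in Q -> b \in Q -> d \in Q ->
  k < lf n (c a) -> k < lf n (c b) -> k < lf n (c d) -> D a b d = 0.
Proof.
move=> cQ hn xI yI xy xk yk aQ bQ dQ ka kb kd; apply: contrapT => /eqP abd.
have n0 : n != 0.
  by apply: contraTneq ka => n0; rewrite -xk n0 /lf /= !mul0r ltxx.
have out q : q \in Q -> k < lf n (c q) -> q \in bnd Q.
  move=> qQ kq; case: (bnd_or qQ) => // /hn; rewrite leNgt => /negP; by [].
pose S := [set x; y; a; b; d].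
have [ab bd ad] := D_neq abd.
have S5 : five_exposed c S.
  have eabd p q r : D p q r != 0 -> p \in Q -> q \in Q -> r \in Q ->
     k < lf n (c p) -> {subset S <= [:: x; y; p; q; r]} -> ssep c (S :\ p) (c p).
    move=> hD pQ qQ rQ kp hS; have [u [u0 hu hu']] := bnd_support (out _ pQ kp).
    have [pq qr pr] := D_neq hD.
    have one : lf u (c q) < lf u (c p) \/ lf u (c r) < lf u (c p).
      case: (ltP (lf u (c q)) (lf u (c p))) => [|h1]; first by left.
      case: (ltP (lf u (c r)) (lf u (c p))) => [|h2]; first by right.
      case/eqP: hD; apply: (lf_level_det u0); apply: le_anti; rewrite ?h1 ?h2 hu //.
    have mem s : s \in S :\ p -> [\/ lf u (c s) < lf u (c p), s = q | s = r].
      rewrite inE => /andP[sp /hS]; rewrite !inE in sp *.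
      rewrite (negbTE sp) => /or4P[/eqP->|/eqP->| //|/orP[]/eqP->].
      - by constructor 1; apply: hu'; apply: inner_nwsep.
      - by constructor 1; apply: hu'; apply: inner_nwsep.
      - by constructor 2.
      - by constructor 3.
    have gen s t : p != s -> lf u (c s) <= lf u (c p) -> lf u (c t) < lf u (c p) -> 
      (forall w, w \in S :\ p -> [\/ lf u (c w) < lf u (c p), w = s | w = t]) -> ssep c (S :\ p) (c p).
      move=> ps; rewrite le_eqVlt => /orP[/eqP es lt_t|ls lt_t] hm; last first.
        by exists u => w /hm[|->|->].
      have tn : lf (rot u) (c s) != lf (rot u) (c p).
        by apply: contra ps => /eqP e; apply/eqP/cI/(lf_rot_inj u0).
      have [tl|tl] := ltP (lf (rot u) (c s)) (lf (rot u) (c p)).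
        by apply: (@ssep_tilt _ _ _ _ _ u (rot u)) => w /hm[|->|->]; [left|right|left].
      apply: (@ssep_tilt _ _ _ _ _ u (- rot u)) => w /hm[|->|->]; [by left| |by left].
      by right; rewrite !lfN ltrN2 lt_neqAle eq_sym tn tl.
    case: one => h.
      by apply: (gen r q) => //; [exact: hu|move=> w /mem[]; [constructor 1|constructor 3|constructor 2]].
    by apply: (gen q r) => //; exact: hu.
  apply: (five_exposed_cap n0 xy xk yk ka kb kd ab bd ad).
  - by apply: (eabd a b d) => // s; rewrite !inE -!orbA.
  - apply: (eabd b a d) => //; first by rewrite det3_swap oppr_eq0.
    by move=> s; rewrite !inE -!orbA; do !case: (_ == _) => //.
  - apply: (eabd d a b) => //; first by rewrite det3_cyc.
    by move=> s; rewrite !inE -!orbA; do !case: (_ == _) => //.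
have [p] := five_interior cI H5 S5; apply.
have SQ : S \subset Q.
  by apply/subsetP => s; rewrite !inE -!orbA => /or4P[/eqP->|/eqP->|/eqP->|/orP[]/eqP->] //; apply: innerQ.
have [pQ|pQ] := boolP (p \in Q); last first.
  exact/(wsepS SQ)/ssep_wsep/cQ.
have [/bndE[_ h]|pI] := bnd_or pQ; first exact: wsepS SQ h.
exists (- n); first by rewrite oppr_eq0.
move=> s; rewrite !lfN lerN2 => sS; apply: le_trans (hn _ pI) _.
by move: sS; rewrite !inE -!orbA => /or4P[/eqP->|/eqP->|/eqP->|/orP[]/eqP->]; rewrite ?xk ?yk // ltW.
Qed.

(** The orientation of all triples expresses that the five points are in
    strictly convex position, in this cyclic order. *)
Lemma pentagon_interior (p1 p2 p3 p4 p5 : T) :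
  0 < D p1 p2 p3 -> 0 < D p1 p2 p4 -> 0 < D p1 p2 p5 -> 0 < D p1 p3 p4 -> 0 < D p1 p3 p5 ->
  0 < D p1 p4 p5 -> 0 < D p2 p3 p4 -> 0 < D p2 p3 p5 -> 0 < D p2 p4 p5 -> 0 < D p3 p4 p5 ->
  exists q, [/\ 0 < D p1 p2 q, 0 < D p2 p3 q, 0 < D p3 p4 q, 0 < D p4 p5 q & 0 < D p5 p1 q].
Proof.
move=> h123 h124 h125 h134 h135 h145 h234 h235 h245 h345.
pose S := [set p1; p2; p3; p4; p5].
have neq a b d : 0 < D a b d -> [/\ a != b, b != d & a != d].
  by move=> h; apply: D_neq; rewrite gt_eqF.
have [n12 n23 n13] := neq _ _ _ h123; have [n14 n45 n15] := neq _ _ _ h145.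
have [n24 _ n25] := neq _ _ _ h245; have [n34 _ n35] := neq _ _ _ h345.
have mem (q : T) : q \in S -> [\/ q = p1, q = p2 | [\/ q = p3, q = p4 | q = p5]].
  rewrite !inE -!orbA => /or4P[/eqP->|/eqP->|/eqP->|/orP[]/eqP->].
  - by constructor 1.
  - by constructor 2.
  - by constructor 3; constructor 1.
  - by constructor 3; constructor 2.
  - by constructor 3; constructor 3.
have exp_ (w v u' a b : T) : D w u' v < 0 -> 0 <= D w u' a -> 0 <= D w u' b ->
    {subset S <= [:: v; w; u'; a; b]} -> ssep c (S :\ v) (c v).
  move=> hv ha hb hm; apply: (@ssep_det _ _ _ _ _ (c w) (c u')) => q; rewrite in_setD1.
  move=> /andP[qv /hm]; rewrite !in_cons in_nil orbF (negbTE qv) /=.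
  move=> /or4P[]/eqP->; rewrite ?det3_eqm ?det3_eqr //.
    exact: lt_le_trans ha.
  exact: lt_le_trans hb.
have S5 : five_exposed c S.
  split.
    rewrite /S -!setUA !cardsU1 cards1 !inE !negb_or.
    by rewrite n12 n13 n14 n15 n23 n24 n25 n34 n35 n45.
  move=> x /mem[->|->|[->|->|->]];
    [apply: (exp_ p5 p1 p2 p3 p4)|apply: (exp_ p1 p2 p3 p4 p5)
    |apply: (exp_ p2 p3 p4 p5 p1)|apply: (exp_ p3 p4 p5 p1 p2)
    |apply: (exp_ p4 p5 p1 p2 p3)]; first [dsgn|idtac];
  by move=> q; rewrite !inE -!orbA; do !case: (_ == _).
have [q hq] := five_interior cI H5 S5; exists q.
have pos (a b : T) : a != b -> (forall s, s \in S -> 0 <= D a b s) -> 0 < D a b q.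
  move=> ab h; rewrite ltNge; apply/negP => le; apply: hq.
  apply: (@wsep_det _ _ _ _ _ (c a) (c b)); first by rewrite (inj_eq cI).
  by move=> s /h; apply: le_trans.
split; apply: pos; rewrite // 1?eq_sym // => s /mem[->|->|[->|->|->]];
  rewrite ?det3_eqr ?det3_eqm // ?ltW //; by [rewrite det3_cyc|rewrite -det3_cyc].
Qed.

End Interior.

(* Opaque determinants keep arithmetic tactics from comparing coordinates. *)
Opaque det3.

(** * Empty quadrilaterals *)

Section QuadOut.
Variable R : realFieldType.
Local Notation pt := (R * R)%type.

Lemma ex_max (I : finType) (P : pred I) (F : I -> R) i0 : P i0 ->
  exists2 i, P i & forall j, P j -> F j <= F i.
Proof. by move=> Pi0; case: (arg_maxP F Pi0) => i Pi h; exists i. Qed.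

Lemma ex_min (I : finType) (P : pred I) (F : I -> R) i0 : P i0 ->
  exists2 i, P i & forall j, P j -> F i <= F j.
Proof. by move=> Pi0; case: (arg_minP F Pi0) => i Pi h; exists i. Qed.

Variables (T : finType) (c : T -> pt).
Implicit Types (Q S : {set T}) (o : pt).
Local Notation "'D' p q r" := (det3 (c p) (c q) (c r))
  (at level 10, p, q, r at level 9).
Hypothesis cI : injective c.
Hypothesis H5 : forall S, five_exposed c S -> exists2 p : T, p \notin S & ~ ssep c S (c p).

(** Among the points beyond the side a b choose one, p, nearest to that line.
    The pentagon a p b d e is strictly convex; a point in its interior is
    either in the quadrilateral or nearer to the side than p. *)
Lemma quad_no_point_beyond (a b d e : T) :
  0 < D a b d -> 0 < D b d e -> 0 < D d e a -> 0 < D e a b ->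
  (forall q, 0 <= D a b q -> 0 < D b d q -> 0 < D d e q -> 0 < D e a q -> False) ->
  forall p, D a b p < 0 -> 0 < D b d p -> 0 < D e a p -> False.
Proof.
move=> abd bde dea eab emp p0 h1 h2 h3.
pose P p := [&& D a b p < 0, 0 < D b d p & 0 < D e a p].
have [|p /and3P[pab pbd pea] pmax] := @ex_max T P (fun p => D a b p) p0.
  by rewrite /P h1 h2 h3.
have apb : 0 < D a p b by rewrite det3_swapr; lra.
have apd : 0 < D a p d.
  have := plucker (c a) (c p) (c b) (c d) (c e).
  have : 0 < D a d e by dsgn.
  have : 0 < D a b e by dsgn.
  have : 0 < D a p e by dsgn.
  by move: (D a p d) => x; nra.
have bap : 0 < D b a p by dsgn.
have pbe : 0 < D p b e.
  have := plucker (c b) (c d) (c e) (c a) (c p).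
  have : 0 < D b e a by dsgn.
  have : 0 < D b d a by dsgn.
  rewrite (det3_cyc (c p)).
  by move: (D b e p) => x; nra.
have pde : 0 < D p d e.
  have := plucker (c d) (c e) (c a) (c p) (c b).
  have : 0 < D d a p by dsgn.
  have : 0 < D d p b by dsgn.
  have : 0 < D d e b by dsgn.
  have : 0 < D d a b by dsgn.
  rewrite (det3_cyc (c p)).
  by move: (D d e p) => x; nra.
have [||||||||||q [q1 q2 q3 q4 q5]] := @pentagon_interior _ _ _ cI H5 a p b d e.
1-10: by dsgn.
have [l|g] := ltP (D a b q) 0; last exact: (emp q).
have := pmax q; rewrite /P l q3 q5 => /(_ isT).
have := det3_bary1 (c a) (c p) (c b) (c q).
have -> : D b a q = - D a b q by apply: det3_swap.
have -> : D a p b = - D a b p by apply: det3_swapr.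
move: q1 q2; lra.
Qed.


End QuadOut.

(** * Hull edges seen from a centre *)

Section Edges.
Variable R : realFieldType.
Local Notation pt := (R * R)%type.
Variables (T : finType) (c : T -> pt).
Implicit Types (Q S : {set T}) (o : pt) (a b q r v w x : T).
Local Notation "'D' p q r" := (det3 (c p) (c q) (c r))
  (at level 10, p, q, r at level 9).
Local Notation "'E' o p q" := (det3 o (c p) (c q))
  (at level 10, o, p, q at level 9).

(** An oriented pair of consecutive boundary points of Q, counterclockwise
    about the interior point o. *)
Definition hull_edge o Q a b : bool :=
  [&& a \in Q, b \in Q, 0 < E o a b, [forall r in Q, 0 <= D a b r] &
      [forall r in Q, ~~ [&& 0 < E o a r, 0 < E o r b & D a b r == 0]]].

Variant edge_spec o Q a b : Prop := EdgeSpec of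
  a \in Q & b \in Q & 0 < E o a b & (forall r, r \in Q -> 0 <= D a b r) &
  (forall r, r \in Q -> 0 < E o a r -> 0 < E o r b -> 0 < D a b r).

Lemma edgeP o Q a b : reflect (edge_spec o Q a b) (hull_edge o Q a b).
Proof.
apply: (iffP and5P) => [[aQ bQ ab /forall_inP h1 /forall_inP h2]|[aQ bQ ab h1 h2]].
  split=> // r rQ h h'; rewrite lt_neqAle h1 // andbT.
  by apply/eqP => e; have := h2 r rQ; rewrite h h' /= -e eqxx.
split=> //; apply/forall_inP => // r rQ; apply/negP => /and3P[h h' /eqP e].
by have := h2 r rQ h h'; rewrite e ltxx.
Qed.

Lemma edgeS o Q S a b : S \subset Q -> a \in S -> b \in S -> hull_edge o Q a b -> hull_edge o S a b.
Proof.
move=> /subsetP sub aS bS /edgeP[_ _ ab h1 h2].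
by apply/edgeP; split=> // r /sub; [exact: h1|exact: h2].
Qed.

Section Center.
Variables (Q : {set T}) (o : pt).
Hypothesis oI : ~ wsep c Q o.

Lemma sides_ne (d : pt) : d != o ->
  (exists2 a, a \in Q & 0 < det3 o (c a) d) /\ (exists2 b, b \in Q & det3 o (c b) d < 0).
Proof.
move=> od; split; apply: contrapT => h; apply: oI.
  apply: (@wsep_det _ _ _ _ _ o d) => [|q qQ]; first by rewrite eq_sym.
  rewrite det3_eqm det3_swapr oppr_ge0 leNgt; apply/negP => h'.
  by apply: h; exists q.
apply: (@wsep_det _ _ _ _ _ d o) => // q qQ; rewrite det3_eqr det3_cyc leNgt.
by apply/negP => h'; apply: h; exists q.
Qed.

(** Among all segments of Q that cross the line through o in direction d, take
    one that crosses it farthest from o, and among these one of minimal width.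
    The quotient t is the position of the crossing. *)
Lemma sector_generic (d : pt) : d != o ->
  (forall q, q \in Q -> det3 o (c q) d != 0) ->
  exists a b, [/\ hull_edge o Q a b, 0 < det3 o (c a) d & det3 o (c b) d < 0].
Proof.
move=> od gen; have [[a0 a0Q a0d] [b0 b0Q b0d]] := sides_ne od.
pose f q := det3 o (c q) d.
pose t (ab : T * T) := E o ab.1 ab.2 / (f ab.1 - f ab.2).
pose P1 (ab : T * T) := [&& ab.1 \in Q, ab.2 \in Q, 0 < f ab.1 & f ab.2 < 0].
have [|m Pm mmax] := @ex_max R _ P1 t (a0, b0); first by rewrite /P1 /= a0Q b0Q a0d b0d.
pose P2 (ab : T * T) := P1 ab && (t ab == t m).
have [|[a b] /andP[Pab /eqP tab] abmin] := @ex_min R _ P2 (fun ab => f ab.1 - f ab.2) m.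
  by rewrite /P2 Pm eqxx.
move: (Pab) => /and4P[/= aQ bQ fa fb].
exists a, b; split=> //.
have den : 0 < f a - f b by lra.
have best a' b' : a' \in Q -> b' \in Q -> 0 < f a' -> f b' < 0 ->
    E o a' b' * (f a - f b) <= E o a b * (f a' - f b').
  move=> h1 h2 h3 h4; have := mmax (a', b'); rewrite /P1 /= h1 h2 h3 h4 => /(_ isT).
  have den' : 0 < f a' - f b' by lra.
  by rewrite -tab /t /= (ler_pdivrMr _ _ den') mulrAC (ler_pdivlMr _ _ den).
have plr r : E o a b * f r - E o a r * f b + f a * E o b r = 0.
  exact: plucker.
have Dr r : D a b r = E o a b + E o b r + E o r a by apply: det3_split.
have Era r : E o r a = - E o a r by apply: det3_swapr.
have Erb r : E o b r = - E o r b by apply: det3_swapr.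
have key1 r : D a b r * - f b = E o a b * (f r - f b) - E o r b * (f a - f b).
  by have := plr r; rewrite Dr Era Erb; lra.
have key2 r : D a b r * f a = E o a b * (f a - f r) - E o a r * (f a - f b).
  by have := plr r; rewrite Dr Era Erb; lra.
have pos r : r \in Q -> 0 <= D a b r.
  move=> rQ; have := gen r rQ; rewrite -/(f r) neq_lt => /orP[fr|fr].
    rewrite -(pmulr_lge0 _ fa) key2 subr_ge0; exact: best.
  rewrite -(@pmulr_lge0 _ (- f b)) ?oppr_gt0 // key1 subr_ge0; exact: best.
have Eab : 0 < E o a b.
  rewrite ltNge; apply/negP => h; apply: oI; apply: (@wsep_det _ _ _ _ _ (c a) (c b)).
    by apply: contraTneq fb => e; rewrite /f -e -leNgt ltW.
  by move=> q /pos; apply: le_trans; rewrite -det3_cyc -det3_cyc det3_cyc.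
apply/edgeP; split=> // r rQ ar rb; rewrite lt_neqAle pos // andbT eq_sym; apply/eqP => D0.
have := Dr r; rewrite D0 Era Erb => sum.
have := gen r rQ; rewrite -/(f r) neq_lt => /orP[fr|fr].
  have k := key2 r; rewrite D0 mul0r in k.
  have dr : 0 < f a - f r by lra.
  have tar : t (a, r) = t m.
    by rewrite -tab /t /=; apply/eqP; rewrite eqr_div ?lt0r_neq0 //; apply/eqP; lra.
  have := abmin (a, r); rewrite /P2 /P1 /= aQ rQ fa fr tar eqxx => /(_ isT) le.
  have : E o a r * (f a - f b) < E o a b * (f a - f b) by rewrite ltr_pM2r //; lra.
  have : E o a b * (f a - f b) <= E o a b * (f a - f r) by rewrite ler_pM2l.
  lra.
have k := key1 r; rewrite D0 mul0r in k.
have dr : 0 < f r - f b by lra.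
have tar : t (r, b) = t m.
  by rewrite -tab /t /=; apply/eqP; rewrite eqr_div ?lt0r_neq0 //; apply/eqP; lra.
have := abmin (r, b); rewrite /P2 /P1 /= bQ rQ fb fr tar eqxx => /(_ isT) le.
have : E o r b * (f a - f b) < E o a b * (f a - f b) by rewrite ltr_pM2r //; lra.
have : E o a b * (f a - f b) <= E o a b * (f r - f b) by rewrite ler_pM2l.
lra.
Qed.

End Center.

(** If points of Q lie on the ray through d, then d is first rotated by a
    small angle, so that they count as lying before it. *)
Lemma sector_exists Q o (d : pt) : ~ wsep c Q o -> d != o ->
  exists a b, [/\ hull_edge o Q a b, 0 <= det3 o (c a) d & 0 < det3 o d (c b)].
Proof.
move=> oI od; have [[a0 a0Q a0d] _] := sides_ne oI od.
pose g q := ((c q).1 - o.1) * (d.1 - o.1) + ((c q).2 - o.2) * (d.2 - o.2).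
pose f q := det3 o (c q) d.
pose e_ (e : R) : pt := (d.1 - e * (d.2 - o.2), d.2 + e * (d.1 - o.1)).
have fe e q : det3 o (c q) (e_ e) = f q + e * g q by rewrite /f /g det3E det3E /=; ring.
have dd : 0 < (d.1 - o.1) ^+ 2 + (d.2 - o.2) ^+ 2.
  by apply: (@pt_neq0 _ (d - o)); rewrite subr_eq0.
have fg a b : ((d.1 - o.1) ^+ 2 + (d.2 - o.2) ^+ 2) * E o a b = f a * g b - g a * f b.
  by rewrite /f /g !det3E; ring.
have qo q : q \in Q -> f q = 0 -> g q = 0 -> c q = o.
  rewrite /f /g det3E => _ h1 h2.
  have e1 : ((d.1 - o.1) ^+ 2 + (d.2 - o.2) ^+ 2) * ((c q).1 - o.1) =
     (d.1 - o.1) * g q + (d.2 - o.2) * (((c q).1 - o.1) * (d.2 - o.2) - ((c q).2 - o.2) * (d.1 - o.1)).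
    by rewrite /g; ring.
  have e2 : ((d.1 - o.1) ^+ 2 + (d.2 - o.2) ^+ 2) * ((c q).2 - o.2) =
     (d.2 - o.2) * g q - (d.1 - o.1) * (((c q).1 - o.1) * (d.2 - o.2) - ((c q).2 - o.2) * (d.1 - o.1)).
    by rewrite /g; ring.
  move: e1 e2; rewrite h1 /g h2 !mulr0 addr0 subr0 => /eqP + /eqP.
  rewrite !mulf_eq0 gt_eqF //= !subr_eq0 => /eqP E1 /eqP E2.
  by apply/eqP; rewrite -[_ == _]/((_ == _) && (_ == _)) E1 E2 !eqxx.
pose Q' := [set q in Q | c q != o].
have Q'P q : q \in Q' -> q \in Q /\ c q != o by rewrite inE => /andP.
pose s := [seq (if f q == 0 then (`|g q|, 0) else (`|f q|, - `|g q|)) | q <- enum Q'].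
have [|e e0 he] := @small_eps R s.
  move=> x /mapP[q]; rewrite mem_enum => /Q'P[qQ qo'] ->.
  case: eqP => [f0|/eqP f0] /=; left; rewrite normr_gt0 //.
  by apply: contraNneq qo' => g0; apply/eqP/qo.
have hs q : q \in Q' -> f q != 0 -> e * `|g q| < `|f q|.
  move=> qQ f0; have := he e _ (`|f q|, - `|g q|); rewrite e0 lexx => /(_ isT).
  have -> : (`|f q|, - `|g q|) \in s.
    by apply/mapP; exists q; rewrite ?mem_enum // (negbTE f0).
  by move=> /(_ isT) /=; lra.
have egle q : - (e * `|g q|) <= e * g q <= e * `|g q|.
  by rewrite -mulrN !ler_pM2l // ler_norm lerNl -normrN ler_norm.
have fpos q : q \in Q' -> 0 < f q -> 0 < f q + e * g q.
  move=> qQ f0; have := hs q qQ (lt0r_neq0 f0); rewrite (gtr0_norm f0).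
  by have /andP[] := egle q; lra.
have fneg q : q \in Q' -> f q < 0 -> f q + e * g q < 0.
  move=> qQ f0; have := hs q qQ (ltr0_neq0 f0); rewrite (ltr0_norm f0).
  by have /andP[] := egle q; lra.
have oI' : ~ wsep c Q' o.
  move=> [u u0 hu]; apply: oI; exists u => // q qQ.
  by case: (eqVneq (c q) o) => [->|h] //; apply: hu; rewrite inE qQ.
have gen q : q \in Q' -> det3 o (c q) (e_ e) != 0.
  move=> qQ; rewrite fe; case: (ltgtP (f q) 0) => h.
  - by rewrite ltr0_neq0 ?fneg.
  - by rewrite lt0r_neq0 ?fpos.
  - rewrite h add0r mulf_neq0 ?(lt0r_neq0 e0) //.
    have [qQ' qo'] := Q'P _ qQ; by apply: contraNneq qo' => g0; apply/eqP/qo.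
have a0Q' : a0 \in Q'.
  by rewrite inE a0Q; apply: contraTneq a0d => ->; rewrite det3_eql ltxx.
have eo : e_ e != o.
  by apply: contraNneq (gen _ a0Q') => ->; rewrite det3_eqm.
have [a [b [/edgeP[aQ bQ ab h1 h2] fa fb]]] := sector_generic oI' eo gen.
rewrite fe in fa; rewrite fe in fb.
have fa' : 0 <= f a by rewrite leNgt; apply/negP => /(fneg _ aQ); lra.
exists a, b; split=> //.
  have Dabo r : c r = o -> D a b r = E o a b by move=> ->; rewrite -det3_cyc.
  apply/edgeP; split=> //; [by case/Q'P: aQ|by case/Q'P: bQ| |].
    move=> r rQ; case: (eqVneq (c r) o) => [/Dabo->|ro]; first exact: ltW.
    by apply: h1; rewrite inE rQ.
  move=> r rQ ra rb; apply: h2 => //; rewrite inE rQ.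
  by apply: contraTneq ra => ->; rewrite det3_eqm ltxx.
rewrite det3_swapr oppr_gt0 -/(f b) lt_neqAle; apply/andP; split; last first.
  by rewrite leNgt; apply/negP => /(fpos _ bQ); lra.
apply/eqP => fb0; have gb : g b < 0 by move: fb; rewrite fb0 add0r pmulr_rlt0.
have := fg a b; rewrite fb0 mulr0 subr0 => h.
have : 0 < f a * g b by rewrite -h mulr_gt0.
have : 0 <= f a * - g b by rewrite mulr_ge0 // oppr_ge0 ltW.
lra.
Qed.

Hypothesis cI : injective c.

Section Center2.
Variables (Q : {set T}) (o : pt).
Hypothesis oI : ~ wsep c Q o.
Local Notation bnd := (boundary c).
Local Notation edge := (hull_edge o Q).

Lemma edge_bnd a b : edge a b -> a \in bnd Q /\ b \in bnd Q.
Proof.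
move=> /edgeP[aQ bQ ab h _].
have ab' : c a != c b by apply: contraTneq ab => ->; rewrite det3_eqr ltxx.
by split; apply/bndE; split=> //; apply: (@wsep_det _ _ _ _ _ _ _ ab') => q qQ;
  rewrite ?det3_eqm ?det3_eqr h.
Qed.

(** A boundary point in the sector of an edge cannot be inside the triangle
    with apex o, so it is on the edge. *)
Lemma bnd_in_sector a b v : edge a b -> v \in bnd Q ->
  0 <= E o a v -> 0 < E o v b -> v = a.
Proof.
move=> eab vb h1 h2; have [ab bb] := edge_bnd eab.
case/edgeP: (eab) => aQ bQ ab0 h3 h4.
have le := bnd_not_in_triangle oI vb aQ bQ h1 (ltW h2) ab0.
move: h1; rewrite le_eqVlt => /orP[/eqP e|h1].
  by apply/esym/(bnd_same_ray cI oI ab vb _ ab0 h2); rewrite -e.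
by have := h4 v (bndQ vb) h1 h2; rewrite ltNge le.
Qed.

Lemma edge_inj a a' x : edge a x -> edge a' x -> a = a'.
Proof.
move=> e e'; have [ab _] := edge_bnd e; have [ab' _] := edge_bnd e'.
case/edgeP: (e) => _ _ h _ _; case/edgeP: (e') => _ _ h' _ _.
have [le|lt] := leP 0 (E o a a'); first by apply/esym/(bnd_in_sector e).
by apply: (bnd_in_sector e') => //; rewrite det3_swapr oppr_ge0 ltW.
Qed.

Lemma edge_fun a b b' : edge a b -> edge a b' -> b = b'.
Proof.
move=> e e'; have [ab bb] := edge_bnd e; have [_ bb'] := edge_bnd e'.
case/edgeP: (e) => _ _ h _ _; case/edgeP: (e') => _ _ h' _ _.
case: (ltgtP (E o b b') 0) => hb.
- have := bnd_in_sector e bb' (ltW h'); rewrite det3_swapr oppr_gt0 => /(_ hb) E'.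
  by move: h'; rewrite E' det3_eqr ltxx.
- by have E' := bnd_in_sector e' bb (ltW h) hb; move: h; rewrite E' det3_eqr ltxx.
pose r : pt := (o.1 + (o.1 - (c a).1), o.2 + (o.2 - (c a).2)).
have rE q : det3 o (c q) r = E o a q by rewrite !det3E /r /=; ring.
by apply: (@bnd_same_ray _ _ _ _ _ _ _ r cI oI); rewrite // rE.
Qed.

Lemma bnd_neq v : v \in bnd Q -> c v != o.
Proof. by move=> /bndE[_ h]; apply: contra_notN oI => /eqP <-. Qed.

Lemma edge_ex v : v \in bnd Q -> exists b, edge v b.
Proof.
move=> vb; have [a [b [e h1 h2]]] := sector_exists oI (bnd_neq vb).
by exists b; rewrite (bnd_in_sector e vb h1 h2).
Qed.

End Center2.

(** The counterclockwise successor of a boundary point; other points are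
    fixed, which makes the map injective. *)
Definition nxt o Q w := odflt w [pick x | hull_edge o Q w x].

Section Next.
Variables (Q : {set T}) (o : pt).
Hypothesis oI : ~ wsep c Q o.
Local Notation bnd := (boundary c).
Local Notation edge := (hull_edge o Q).
Local Notation nxt := (nxt o Q).

Lemma edge_nxt v : v \in bnd Q -> edge v (nxt v).
Proof.
by rewrite /nxt; case: pickP => //= h /(edge_ex oI)[b]; rewrite h.
Qed.

Lemma nxtE v x : edge v x -> nxt v = x.
Proof.
by move=> e; have [vb _] := edge_bnd e; exact: (edge_fun oI (edge_nxt vb) e).
Qed.

Lemma nxt_bnd v : v \in bnd Q -> nxt v \in bnd Q.
Proof. by move=> /edge_nxt /edge_bnd[]. Qed.

Lemma nxt_inj : {in bnd Q &, injective nxt}.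
Proof.
move=> v w /edge_nxt ev /edge_nxt ew vw; rewrite -vw in ew.
exact: (edge_inj oI) ev ew.
Qed.

Lemma nxt_surj v : v \in bnd Q -> exists2 w, w \in bnd Q & nxt w = v.
Proof.
move=> vb; suff : nxt @: bnd Q = bnd Q.
  by move=> E'; move: vb; rewrite -{1}E' => /imsetP[w wb ->]; exists w.
apply/eqP; rewrite eqEcard (card_in_imset nxt_inj) leqnn andbT.
by apply/subsetP => _ /imsetP[w wb ->]; apply: nxt_bnd.
Qed.

(** If X were in a half-plane bounded by a line through o, then the slope g /
    f would increase along nxt for ever, although X is finite. *)
Lemma nxt_closed_surrounds (X : {set T}) : X != set0 -> X \subset bnd Q ->
  (forall w, w \in X -> nxt w \in X) -> ~ wsep c X o.
Proof.
move=> /set0Pn[w0 w0X] /subsetP XB Xn [u u0 hu].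
pose f q := lf u (c q) - lf u o; pose g q := lf (rot u) (c q) - lf (rot u) o.
have f0 q : q \in X -> f q <= 0 by move=> /hu; rewrite subr_le0.
have uu := pt_neq0 u0.
have fg a b : (u.1 ^+ 2 + u.2 ^+ 2) * E o a b = f a * g b - g a * f b.
  by rewrite /f /g /lf /rot det3E /=; ring.
have step w : w \in X -> 0 < f w * g (nxt w) - g w * f (nxt w).
  by move=> /XB /edge_nxt /edgeP[_ _ h _ _]; rewrite -fg mulr_gt0.
have [w1 w1X fw1] : exists2 w, w \in X & f w < 0.
  case: (ltP (f w0) 0) => h; first by exists w0.
  exists (nxt w0); first exact: Xn.
  have e : f w0 = 0 by apply/le_anti; rewrite h f0.
  rewrite lt_neqAle f0 ?Xn // andbT; apply/eqP => e'.
  by have := step w0 w0X; rewrite e e' mul0r mulr0 subr0 ltxx.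
have [|w /andP[wX fw] wmax] := @ex_max R T (fun w => (w \in X) && (f w < 0)) (fun w => g w / f w) w1.
  by rewrite w1X fw1.
have s1 := step w wX; have xX := Xn w wX; have s2 := step _ xX.
case: (ltP (f (nxt w)) 0) => h.
  have := wmax (nxt w); rewrite xX h => /(_ isT).
  rewrite ler_ndivrMr // mulrAC ler_ndivrMr // => le.
  by move: s1; rewrite subr_gt0 ltNge mulrC le.
have e : f (nxt w) = 0 by apply/le_anti; rewrite h f0.
move: s1 s2; rewrite e mulr0 subr0 mul0r sub0r => s1 s2.
have gx : g (nxt w) < 0 by rewrite -(nmulr_rgt0 _ fw).
move: s2; rewrite oppr_gt0 nmulr_rlt0 // => h'.
by have := f0 _ (Xn _ xX); rewrite leNgt h'.
Qed.

(** The boundary is a single cycle: X already surrounds o, so a boundary point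
    v is in the sector of an edge of X, and that edge is an edge of Q. *)
Lemma nxt_connected (X : {set T}) : X != set0 -> X \subset bnd Q ->
  (forall w, w \in X -> nxt w \in X) -> X = bnd Q.
Proof.
move=> X0 XB Xn; apply/eqP; rewrite eqEsubset XB; apply/subsetP => v vb.
have XI := nxt_closed_surrounds X0 XB Xn.
have [a [b [e h1 h2]]] := sector_exists XI (bnd_neq oI vb).
have aX : a \in X by case/edgeP: e.
have aB := subsetP XB _ aX.
have e' := edge_nxt aB.
have sub : X \subset Q by apply: subset_trans XB (bnd_sub c Q).
have E' := edge_fun XI e (edgeS sub aX (Xn _ aX) e'); rewrite E' in h2.
by rewrite (bnd_in_sector oI e' vb h1 h2).
Qed.

End Next.
End Edges.

(** * Consecutive layers and unflanked vertices *)

Section Layers.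
Variable R : realFieldType.
Local Notation pt := (R * R)%type.
Variables (T : finType) (c : T -> pt).
Implicit Types (Q S : {set T}) (o : pt) (a b q r v w x z m p : T).
Local Notation "'D' p q r" := (det3 (c p) (c q) (c r))
  (at level 10, p, q, r at level 9).
Local Notation inner := (interior c).
Local Notation bnd := (boundary c).
Local Notation closed := (convex_closed c).
Local Notation edge z Q := (hull_edge c (c z) Q).
Hypothesis cI : injective c.
Hypothesis H5 : forall S, five_exposed c S -> exists2 p : T, p \notin S & ~ ssep c S (c p).

(** Points that are not inner points of Q can be supported in the same way,
    whether they belong to Q or not. *)
Lemma outer_support Q q : closed Q -> q \notin inner Q -> exists u : pt,
  (forall r, r \in Q -> lf u (c r) <= lf u (c q)) /\
  (forall r, r \in inner Q -> lf u (c r) < lf u (c q)).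
Proof.
move=> cQ qI; have [qQ|qQ] := boolP (q \in Q); last first.
  have [u hu] := cQ q qQ; exists u; split=> r; first by move/hu/ltW.
  by move/innerQ/hu.
have /bnd_support[u [_ hu hu']] : q \in bnd Q by rewrite inE qI.
by exists u; split=> // r /inner_nwsep; apply: hu'.
Qed.

(** A convex combination with positive weight at p1 cannot attain the maximum
    if p1 does not. *)
Lemma max_not_in_triangle (u p1 p2 p3 q : pt) :
  0 < det3 p2 p3 q -> 0 <= det3 p3 p1 q -> 0 <= det3 p1 p2 q ->
  lf u p1 < lf u q -> lf u p2 <= lf u q -> lf u p3 <= lf u q -> False.
Proof.
move=> h1 h2 h3; have := lf_bary u p1 p2 p3 q; rewrite -(det3_bary1 p1 p2 p3 q).
move: h1 h2 h3; move: (det3 p2 p3 q) (det3 p3 p1 q) (det3 p1 p2 q) => A B C.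
move: (lf u p1) (lf u p2) (lf u p3) (lf u q) => f1 f2 f3 f hA hB hC e l1 l2 l3.
have : A * f1 < A * f by rewrite ltr_pM2l.
have : B * f2 <= B * f by rewrite ler_wpM2l.
have : C * f3 <= C * f by rewrite ler_wpM2l.
lra.
Qed.

Lemma edge_inner_pos o Q a b p : hull_edge c o Q a b -> p \in inner Q -> 0 < D a b p.
Proof.
move=> /edgeP[aQ bQ ab h _] /innerP[pQ pn]; rewrite lt_neqAle h // andbT.
apply/eqP => e; apply: pn; apply: (@wsep_det _ _ _ _ _ (c a) (c b)).
  by apply: contraTneq ab => ->; rewrite det3_eqr ltxx.
by move=> q /h; rewrite -e.
Qed.

(** Otherwise a would be in the triangle with vertices z, w and x, whose
    vertices are inner points. *)
Lemma beyond_edge Q z w x a : closed Q -> z \in inner Q -> a \notin inner Q ->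
  edge z (inner Q) w x -> 0 <= D z w a -> 0 < D z a x -> D w x a < 0.
Proof.
move=> cQ zI aI /edgeP[wI xI wx _ _] h1 h2; rewrite ltNge; apply/negP => h.
have [u [hu hu']] := outer_support cQ aI.
by apply: (@max_not_in_triangle u (c w) (c x) (c z) (c a));
  [dsgn|dsgn|dsgn|exact: hu'|exact/ltW/hu'|exact/ltW/hu'].
Qed.

(** The quadrilateral w a b x between two layers contains no point of T, and
    its side on the inner layer is an edge; so the region beyond that side,
    towards the inside, is empty as well. *)
Lemma quad_inward_empty Q o w x a b p : closed Q -> hull_edge c o (inner Q) w x ->
  a \in Q -> b \in Q ->
  0 < D w a b -> 0 < D a b x -> 0 < D b x w -> 0 < D x w a ->
  p \in inner Q -> 0 < D w x p -> 0 < D w a p -> 0 < D b x p -> False.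
Proof.
move=> cQ e aQ bQ wab abx bxw xwa pI wxp wap bxp.
case/edgeP: (e) => wI xI wx h h'.
apply: (@quad_no_point_beyond _ _ _ cI H5 x w a b xwa wab abx bxw _ p) => //; last first.
  by rewrite det3_swap oppr_lt0.
move=> q q1 q2 q3 q4; have [qI|qI] := boolP (q \in inner Q).
  have wxq : D w x q = 0.
    by apply/le_anti; rewrite h // andbT det3_swap oppr_le0.
  have wq : 0 < det3 o (c w) (c q).
    have := plucker (c w) o (c a) (c x) (c q).
    rewrite wxq mulr0 sub0r (det3_swap _ o (c x)) (det3_swap _ o (c q)).
    have : 0 < D w a x by dsgn.
    move: (D w a q) (D w a x) (det3 o (c w) (c q)) (det3 o (c w) (c x)) q2 wx => A B C F hA hF hB e0.
    by rewrite -(pmulr_lgt0 C hB); have := mulr_gt0 hF hA; lra.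
  have qx : 0 < det3 o (c q) (c x).
    have := plucker (c x) o (c b) (c w) (c q).
    have -> : D x w q = 0 by rewrite det3_swap wxq oppr0.
    rewrite mulr0 sub0r (det3_cyc (c x) o (c w)) (det3_cyc (c x) o (c q)).
    have : 0 < D b x w by dsgn.
    rewrite (det3_swap (c x) (c b) (c w)) (det3_swap (c x) (c b) (c q)).
    move: (D b x q) (D b x w) (det3 o (c q) (c x)) (det3 o (c w) (c x)) q4 wx => A B C F hA hF hB e0.
    by rewrite -(pmulr_lgt0 C hB); have := mulr_gt0 hF hA; lra.
  by have := h' q qI wq qx; rewrite wxq ltxx.
have [u [hu hu']] := outer_support cQ qI.
have [l|l] := leP (D w b q) 0.
  by apply: (@max_not_in_triangle u (c w) (c a) (c b) (c q));
    [dsgn|dsgn|dsgn|exact: hu'|exact: hu|exact: hu].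
by apply: (@max_not_in_triangle u (c w) (c b) (c x) (c q));
  [dsgn|dsgn|dsgn|exact: hu'|exact: hu|exact/ltW/hu'].
Qed.

(** Here z itself would be in the region of quad_inward_empty. *)
Lemma sector_unique_lt Q z w x a b : closed Q -> z \in inner Q ->
  edge z (inner Q) w x -> a \in bnd Q -> b \in bnd Q ->
  0 < D z w a -> 0 < D z a b -> 0 < D z b x -> 0 < D z w b -> 0 < D z a x -> False.
Proof.
move=> cQ zI e ab bb wa ab0 bx wb ax.
case/edgeP: (e) => wI xI wx _ _.
have nI q : q \in bnd Q -> q \notin inner Q by rewrite inE => /andP[].
have wxa := beyond_edge cQ zI (nI _ ab) e (ltW wa) ax.
have wxb := beyond_edge cQ zI (nI _ bb) e (ltW wb) bx.
apply: (@quad_inward_empty Q (c z) w x a b z cQ e (bndQ ab) (bndQ bb)) => //.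
- rewrite ltNge; apply/negP => h; have [u [hu hu']] := outer_support cQ (nI _ ab).
  have {}h : D w b a >= 0 by rewrite det3_swapr oppr_ge0.
  by apply: (@max_not_in_triangle u (c w) (c b) (c z) (c a));
    [dsgn|dsgn|dsgn|exact: hu'|exact: hu (bndQ bb)|exact/ltW/hu'].
- rewrite ltNge; apply/negP => h; have [u [hu hu']] := outer_support cQ (nI _ bb).
  by apply: (@max_not_in_triangle u (c x) (c z) (c a) (c b));
    [dsgn|dsgn|dsgn|exact: hu'|exact/ltW/hu'|exact: hu (bndQ ab)].
- by dsgn.
- by dsgn.
- by dsgn.
- by dsgn.
- by dsgn.
Qed.

Lemma sector_unique Q z w x a b : closed Q -> z \in inner Q ->
  edge z (inner Q) w x -> a \in bnd Q -> b \in bnd Q ->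
  0 < D z w a -> 0 < D z a x -> 0 < D z w b -> 0 < D z b x -> a = b.
Proof.
move=> cQ zI e ab bb wa ax wb bx; case: (ltgtP (D z a b) 0) => h.
- by case: (@sector_unique_lt Q z w x b a) => //; rewrite det3_swapr oppr_gt0.
- by case: (@sector_unique_lt Q z w x a b).
- by apply: (bnd_same_ray cI (inner_nwsep zI) ab bb h ax bx).
Qed.

Lemma ray_beyond z w x a p : D z w a = 0 -> D w x a < 0 -> 0 < D z w x ->
  0 < D z w p -> 0 < D w a p.
Proof.
move=> e h wx wp; have := plucker (c w) (c z) (c a) (c x) (c p).
have -> : D w z a = 0 by rewrite det3_swap e oppr0.
rewrite mul0r sub0r (det3_swap (c w) (c z) (c x)) (det3_swap (c w) (c z) (c p))
  (det3_swapr (c w) (c a) (c x)).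
move: (D z w x) (D z w p) (D w x a) (D w a p) h wx wp => A B C F hC hA hB e0.
by rewrite -(pmulr_rgt0 F hA); have := mulr_gt0 hB (_ : 0 < - C); rewrite oppr_gt0 => /(_ hC); lra.
Qed.

Lemma ray_turn z w x a p : D z w a = 0 -> 0 < D z a x -> 0 < D z w x ->
  0 < D z w p -> 0 < D z a p.
Proof.
move=> e ax wx wp; have := plucker (c z) (c w) (c a) (c x) (c p).
rewrite e mul0r sub0r => e0.
by rewrite -(pmulr_rgt0 _ wx); have := mulr_gt0 wp ax; lra.
Qed.

Lemma line_trans z m x w q : 0 < D z m x -> D z m w = 0 -> D z m q = 0 -> D z w q = 0.
Proof.
move=> mx mw mq; have := plucker (c z) (c m) (c x) (c w) (c q).
rewrite mw mq mul0r mul0r subr0 addr0 => /eqP.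
by rewrite mulf_eq0 gt_eqF //= => /eqP.
Qed.

Lemma cone_trans z a b d e : 0 < D z a b -> 0 < D z b e -> 0 < D z a e ->
   0 < D z b d -> 0 < D z d e -> 0 < D z a d.
Proof.
move=> ab be ae bd de; have := plucker (c z) (c a) (c b) (c d) (c e) => e0.
by rewrite -(pmulr_lgt0 _ be); have := mulr_gt0 ab de; have := mulr_gt0 ae bd; lra.
Qed.

(** The sector of w contains two points of bnd Q, one on the ray of w and one
    strictly inside. *)
Definition unflanked z Q w := exists x a a', [/\ edge z (inner Q) w x,
  a \in bnd Q /\ a' \in bnd Q, D z w a = 0 /\ 0 < D z a x & 0 < D z w a' /\ 0 < D z a' x].

(** By quad_inward_empty no vertex of the third layer is in the sector of w,
    except possibly on the ray of w.  If there were none on that ray, then one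
    sector of the third layer would contain w and its successor strictly
    inside, against sector_unique. *)
Lemma unflanked_step Q z w : closed Q -> z \in inner (inner (inner Q)) ->
  unflanked z Q w -> exists2 m, unflanked z (inner Q) m & D z m w = 0 /\ exists n, 0 < D z m n /\ 0 < D z w n.
Proof.
move=> cQ z3 [x [a [a' [e [ab a'b] [wa ax] [wa' a'x]]]]].
have z2 := innerQ z3; have z1 := innerQ z2.
case/edgeP: (e) => wI xI wx _ _.
have nI q : q \in bnd Q -> q \notin inner Q by rewrite inE => /andP[].
have wxa : D w x a < 0 by apply: (beyond_edge cQ z1 (nI _ ab) e) => //; rewrite wa.
have wxa' := beyond_edge cQ z1 (nI _ a'b) e (ltW wa') a'x.
have empty p : p \in inner (inner Q) -> 0 < D z w p -> 0 <= D z p x -> False.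
  move=> p2 wp px; have wxp := edge_inner_pos e p2.
  apply: (@quad_inward_empty Q (c z) w x a a' p cQ e (bndQ ab) (bndQ a'b)) => //.
  - exact: (ray_beyond wa wxa wx wa').
  - rewrite ltNge; apply/negP => h; have [u [hu hu']] := outer_support cQ (nI _ a'b).
    have aa' := ray_turn wa ax wx wa'.
    by apply: (@max_not_in_triangle u (c x) (c z) (c a) (c a'));
      [dsgn|dsgn|dsgn|exact: hu'|exact/ltW/hu'|exact: hu (bndQ ab)].
  - by dsgn.
  - by dsgn.
  - exact: (innerQ p2).
  - exact: (ray_beyond wa wxa wx wp).
  have := det3_bary (c z) (c w) (c x) (c p) (c a') (c x).
  rewrite det3_eqr mulr0 addr0.
  have -> : D a' x z = D z a' x by rewrite det3_cyc det3_cyc.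
  have -> : D a' x w = - D w x a' by rewrite det3_cyc det3_swap -det3_cyc.
  have -> : D x z p = D z p x by apply: det3_cyc.
  move=> e0; rewrite -(pmulr_rgt0 _ wx) -e0 ltr_pwDl ?mulr_gt0 // mulr_ge0 //.
  by rewrite oppr_ge0 ltW.
have wz : c w != c z by apply: contraTneq wx => ->; rewrite det3_eql ltxx.
have [m [n [em mw wn]]] := sector_exists (inner_nwsep z3) wz.
case/edgeP: (em) => mI nIn mn _ _.
have nx : 0 < D z x n.
  rewrite det3_swapr oppr_gt0 ltNge; apply/negP => h; exact: (empty n nIn wn h).
have [wb xb] := edge_bnd e.
have mx : 0 < D z m x.
  have := plucker (c z) (c m) (c w) (c x) (c n) => e0.
  rewrite -(pmulr_lgt0 _ wn).
  by have := mulr_gt0 mn wx; have := mulr_ge0 mw (ltW nx); lra.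
move: mw; rewrite le_eqVlt => /orP[/eqP mw|mw]; last first.
  have := sector_unique (inner_closed cQ) z2 em wb xb mw wn mx nx => E'.
  by move: wx; rewrite E' det3_eqr ltxx.
exists m; last by split=> //; exists n.
by exists n, w, x; split.
Qed.

(** z is a point of the last nonempty layer. *)
Definition innermost Q z := forall j, iter j inner Q = set0 \/ z \in iter j inner Q.

Lemma innermost_inner Q z : innermost Q z -> innermost (inner Q) z.
Proof. by move=> h j; have := h j.+1; rewrite iterSr. Qed.

(** The ray of w contains a point of every layer; each layer contributes at
    most K points. *)
Lemma unflanked_card K Q z w : (forall S, closed S -> (#|bnd S| <= K)%N) ->
  closed Q -> innermost Q z -> z \in inner (inner Q) -> unflanked z Q w ->
  (#|Q| <= K * #|[set q in Q | D z w q == 0%R]|)%N.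
Proof.
move=> bK; have [n] := ubnP #|Q|; elim: n Q w => // n ih Q w hn cQ im z2 uw.
have [x [a [a' [e [ab a'b] [wa ax] [wa' a'x]]]]] := uw.
case/edgeP: (e) => wI xI wx _ _.
have aI : a \notin inner Q by move: ab; rewrite inE => /andP[].
have aL : a \in [set q in Q | D z w q == 0] by rewrite inE (bndQ ab) wa eqxx.
rewrite (card_bnd_inner c Q).
have cI' := inner_closed cQ.
have [z3|z3] := boolP (z \in inner (inner (inner Q))).
  have [m um [mw [k [mk wk]]]] := unflanked_step cQ z3 uw.
  have lt_n : (#|inner Q| < n)%N.
    rewrite -ltnS; apply: leq_trans hn; rewrite ltnS; apply: proper_card.
    by apply/properP; split; [apply: inner_sub|exists a; [exact: (bndQ ab)|]].
  have h := ih (inner Q) m lt_n cI' (innermost_inner im) z3 um.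
  apply: leq_trans (leq_add (bK _ cQ) h) _; rewrite -mulnS leq_mul2l; apply/orP; right.
  rewrite (cardsD1 a [set q in Q | _]) aL add1n ltnS; apply: subset_leq_card.
  apply/subsetP => q; rewrite inE => /andP[qI /eqP mq].
  rewrite in_setD1 inE (innerQ qI) (line_trans mk mw mq) eqxx !andbT.
  by apply: contraNneq aI => <-.
have I3 : inner (inner (inner Q)) = set0.
  by have [//|] := im 3; rewrite /= (negbTE z3).
have := card_bnd_inner c (inner Q); have := card_bnd_inner c (inner (inner Q)).
rewrite I3 cards0 addn0 => -> ->.
have h1 := bK _ cQ; have h2 := bK _ cI'; have h3 := bK _ (inner_closed cI').
apply: leq_trans (_ : K * 3 <= _)%N.
  by rewrite !mulnS muln0 addn0 leq_add // leq_add.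
rewrite leq_mul2l; apply/orP; right.
have sub : [set a; w; z] \subset [set q in Q | D z w q == 0].
  apply/subsetP => q; rewrite !inE -!orbA => /or3P[]/eqP->.
  - by rewrite (bndQ ab) wa eqxx.
  - by rewrite (innerQ wI) det3_eqr eqxx.
  - by rewrite (innerQ (innerQ z2)) det3_eqm eqxx.
apply: leq_trans (subset_leq_card sub).
rewrite -!setUA !cardsU1 cards1 !inE !negb_or.
have -> : a != w by apply: contraNneq aI => ->.
have -> : a != z by apply: contraNneq aI => ->; exact: (innerQ z2).
have -> : w != z by apply: contraTneq wx => ->; rewrite det3_eql ltxx.
by [].
Qed.

End Layers.

(** * Supporting lines of consecutive layers *)

Section Faces.
Variable R : realFieldType.
Local Notation pt := (R * R)%type.
Variables (T : finType) (c : T -> pt).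
Implicit Types (Q S W : {set T}) (o : pt) (a b q r v w x z m p : T) (h : pt * R).
Local Notation "'D' p q r" := (det3 (c p) (c q) (c r))
  (at level 10, p, q, r at level 9).
Local Notation inner := (interior c).
Local Notation bnd := (boundary c).
Local Notation closed := (convex_closed c).
Hypothesis cI : injective c.
Hypothesis H5 : forall S, five_exposed c S -> exists2 p : T, p \notin S & ~ ssep c S (c p).

Definition face Q h := h.1 != 0 /\ forall q, q \in Q -> lf h.1 (c q) <= h.2.
Definition on h q := lf h.1 (c q) = h.2.
(** At most k supporting lines of Q contain all points of W. *)
Definition face_cover k Q W := exists s : seq (pt * R), [/\ (size s <= k)%N,
  forall h, h \in s -> face Q h & forall w, w \in W -> exists2 h, h \in s & on h w].

Lemma bnd_face Q q : q \in bnd Q -> exists2 h, face Q h & on h q.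
Proof. by move=> /bnd_support[u [u0 hu _]]; exists (u, lf u (c q)). Qed.

Lemma line_face Q a b : a != b -> (forall r, r \in Q -> 0 <= D a b r) ->
  exists2 h, face Q h & forall q, D a b q = 0 -> on h q.
Proof.
move=> ab hr; exists (- nrm (c a) (c b), - lf (nrm (c a) (c b)) (c a)).
  split=> /=; first by rewrite oppr_eq0 nrm_neq0 // (inj_eq cI).
  by move=> r /hr; rewrite -lf_nrm lfN; lra.
by move=> q; rewrite -lf_nrm /on /= lfN; lra.
Qed.

Lemma unit_pt_neq0 : ((1, 0) : pt) != 0.
Proof. by rewrite -[_ == _]/((1 == 0 :> R) && (0 == 0 :> R)) oner_eq0. Qed.

Lemma face_exists Q : exists h, face Q h.
Proof.
have [->|[q qQ]] := set_0Vmem Q.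
  by exists ((1, 0), 0); split=> [|r]; rewrite ?unit_pt_neq0 ?inE.
have [m mQ hm] := @ex_max R T (mem Q) (fun r => lf (1, 0) (c r)) q qQ.
by exists ((1, 0), lf (1, 0) (c m)); split; rewrite ?unit_pt_neq0.
Qed.

Lemma same_side_ray Q o (n : pt) k w w' : ~ wsep c Q o -> w \in bnd Q -> w' \in bnd Q ->
  lf n o <= k -> k < lf n (c w) -> k < lf n (c w') -> det3 o (c w) (c w') = 0 -> w = w'.
Proof.
move=> oI wb wb' ok kw kw' e.
pose b : pt := (o.1 - n.2, o.2 + n.1).
have bE p : det3 o (c p) b = lf n (c p) - lf n o by rewrite det3E /lf /b /=; ring.
by apply: (bnd_same_ray (b := b) cI oI wb wb' e); rewrite bE; lra.
Qed.

(** The points beyond the line are collinear; two angularly consecutive ones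
    among them form a hull edge of Q, so their line supports Q. *)
Lemma face_above Q z (n : pt) k x y : closed Q -> z \in inner Q ->
  face (inner Q) (n, k) -> x \in inner Q -> y \in inner Q -> x != y ->
  on (n, k) x -> on (n, k) y ->
  exists2 h, face Q h & forall q, q \in Q -> k < lf n (c q) -> on h q.
Proof.
move=> cQ zI [/= n0 hn] xI yI xy xk yk.
have col a b d : a \in Q -> b \in Q -> d \in Q ->
  k < lf n (c a) -> k < lf n (c b) -> k < lf n (c d) -> D a b d = 0.
  exact: (collinear_beyond_support cI H5 cQ hn xI yI xy xk yk).
pose B := [set q in Q | k < lf n (c q)].
have BP q : q \in B -> q \in Q /\ k < lf n (c q) by rewrite inE => /andP.
have Bb q : q \in B -> q \in bnd Q.
  by move=> /BP[qQ kq]; case: (bnd_or c qQ) => // /hn; rewrite leNgt kq.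
have oI := inner_nwsep zI.
have gen w0 w1 : w0 \in B -> w1 \in B -> 0 < D z w0 w1 ->
  exists2 h, face Q h & forall q, q \in Q -> k < lf n (c q) -> on h q.
  move=> w0B w1B w01; have w0b := Bb _ w0B; have w1b := Bb _ w1B.
  have e := edge_nxt cI oI w0b; set x1 := nxt _ _ _ _ in e.
  case/edgeP: (e) => w0Q x1Q w0x1 hx _.
  have x1w1 : 0 <= D z x1 w1.
    rewrite det3_swapr oppr_ge0 leNgt; apply/negP => l.
    have e' := bnd_in_sector cI oI e w1b (ltW w01) l.
    by move: w01; rewrite e' det3_eqr ltxx.
  have x1k : k < lf n (c x1).
    have := lf_bary n (c z) (c w0) (c w1) (c x1); have := det3_bary1 (c z) (c w0) (c w1) (c x1).
    have -> : D w0 w1 x1 = - D w0 x1 w1 by apply: det3_swapr.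
    have -> : D w1 z x1 = D z x1 w1 by apply: det3_cyc.
    have := hx _ (bndQ w1b); have := hn _ zI.
    have [_] := BP _ w0B; have [_] := BP _ w1B.
    move: w0x1 x1w1 w01; move: (D z w0 x1) (D z x1 w1) (D z w0 w1) (D w0 x1 w1) => C B' S A.
    move: (lf n (c z)) (lf n (c w0)) (lf n (c w1)) (lf n (c x1)) => fz f0 f1 f hC hB hS h1 h0 hz hA s e0.
    rewrite -(ltr_pM2l hS) -e0.
    have : B' * k <= B' * f0 by rewrite ler_wpM2l // ltW.
    have : C * k < C * f1 by rewrite ltr_pM2l.
    have : A * fz <= A * k by rewrite ler_wpM2l.
    have -> : S = - A + B' + C by lra.
    lra.
  have [|h hf hon] := @line_face Q w0 x1 _ hx.
    by apply: contraTneq w0x1 => ->; rewrite det3_eqr ltxx.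
  exists h => // q qQ kq; apply: hon; apply: col => //; by case: (BP _ w0B).
have [B0|[w0 w0B]] := set_0Vmem B.
  exists (n, k); first by split=> //= q qQ; rewrite leNgt; apply/negP => l; have := in_set0 q; rewrite -B0 inE qQ l.
  by move=> q qQ l; have := in_set0 q; rewrite -B0 inE qQ l.
have [/existsP[w1 /andP[w1B w10]]|/existsPn no] := boolP [exists w1, (w1 \in B) && (w1 != w0)].
  case: (ltgtP (D z w0 w1) 0) => l.
  - by apply: (gen w1 w0) => //; rewrite det3_swapr oppr_gt0.
  - exact: (gen w0 w1).
  have [_ k0] := BP _ w0B; have [_ k1] := BP _ w1B.
  have e := same_side_ray oI (Bb _ w0B) (Bb _ w1B) (hn _ zI) k0 k1 l.
  by rewrite e eqxx in w10.
have [h hf hon] := bnd_face (Bb _ w0B); exists h => // q qQ l.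
have := no q; rewrite inE qQ l /= negbK => /eqP ->; exact: hon.
Qed.

(** A boundary point of Q is farther from z than an inner point on the same
    ray. *)
Lemma beyond_on_ray Q z w m n : z \in inner Q -> w \in bnd Q -> m \in inner Q ->
  D z m w = 0 -> 0 < D z m n -> 0 < D z w n ->
  forall h, face (inner Q) h -> lf h.1 (c z) < h.2 -> on h m -> h.2 < lf h.1 (c w).
Proof.
move=> zI wb mI mw mn wn h [_ hf] hz hm.
have key u : D z m n * (lf u (c w) - lf u (c z)) = D z w n * (lf u (c m) - lf u (c z)).
  have -> : D z w n * (lf u (c m) - lf u (c z)) = D z m n * (lf u (c w) - lf u (c z))
     - D z m w * (lf u (c n) - lf u (c z)).
    by rewrite !det3E /lf; ring.
  by rewrite mw mul0r subr0.
have lt : D z m n < D z w n.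
  have [u [_ _ hu]] := bnd_support wb.
  have h1 := hu _ (inner_nwsep zI); have h2 := hu _ (inner_nwsep mI).
  have := key u; move: (D z m n) (D z w n) mn wn => A B hA hB e.
  rewrite ltNge; apply/negP => le.
  have : B * (lf u (c m) - lf u (c z)) < B * (lf u (c w) - lf u (c z)) by rewrite ltr_pM2l //; lra.
  have : B * (lf u (c w) - lf u (c z)) <= A * (lf u (c w) - lf u (c z)) by rewrite ler_wpM2r //; lra.
  lra.
have := key h.1; rewrite hm; move: (D z m n) (D z w n) lt mn wn => A B l hA hB e.
have : A * (h.2 - lf h.1 (c z)) < B * (h.2 - lf h.1 (c z)) by rewrite ltr_pM2r //; lra.
rewrite -e => l'; have : 0 < A * (lf h.1 (c w) - h.2) by lra.
by rewrite pmulr_rgt0 // subr_gt0.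
Qed.

(** The rays from z through the points of one supporting line of inner Q meet
    bnd Q in points of one supporting line of Q: by face_above if there are at
    least two such rays, trivially otherwise. *)
Lemma face_ray Q z h : closed Q -> z \in inner (inner Q) -> face (inner Q) h ->
  exists2 h', face Q h' & forall w m n, w \in bnd Q -> m \in inner Q -> on h m ->
    D z m w = 0 -> 0 < D z m n -> 0 < D z w n -> on h' w.
Proof.
move=> cQ z2 hf; have zI := innerQ z2.
have oI := inner_nwsep zI.
have hz : lf h.1 (c z) < h.2.
  rewrite ltNge; apply/negP => le; apply: (inner_nwsep z2); case: hf => h0 hf.
  by exists h.1 => // q /hf l; apply: le_trans le.
pose M := [set m in inner Q | lf h.1 (c m) == h.2].
have MP m : m \in inner Q -> on h m -> m \in M by move=> mI e; rewrite inE mI e eqxx.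
have [M0|[m0 m0M]] := set_0Vmem M.
  have [h' hf'] := face_exists Q; exists h' => // w m n _ mI /(MP _ mI).
  by rewrite M0 inE.
move: (m0M); rewrite inE => /andP[m0I /eqP m0h].
have [/existsP[m1 /andP[m1M m10]]|/existsPn no] := boolP [exists m1, (m1 \in M) && (m1 != m0)].
  move: (m1M); rewrite inE => /andP[m1I /eqP m1h].
  have [|h' hf' hon] := @face_above Q z h.1 h.2 m1 m0 cQ zI _ m1I m0I m10 m1h m0h.
    by case: hf.
  exists h' => // w m n wb mI mh mw mn wn; apply: hon; first exact: bndQ wb.
  exact: (beyond_on_ray zI wb mI mw mn wn hf hz mh).
pose P w := (w \in bnd Q) && `[< D z m0 w = 0 /\ exists n, 0 < D z m0 n /\ 0 < D z w n >].
have PI w m n : w \in bnd Q -> m \in inner Q -> on h m ->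
    D z m w = 0 -> 0 < D z m n -> 0 < D z w n -> P w.
  move=> wb mI mh mw mn wn; have := no m; rewrite (MP _ mI mh) /= negbK => /eqP e.
  by rewrite /P wb -e; apply/asboolP; split=> //; exists n.
have [/existsP[w0 /andP[w0b /asboolP[mw0 [n0 [mn0 wn0]]]]]|/existsPn noP] := boolP [exists w, P w]; last first.
  have [h' hf'] := face_exists Q; exists h' => // w m n wb mI mh mw mn wn.
  by have := noP w; rewrite (PI w m n).
have [h' hf' hon] := bnd_face w0b; exists h' => // w m n wb mI mh mw mn wn.
have /andP[_ /asboolP[mw' [n' [mn' wn']]]] := PI _ _ _ wb mI mh mw mn wn.
suff <- : w0 = w by [].
have e := line_trans mn0 mw0 mw'.
by apply: (bnd_same_ray cI oI w0b wb e wn0); apply: (ray_turn mw' wn' mn' mn0).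
Qed.

End Faces.

(** * Ends of the sides of a hull *)

Section Extremes.
Variable R : realFieldType.
Local Notation pt := (R * R)%type.
Variables (T : finType) (c : T -> pt).
Implicit Types (Q S W : {set T}) (o : pt) (a b q r v w x z m p : T) (h : pt * R).
Local Notation "'D' p q r" := (det3 (c p) (c q) (c r))
  (at level 10, p, q, r at level 9).
Local Notation inner := (interior c).
Local Notation closed := (convex_closed c).
Hypothesis cI : injective c.
Hypothesis H5 : forall S, five_exposed c S -> exists2 p : T, p \notin S & ~ ssep c S (c p).

(** v is the last point of Q on a side of its hull that starts at b, in
    counterclockwise order. *)
Definition side_end Q b v : bool :=
  [&& b \in Q, v \in Q, b != v, [forall r in Q, 0 <= D b v r] &
      [forall r in Q, (D b v r == 0) ==> (lf (c v - c b) (c r) <= lf (c v - c b) (c v))]].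

(** Distinct sides have distinct last points, so corners count the sides. *)
Definition corners Q := [set v | [exists b, side_end Q b v]].

Lemma side_endP Q b v : side_end Q b v -> [/\ b \in Q, v \in Q, b != v,
  forall r, r \in Q -> 0 <= D b v r & forall r, r \in Q -> D b v r = 0 ->
  lf (c v - c b) (c r) <= lf (c v - c b) (c v)].
Proof.
move=> /and5P[bQ vQ bv /forall_inP h1 /forall_inP h2]; split=> // r rQ e.
by have := h2 r rQ; rewrite e eqxx.
Qed.

Lemma cornersQ Q v : v \in corners Q -> v \in Q.
Proof. by rewrite inE => /existsP[b /side_endP[]]. Qed.

Lemma corner_exposed Q v : v \in corners Q -> ssep c (Q :\ v) (c v).
Proof.
rewrite inE => /existsP[b /side_endP[bQ vQ bv h1 h2]].
apply: (@ssep_tilt _ _ _ _ _ (- nrm (c b) (c v)) (c v - c b)) => r; rewrite !inE => /andP[rv rQ].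
have := h1 r rQ; rewrite le_eqVlt => /orP[/eqP e|l]; last first.
  by left; rewrite !lfN ltrN2; have := lf_nrm (c b) (c v) (c r);
     have := lf_nrm (c b) (c v) (c v); rewrite det3_eqr; lra.
have eN : lf (nrm (c b) (c v)) (c r) = lf (nrm (c b) (c v)) (c v).
  have := lf_nrm (c b) (c v) (c r); have := lf_nrm (c b) (c v) (c v).
  by rewrite det3_eqr -e; lra.
right; rewrite !lfN eN; split=> //; rewrite lt_neqAle h2 // andbT.
apply: contra rv => /eqP e'; apply/eqP/cI/(lf_rot_inj _ eN).
  by rewrite nrm_neq0 // (inj_eq cI).
by move: e'; rewrite /rot /nrm /lf /=; lra.
Qed.

Lemma pt_sub_sqr p q : p != q ->
  0 < ((c q).1 - (c p).1) ^+ 2 + ((c q).2 - (c p).2) ^+ 2.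
Proof.
by move=> pq; apply: (@pt_neq0 _ (c q - c p)); rewrite subr_eq0 eq_sym (inj_eq cI).
Qed.

(** The last point v of the side through a and b; the determinants of a, v and
    of a, b with a third point have the same sign. *)
Lemma side_end_exists Q a b : a \in Q -> b \in Q -> a != b ->
  (forall r, r \in Q -> 0 <= D a b r) -> exists v, [/\ side_end Q a v, D a v b = 0 &
  forall p : pt, det3 (c a) (c b) p < 0 -> det3 (c a) (c v) p < 0].
Proof.
move=> aQ bQ ab h; pose t : pt := c b - c a.
have tt := pt_sub_sqr ab.
have [|v /andP[vQ /eqP Dv] vmax] := @ex_max R T (fun r => (r \in Q) && (D a b r == 0)) (fun r => lf t (c r)) b.
  by rewrite bQ det3_eqr eqxx.
pose n2 := ((c b).1 - (c a).1) ^+ 2 + ((c b).2 - (c a).2) ^+ 2.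
pose tau := lf t (c v) - lf t (c a).
have tau0 : 0 < tau.
  have := vmax b; rewrite bQ det3_eqr eqxx => /(_ isT) le.
  rewrite subr_gt0; apply: lt_le_trans le.
  by rewrite -subr_gt0; move: tt; rewrite /t /lf /=; lra.
have key (p : pt) : n2 * det3 (c a) (c v) p = tau * det3 (c a) (c b) p.
  have -> : n2 * det3 (c a) (c v) p = tau * det3 (c a) (c b) p - D a b v * (lf t p - lf t (c a)).
    by rewrite /n2 /tau /t /lf !det3E /=; ring.
  by rewrite Dv mul0r subr0.
have sgn (p : pt) : det3 (c a) (c b) p = 0 <-> det3 (c a) (c v) p = 0.
  split=> e; have := key p; rewrite e mulr0 => /eqP; last rewrite eq_sym;
    by rewrite mulf_eq0 gt_eqF //= => /eqP.
have key2 r : n2 * (lf (c v - c a) (c v) - lf (c v - c a) (c r)) = tau * (lf t (c v) - lf t (c r)).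
  have -> : n2 * (lf (c v - c a) (c v) - lf (c v - c a) (c r)) =
     tau * (lf t (c v) - lf t (c r)) + D a b v * (lf (rot t) (c v) - lf (rot t) (c r)).
    by rewrite /n2 /tau /t /lf /rot !det3E /=; ring.
  by rewrite Dv mul0r addr0.
exists v; split; last first.
- by move=> p l; rewrite -(pmulr_rlt0 _ tt) key pmulr_rlt0.
- by apply/sgn; rewrite det3_eqr.
apply/and5P; split=> //.
- by apply: contraTneq tau0 => e; rewrite /tau e subrr ltxx.
- apply/forall_inP => r rQ; rewrite -(pmulr_rge0 _ tt) key pmulr_rge0 //; exact: h.
- apply/forall_inP => r rQ; apply/implyP => /eqP /sgn e.
  rewrite -subr_ge0 -(pmulr_rge0 _ tt) key2 pmulr_rge0 // subr_ge0.
  by apply: vmax; rewrite rQ e eqxx.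
Qed.

(** The side of a corner does not depend on the witness b. *)
Lemma side_end_line Q b b' v (p : pt) : side_end Q b v -> side_end Q b' v ->
  (det3 (c b) (c v) p = 0 -> det3 (c b') (c v) p = 0) /\
  (det3 (c b) (c v) p < 0 -> det3 (c b') (c v) p < 0).
Proof.
move=> /side_endP[bQ vQ bv h1 h2] /side_endP[b'Q _ b'v h1' h2'].
have D0 : D b v b' = 0.
  apply/le_anti; rewrite h1 // andbT.
  have := h1' _ bQ; have -> : D b' v b = - D b v b'; last by rewrite oppr_ge0.
  by rewrite det3_swap det3_cyc det3_cyc -det3_cyc -det3_cyc -det3_cyc det3_swap opprK -det3_cyc det3_swap.
have tt := pt_sub_sqr bv.
pose t : pt := c v - c b; pose s := lf t (c v) - lf t (c b').
have key : (((c v).1 - (c b).1) ^+ 2 + ((c v).2 - (c b).2) ^+ 2) * det3 (c b') (c v) p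
    = s * det3 (c b) (c v) p.
  have -> : (((c v).1 - (c b).1) ^+ 2 + ((c v).2 - (c b).2) ^+ 2) * det3 (c b') (c v) p
    = s * det3 (c b) (c v) p + D b v b' * (lf t p - lf t (c v)).
    by rewrite /s /t /lf !det3E /=; ring.
  by rewrite D0 mul0r addr0.
have s0 : 0 < s.
  rewrite lt_neqAle subr_ge0 h2 // andbT; apply: contra b'v; rewrite eq_sym subr_eq0 => /eqP e.
  apply/eqP/esym/cI/(@lf_rot_inj _ t) => //; first by rewrite subr_eq0 eq_sym (inj_eq cI).
  by move: D0; rewrite det3E /t /lf /rot /=; lra.
split=> l.
  by move: key; rewrite l mulr0 => /eqP; rewrite mulf_eq0 gt_eqF //= => /eqP.
by rewrite -(pmulr_rlt0 _ tt) key pmulr_rlt0.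
Qed.

(** Five corners of a set without inner points would contradict five_interior.
    *)
Lemma corners_card4 Q : closed Q -> inner Q = set0 -> (#|corners Q| <= 4)%N.
Proof.
move=> cQ I0; rewrite leqNgt; apply/negP => /card_geqP[s [us s5 sF]].
pose S := [set x in s].
have SQ : S \subset Q by apply/subsetP => x; rewrite inE => /sF /cornersQ.
have S5 : five_exposed c S.
  split; first by rewrite cardsE (card_uniqP us).
  move=> x; rewrite inE => /sF /corner_exposed; apply: ssepS; exact: setSD.
have [p] := five_interior cI H5 S5; apply; apply: (wsepS SQ).
have [pQ|pQ] := boolP (p \in Q); last exact/ssep_wsep/cQ.
by have [/bndE[]|] := bnd_or c pQ => //; rewrite I0 in_set0.
Qed.

(** All inner points are on the line through z and y.  Three corners strictly
    on one side of it, together with z and y, contradict five_interior; and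
    the line itself contains at most two corners.  This gives 2 + 2 + 2. *)
Lemma corners_card6 Q z y : closed Q -> z \in inner Q -> y \in Q -> z != y ->
  (forall j, j \in inner Q -> D z y j = 0) -> (#|corners Q| <= 6)%N.
Proof.
move=> cQ zI yQ zy hJ.
have zyc : c z != c y by rewrite (inj_eq cI).
have n0 := nrm_neq0 zyc.
have side (n : pt) k : n != 0 -> (forall r, r \in Q -> D z y r = 0 -> lf n (c r) = k) ->
    (#|[set v in corners Q | (k < lf n (c v))%R]| <= 2)%N.
  move=> nn hk; rewrite leqNgt; apply/negP => /card_geqP[s [us s3 sF]].
  case: s us s3 sF => [|a [|b [|d [|]]]] //= /and3P[] ; rewrite !inE negb_or => /andP[ab ad] bd _ _ sF.
  have [aF ka] : a \in corners Q /\ k < lf n (c a) by apply/andP; have := sF a; rewrite !inE eqxx; apply.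
  have [bF kb] : b \in corners Q /\ k < lf n (c b) by apply/andP; have := sF b; rewrite !inE eqxx orbT; apply.
  have [dF kd] : d \in corners Q /\ k < lf n (c d) by apply/andP; have := sF d; rewrite !inE eqxx !orbT; apply.
  pose S := [set z; y; a; b; d].
  have SQ : S \subset Q.
    by apply/subsetP => q; rewrite !inE -!orbA => /or4P[/eqP->|/eqP->|/eqP->|/orP[]/eqP->] //;
      [apply: innerQ zI|apply: cornersQ..].
  have ex q : q \in corners Q -> ssep c (S :\ q) (c q).
    by move=> /corner_exposed; apply: ssepS; apply: setSD.
  have zk : lf n (c z) = k by apply: hk; rewrite ?det3_eqm //; exact: innerQ zI.
  have yk : lf n (c y) = k by apply: hk; rewrite ?det3_eqr.
  have S5 : five_exposed c S.
    by apply: (five_exposed_cap cI nn zy zk yk ka kb kd ab bd ad); apply: ex.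
  have [p] := five_interior cI H5 S5; apply.
  have [pQ|pQ] := boolP (p \in Q); last exact/(wsepS SQ)/ssep_wsep/cQ.
  have [/bndE[_]|pI] := bnd_or c pQ; first exact: wsepS SQ.
  exists (- n); first by rewrite oppr_eq0.
  have pk : lf n (c p) = k by apply: hk => //; apply: hJ.
  move=> q; rewrite !lfN lerN2 pk !inE -!orbA.
  by move=> /or4P[/eqP->|/eqP->|/eqP->|/orP[]/eqP->]; rewrite ?zk ?yk // ltW.
have h1 := side (nrm (c z) (c y)) (lf (nrm (c z) (c y)) (c z)) n0.
have h2 := side (- nrm (c z) (c y)) (- lf (nrm (c z) (c y)) (c z)).
have {}h1 : (#|[set v in corners Q | (lf (nrm (c z) (c y)) (c z) < lf (nrm (c z) (c y)) (c v))%R]| <= 2)%N.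
  by apply: h1 => r _; rewrite -lf_nrm => /subr0_eq.
have {}h2 : (#|[set v in corners Q | (- lf (nrm (c z) (c y)) (c z) < lf (- nrm (c z) (c y)) (c v))%R]| <= 2)%N.
  by apply: h2; rewrite ?oppr_eq0 // => r _; rewrite -lf_nrm lfN => /subr0_eq ->.
have h3 : (#|[set v in corners Q | D z y v == 0%R]| <= 2)%N.
  rewrite leqNgt; apply/negP => l3.
  pose O := [set v in corners Q | D z y v == 0]; pose t := rot (nrm (c z) (c y)).
  have OP q : q \in O -> q \in corners Q /\ lf (nrm (c z) (c y)) (c q) = lf (nrm (c z) (c y)) (c z).
    by rewrite inE => /andP[qF /eqP]; rewrite -lf_nrm => /subr0_eq.
  have [e0 e0O] : exists e0 : T, e0 \in O by apply/set0Pn; rewrite -card_gt0; apply: leq_trans l3.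
  have [a aO amin] := @ex_min R T (mem O) (fun q => lf t (c q)) e0 e0O.
  have [b bO bmax] := @ex_max R T (mem O) (fun q => lf t (c q)) e0 e0O.
  have [d] : exists d, d \in O :\: [set a; b].
    apply/set0Pn; rewrite -card_gt0 -(ltn_add2l #|O :&: [set a; b]|) cardsID addn0.
    apply: leq_trans l3; rewrite ltnS; apply: leq_trans (subset_leq_card (subsetIr _ _)) _.
    by rewrite cards2; case: (a != b).
  rewrite in_setD in_set2 negb_or => /andP[/andP[da db] dO].
  have [aF aN] := OP _ aO; have [bF bN] := OP _ bO; have [dF dN] := OP _ dO.
  have ne q : d != q -> lf (nrm (c z) (c y)) (c q) = lf (nrm (c z) (c y)) (c d) -> lf t (c d) != lf t (c q).
    by move=> dq e; apply: contra dq => /eqP e'; apply/eqP/cI/(lf_rot_inj n0).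
  apply: (@btw_not_ssep _ _ c (Q :\ d) (c d) a b).
  - by rewrite in_setD1 eq_sym da cornersQ.
  - by rewrite in_setD1 eq_sym db cornersQ.
  - apply: (btw_level n0); rewrite ?aN ?bN ?dN //.
    rewrite !lt_neqAle amin ?bmax // !andbT eq_sym !ne ?aN ?bN ?dN //.
  - exact: corner_exposed.
apply: leq_trans (_ : 2 + 2 + 2 <= _)%N => //.
apply: leq_trans (leq_add (leq_add h1 h2) h3).
apply: leq_trans (leq_add (leq_card_setU _ _) (leqnn _)).
apply: leq_trans (leq_card_setU _ _); apply: subset_leq_card.
apply/subsetP => v; move: (corners Q) => F vF; rewrite !inE vF /=.
rewrite -lf_nrm lfN ltrN2 subr_eq0.
by case: ltgtP.
Qed.

End Extremes.

(** * Covering boundary points by few supporting lines *)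

Section Covers.
Variable R : realFieldType.
Local Notation pt := (R * R)%type.
Variables (T : finType) (c : T -> pt).
Implicit Types (Q S W : {set T}) (o : pt) (a b q r v w x z m p : T) (h : pt * R).
Local Notation "'D' p q r" := (det3 (c p) (c q) (c r))
  (at level 10, p, q, r at level 9).
Local Notation inner := (interior c).
Local Notation bnd := (boundary c).
Local Notation closed := (convex_closed c).
Local Notation face := (face c).
Local Notation on := (on c).
Local Notation cover := (face_cover c).
Local Notation corners := (corners c).
Local Notation side_end := (side_end c).
Hypothesis cI : injective c.
Hypothesis H5 : forall S, five_exposed c S -> exists2 p : T, p \notin S & ~ ssep c S (c p).

Lemma cornerP Q v : v \in corners Q -> exists b, side_end Q b v.
Proof. by rewrite inE => /existsP. Qed.

Lemma side_end_corner Q b v : side_end Q b v -> v \in corners Q.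
Proof. by move=> h; rewrite inE; apply/existsP; exists b. Qed.

Lemma cover_family Q W (F : {set T}) k (P : T -> T -> Prop) : (#|F| <= k)%N ->
  (forall v, v \in F -> exists2 h, face Q h & forall w, w \in W -> P v w -> on h w) ->
  (forall w, w \in W -> exists2 v, v \in F & P v w) -> cover k Q W.
Proof.
move=> Fk hF hW.
have /choice[f hf] : forall v, exists h, v \in F ->
    face Q h /\ forall w, w \in W -> P v w -> on h w.
  move=> v; have [vF|vF] := boolP (v \in F); last by exists ((0, 0), 0).
  by have [h h1 h2] := hF v vF; exists h.
exists [seq f v | v <- enum F]; split.
- by rewrite size_map -cardE.
- by move=> h /mapP[v]; rewrite mem_enum => vF ->; case: (hf v vF).
move=> w wW; have [v vF vw] := hW w wW; exists (f v).
  by apply: map_f; rewrite mem_enum.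
by case: (hf v vF) => _; apply.
Qed.

Lemma coverS k Q W W' : W \subset W' -> cover k Q W' -> cover k Q W.
Proof.
by move=> /subsetP sub [s [h1 h2 h3]]; exists s; split=> // w /sub; exact: h3.
Qed.

Lemma corner_line_face Q v : v \in corners Q ->
  exists2 h, face Q h & forall b q, side_end Q b v -> D b v q = 0 -> on h q.
Proof.
move=> /cornerP[b0 e0]; have [bQ vQ bv h1 _] := side_endP e0.
have [h hf hon] := line_face cI bv h1; exists h => // b q e l; apply: hon.
by have [hh _] := side_end_line cI (c q) e e0; apply: hh.
Qed.

Lemma edge_corner Q o p b : hull_edge c o Q p b -> exists2 v, v \in corners Q &
  exists2 a, side_end Q a v & D a v p = 0.
Proof.
move=> /edgeP[pQ bQ pb h _].
have pb' : p != b by apply: contraTneq pb => ->; rewrite det3_eqr ltxx.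
have [v [e _ _]] := side_end_exists cI pQ bQ pb' h.
by exists v; [exact: side_end_corner e|exists p; rewrite ?det3_eqm].
Qed.

Lemma boundary_cover Q o k : ~ wsep c Q o -> (#|corners Q| <= k)%N -> cover k Q (bnd Q).
Proof.
move=> oI Fk; apply: (@cover_family Q _ (corners Q) k (fun v w => exists2 a, side_end Q a v & D a v w = 0)) => //.
  move=> v vF; have [h hf hon] := corner_line_face vF; exists h => // w _ [a e l].
  exact: hon e l.
move=> w wb; have [b e] := edge_ex cI oI wb; have [v vF [a e' l]] := edge_corner e.
by exists v => //; exists a.
Qed.

(** The centroid of a triangle serves as centre when no point of the set is
    interior. *)
Lemma noncollinear_center Q a b d : a \in Q -> b \in Q -> d \in Q -> D a b d != 0 ->
  exists o, [/\ ~ wsep c Q o &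
    forall u, 3 * lf u o = lf u (c a) + lf u (c b) + lf u (c d)].
Proof.
move=> aQ bQ dQ abd.
pose o : pt := (((c a).1 + (c b).1 + (c d).1) / 3, ((c a).2 + (c b).2 + (c d).2) / 3).
have oE u : 3 * lf u o = lf u (c a) + lf u (c b) + lf u (c d).
  by rewrite /o /lf /=; field.
exists o; split=> // -[u u0 hu]; case/eqP: abd.
have := oE u; have := hu a aQ; have := hu b bQ; have := hu d dQ => h1 h2 h3 h4.
apply: (lf_level_det u0); lra.
Qed.

(** If the core inner Q is not collinear, it has at most four sides, every
    boundary point of Q is beyond one of them, and face_above applies.  If it
    is collinear, Q itself has at most six sides. *)
Lemma core_boundary_cover Q z : closed Q -> z \in inner Q -> inner (inner Q) = set0 ->
  cover 6 Q (bnd Q).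
Proof.
move=> cQ zI I2; have oI := inner_nwsep zI; have cJ := inner_closed cQ.
have [/existsP[a /existsP[b /existsP[d /and4P[aI bI dI abd]]]]|no] :=
  boolP [exists a, exists b, exists d, [&& a \in inner Q, b \in inner Q, d \in inner Q & D a b d != 0]].
  have [o [oJ oE]] := noncollinear_center aI bI dI abd.
  apply: (@cover_family Q _ (corners (inner Q)) 6 (fun v w => exists2 e, side_end (inner Q) e v & D e v w < 0)).
  - exact: leq_trans (corners_card4 cI H5 cJ I2) _.
  - move=> v /cornerP[e0 se0]; have [eI vI ev h1 _] := side_endP se0.
    pose n := - nrm (c e0) (c v); pose k := - lf (nrm (c e0) (c v)) (c e0).
    have nE q : lf n (c q) = k - D e0 v q by rewrite /n /k lfN -lf_nrm; lra.
    have [|||h hf hon] := @face_above _ _ c cI H5 Q z n k e0 v cQ zI _ eI vI ev.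
    + split=> /=; first by rewrite oppr_eq0 nrm_neq0 // (inj_eq cI).
      by move=> q /h1; rewrite nE; lra.
    + by rewrite /on /= nE det3_eqm subr0.
    + by rewrite /on /= nE det3_eqr subr0.
    exists h => // w wb [e se l]; apply: hon; first exact: bndQ wb.
    have [_ hh] := side_end_line cI (c w) se se0; rewrite nE.
    by have := hh l; lra.
  move=> p pb; have pI : p \notin inner Q by move: pb; rewrite inE => /andP[].
  have [u [hu hu']] := outer_support cQ pI.
  have uo : lf u o < lf u (c p).
    by have := oE u; have := hu' _ aI; have := hu' _ bI; have := hu' _ dI; lra.
  have po : c p != o by apply: contraTneq uo => ->; rewrite ltxx.
  have [e [f [ef ep pf]]] := sector_exists oJ po.
  case/edgeP: (ef) => eI fI oef hef _.
  have efp : D e f p < 0.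
    rewrite ltNge; apply/negP => l.
    apply: (@max_not_in_triangle _ u (c e) (c f) o (c p)).
    + by rewrite det3_cyc.
    + exact: ep.
    + exact: l.
    + exact: hu'.
    + exact/ltW/hu'.
    + exact: ltW.
  have ef' : e != f by apply: contraTneq oef => ->; rewrite det3_eqr ltxx.
  have [v [se _ sg]] := side_end_exists cI eI fI ef' hef.
  exists v; first exact: side_end_corner se.
  by exists e => //; apply: sg.
have col a b d : a \in inner Q -> b \in inner Q -> d \in inner Q -> D a b d = 0.
  move=> aI bI dI; apply: contrapT => /eqP h; case/negP: no.
  by apply/existsP; exists a; apply/existsP; exists b; apply/existsP; exists d; rewrite aI bI dI.
apply: (boundary_cover oI).
have [/existsP[y /andP[yI yz]]|/existsPn one] := boolP [exists y, (y \in inner Q) && (y != z)].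
  by apply: (@corners_card6 _ _ _ cI H5 Q z y) => //; [exact: innerQ yI|rewrite eq_sym|move=> j jI; exact: col].
have [/existsP[y /andP[yI yz]]|/existsPn one'] := boolP [exists y, (y \in Q) && (y != z)].
  apply: (@corners_card6 _ _ _ cI H5 Q z y) => //; first by rewrite eq_sym.
  by move=> j jI; have := one j; rewrite jI /= negbK => /eqP ->; rewrite det3_eqm.
case: oI; exists (1, 0); first exact: unit_pt_neq0.
by move=> q qQ; have := one' q; rewrite qQ /= negbK => /eqP ->.
Qed.

(** Without inner points, Q has at most four sides or is collinear. *)
Lemma coreless_cover Q : closed Q -> inner Q = set0 -> cover 4 Q Q.
Proof.
move=> cQ I0.
have Qb : Q = bnd Q by rewrite /boundary I0 setD0.
have [/existsP[a /existsP[b /existsP[d /and4P[aI bI dI abd]]]]|no] :=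
  boolP [exists a, exists b, exists d, [&& a \in Q, b \in Q, d \in Q & D a b d != 0]].
  have [o [oJ oE]] := noncollinear_center aI bI dI abd.
  rewrite {2}Qb; apply: (boundary_cover oJ); exact: corners_card4.
have col a b d : a \in Q -> b \in Q -> d \in Q -> D a b d = 0.
  move=> aI bI dI; apply: contrapT => /eqP h; case/negP: no.
  by apply/existsP; exists a; apply/existsP; exists b; apply/existsP; exists d; rewrite aI bI dI.
have [Q0|[a aQ]] := set_0Vmem Q.
  by exists [::]; split=> // w; rewrite Q0 inE.
have [/existsP[b /andP[bQ ba]]|/existsPn one] := boolP [exists b, (b \in Q) && (b != a)].
  have [|h hf hon] := @line_face _ _ c cI Q b a ba; first by move=> r rQ; rewrite col.
  exists [:: h]; split=> // h'; first by rewrite inE => /eqP ->.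
  by move=> hQ; exists h; rewrite ?inE ?eqxx //; apply: hon; apply: col.
have [h hf hon] : exists2 h, face Q h & on h a by apply: bnd_face; rewrite -Qb.
exists [:: h]; split=> // h'; first by rewrite inE => /eqP ->.
move=> hQ; exists h; rewrite ?inE ?eqxx //.
by have := one h'; rewrite hQ /= negbK => /eqP ->.
Qed.

(** The bound of core_boundary_cover for the innermost layers is carried
    outwards: by unflanked_step the unflanked vertices of Q are on the rays of
    those of inner Q, and face_ray applies. *)
Lemma unflanked_cover Q z : closed Q -> innermost c Q z -> z \in inner (inner Q) ->
  cover 6 (inner Q) [set w | `[< unflanked c z Q w >]].
Proof.
have [n] := ubnP #|Q|; elim: n Q => // n ih Q hn cQ im z2.
have cI' := inner_closed cQ.
have ub w : unflanked c z Q w -> w \in bnd (inner Q).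
  by move=> [x [a [a' [e _ _ _]]]]; case: (edge_bnd e).
have [z3|z3] := boolP (z \in inner (inner (inner Q))).
  have lt_n : (#|inner Q| < n)%N.
    rewrite -ltnS; apply: leq_trans hn; rewrite ltnS (card_bnd_inner c Q) -add1n leq_add2r.
    have dz : (((c z).1 + 1, (c z).2) : pt) != c z.
      by apply/eqP => /(congr1 fst) /= e; lra.
    have [a [b [e _ _]]] := sector_exists (inner_nwsep (innerQ z2)) dz.
    by rewrite card_gt0; apply/set0Pn; exists a; case: (edge_bnd e).
  have [s [s6 sf sW]] := ih _ lt_n cI' (innermost_inner im) z3.
  have /choice[f hf] : forall h, exists h', face (inner (inner Q)) h -> face (inner Q) h' /\
     forall w m n, w \in bnd (inner Q) -> m \in inner (inner Q) -> on h m ->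
    D z m w = 0 -> 0 < D z m n -> 0 < D z w n -> on h' w.
    move=> h; have [hh|hh] := pselect (face (inner (inner Q)) h); last by exists h.
    by have [h' h1 h2] := face_ray cI H5 cI' z3 hh; exists h'.
  exists [seq f h | h <- s]; split; first by rewrite size_map.
    by move=> h /mapP[h0 /sf hh ->]; case: (hf _ hh).
  move=> w; rewrite inE => /asboolP uw; have [m um [mw [k [mk wk]]]] := unflanked_step cI H5 cQ z3 uw.
  have [h hs hm] : exists2 h, h \in s & on h m by apply: sW; rewrite inE; apply/asboolP.
  exists (f h); first exact: map_f.
  have [_ hh] := hf _ (sf _ hs); apply: (hh w m k) => //; first exact: ub.
  by move: um => [x [a [a' [/edgeP[]]]]].
have I3 : inner (inner (inner Q)) = set0.
  by have [//|] := im 3; rewrite /= (negbTE z3).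
apply: coverS (core_boundary_cover cI' z2 I3).
by apply/subsetP => w; rewrite inE => /asboolP /ub.
Qed.

Lemma cover_card Q W k M : (0 < M)%N ->
  (forall p q, p != q -> (#|[set r | (D p q r == 0)%R]| <= M)%N) -> cover k Q W -> (#|W| <= k * M)%N.
Proof.
move=> M0 hM [s [sk sf sW]].
have one h : face Q h -> (#|[set w in W | lf h.1 (c w) == h.2]| <= M)%N.
  move=> [h0 _]; set X := [set _ in W | _].
  have XP w : w \in X -> lf h.1 (c w) = h.2 by rewrite inE => /andP[_ /eqP].
  have [X1|X2] := leqP #|X| 1; first exact: leq_trans X1 M0.
  case/card_gt1P: X2 => p [q [pX qX pq]].
  apply: leq_trans (subset_leq_card _) (hM p q pq); apply/subsetP => r rX.
  by rewrite inE; apply/eqP/(lf_level_det h0); rewrite !XP.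
apply: leq_trans (_ : size s * M <= _)%N; last by rewrite leq_mul2r sk orbT.
have : W \subset \bigcup_(h <- s) [set w in W | lf h.1 (c w) == h.2].
  apply/subsetP => w wW; have [h hs hw] := sW w wW.
  by rewrite big_tnth; have /(nthP h)[i si hi] := hs; apply/bigcupP;
     exists (Ordinal si) => //; rewrite (tnth_nth h) /= hi inE wW hw eqxx.
move/subset_leq_card/leq_trans; apply.
elim: s sf {sk sW} => [|h s ih] sf; first by rewrite big_nil cards0.
rewrite big_cons mulSn; apply: leq_trans (leq_card_setU _ _) _.
apply: leq_add; first by apply: one; apply: sf; rewrite inE eqxx.
by apply: ih => h' hs; apply: sf; rewrite inE hs orbT.
Qed.

End Covers.

(** * Cutting off the points beyond edges *)

Section Gain.
Variable R : realFieldType.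
Local Notation pt := (R * R)%type.
Variables (T : finType) (c : T -> pt).
Implicit Types (Q S W X : {set T}) (o : pt) (a b q r v w x y z m p : T) (h : pt * R).
Local Notation "'D' p q r" := (det3 (c p) (c q) (c r))
  (at level 10, p, q, r at level 9).
Local Notation inner := (interior c).
Local Notation bnd := (boundary c).
Local Notation closed := (convex_closed c).
Hypothesis cI : injective c.
Hypothesis H5 : forall S, five_exposed c S -> exists2 p : T, p \notin S & ~ ssep c S (c p).

Lemma bnd_neq0 Q z : z \in inner Q -> bnd Q != set0.
Proof.
move=> zI; have dz : (((c z).1 + 1, (c z).2) : pt) != c z.
  by apply/eqP => /(congr1 fst) /= e; lra.
have [a [b [e _ _]]] := sector_exists (inner_nwsep zI) dz.
by apply/set0Pn; exists a; case: (edge_bnd e).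
Qed.

Lemma inner_lt Q z : z \in inner Q -> (#|inner Q| < #|Q|)%N.
Proof.
by move=> /bnd_neq0 h; rewrite (card_bnd_inner c Q) -{1}[#|inner Q|]add0n ltn_add2r card_gt0.
Qed.

(** The layers of a nonempty finite set decrease strictly as long as they have
    inner points. *)
Lemma innermost_exists Q : Q != set0 -> exists2 z, z \in Q & innermost c Q z.
Proof.
have inner0 : inner set0 = set0 by apply/setP => q; rewrite !inE.
have [n] := ubnP #|Q|; elim: n Q => // n ih Q hn /set0Pn[q qQ].
have [I0|[z zI]] := set_0Vmem (inner Q).
  exists q => // -[|j]; [by right|left].
  by rewrite iterSr I0; elim: j => //= j ->.
have [||y yI yin] := ih (inner Q).
- by rewrite -ltnS; apply: leq_trans hn; rewrite ltnS; apply: inner_lt zI.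
- by apply/set0Pn; exists z.
exists y; first exact: innerQ yI.
by case=> [|j]; [right; exact: innerQ yI|rewrite iterSr; exact: yin].
Qed.

Section Cut.
Variables (Q : {set T}) (z : T).
Hypothesis cQ : closed Q.
Hypothesis zI : z \in inner (inner Q).
Local Notation nx := (nxt c (c z) (inner Q)).
Local Notation L := (bnd (inner Q)).

Definition beyond_of w : {set T} := [set p in Q | D w (nx w) p < 0].
Local Notation beyond := beyond_of.
(** The points removed by the cut along the edges that start in X; ends X
    consists of the ends of these edges. *)
Definition beyonds_of X : {set T} := \bigcup_(w in X) beyond w.
Local Notation beyonds := beyonds_of.
Definition ends_of X : {set T} := X :|: [set nx w | w in X].
Local Notation ends := ends_of.

Let oI := inner_nwsep zI.
Let zI1 := innerQ zI.

Lemma edge_nx w : w \in L -> hull_edge c (c z) (inner Q) w (nx w).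
Proof. exact: (edge_nxt cI oI). Qed.

Lemma nx_L w : w \in L -> nx w \in L.
Proof. exact: (nxt_bnd cI oI). Qed.

Lemma beyond_bnd w p : w \in L -> p \in beyond w -> p \in bnd Q.
Proof.
move=> wL; rewrite inE => /andP[pQ l]; case: (bnd_or c pQ) => // pI.
by case/edgeP: (edge_nx wL) => _ _ _ /(_ p pI); rewrite leNgt l.
Qed.

(** The edges of X support the remaining set, so their ends become boundary
    points. *)
Lemma gain X : X \subset L -> closed (Q :\: beyonds X) /\
  (#|bnd Q| + #|ends X| <= #|bnd (Q :\: beyonds X)| + #|beyonds X|)%N.
Proof.
move=> /subsetP XL; set Q' := Q :\: _.
have Q'pos w r : w \in X -> r \in Q' -> 0 <= D w (nx w) r.
  move=> wX; rewrite inE => /andP[/bigcupP h rQ]; rewrite leNgt; apply/negP => l.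
  by apply: h; exists w => //; rewrite inE rQ.
have bQ p : p \in beyonds X -> p \in bnd Q.
  by move=> /bigcupP[w wX]; apply: beyond_bnd; apply: XL.
split.
  move=> p; rewrite inE negb_and negbK => /orP[/bigcupP[w wX]|pQ]; last first.
    by apply: ssepS (cQ pQ); exact: subsetDl.
  rewrite inE => /andP[pQ l]; apply: (@ssep_det _ _ _ _ _ (c w) (c (nx w))) => q qQ.
  exact: lt_le_trans l (Q'pos w q wX qQ).
have endL w : w \in ends X -> w \in L.
  by rewrite inE => /orP[/XL//|/imsetP[y /XL yL ->]]; apply: nx_L.
have endQ' w : w \in ends X -> w \in Q'.
  move=> wE; have wI := bndQ (endL w wE); rewrite inE (innerQ wI) andbT.
  by apply/negP => /bQ /bnd_inner; apply.
have sub : (bnd Q :\: beyonds X) :|: ends X \subset bnd Q'.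
  apply/subsetP => p; rewrite inE => /orP[].
    rewrite inE => /andP[pn pb]; apply/bndE; split; first by rewrite inE pn (bndQ pb).
    by case/bndE: pb => _; apply: wsepS; exact: subsetDl.
  move=> pE; apply/bndE; split; first exact: endQ'.
  have sep w q : w \in X -> q \in [:: w; nx w] -> wsep c Q' (c q).
    move=> wX; have wL := XL w wX; case/edgeP: (edge_nx wL) => _ _ h _ _.
    have ne : c w != c (nx w) by apply: contraTneq h => ->; rewrite det3_eqr ltxx.
    rewrite !inE => /orP[]/eqP->; apply: (@wsep_det _ _ _ _ _ _ _ ne) => r rQ;
      by rewrite ?det3_eqm ?det3_eqr; apply: Q'pos.
  move: pE; rewrite inE => /orP[pX|/imsetP[w wX ->]].
    by apply: (sep p); rewrite // inE eqxx.
  by apply: (sep w); rewrite // !inE eqxx orbT.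
have disj : (bnd Q :\: beyonds X) :&: ends X = set0.
  apply/setP => p; rewrite !in_set0 in_setI; apply/negP => /andP[].
  by rewrite in_setD => /andP[_ pb] /endL /bndQ; apply: bnd_inner pb.
apply: leq_trans (leq_add (subset_leq_card sub) (leqnn _)).
rewrite cardsU disj cards0 subn0 addnAC leq_add2r.
rewrite -(cardsID (beyonds X) (bnd Q)) addnC leq_add2l.
by apply: subset_leq_card; apply: subsetIr.
Qed.

Lemma beyond_collinear w a b d : w \in L -> a \in beyond w -> b \in beyond w -> d \in beyond w ->
  D a b d = 0.
Proof.
move=> wL; rewrite !inE => /andP[aQ la] /andP[bQ lb] /andP[dQ ld].
case/edgeP: (edge_nx wL) => wI xI wx h _.
pose n := - nrm (c w) (c (nx w)); pose k := - lf (nrm (c w) (c (nx w))) (c w).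
have nE q : lf n (c q) = k - D w (nx w) q by rewrite /n /k lfN -lf_nrm; lra.
apply: (@collinear_beyond_support _ _ _ cI H5 Q n k w (nx w)) => //; rewrite ?nE ?det3_eqm ?det3_eqr; try lra.
- by move=> q qI; have := h q qI; rewrite nE; lra.
- by apply: contraTneq wx => <-; rewrite det3_eqr ltxx.
Qed.

(** A point beyond an edge and past its second end is beyond the next edge
    too. *)
Lemma opposite_cone_next w p : w \in L -> D w (nx w) p < 0 -> 0 <= D z (nx w) p ->
  D (nx w) (nx (nx w)) p < 0.
Proof.
move=> wL; case/edgeP: (edge_nx wL) => wI xI wx h _.
case/edgeP: (edge_nx (nx_L wL)); set x := nx w; set y := nx x => _ yI xy _ _.
have := h y yI; have := plucker (c x) (c w) (c z) (c y) (c p).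
have -> : D x w z = D z x w by rewrite det3_cyc det3_cyc.
rewrite (det3_swapr (c z) (c x)) (det3_swap (c x) (c w) (c y)) (det3_swap (c x) (c z) (c p))
  (det3_swap (c x) (c w) (c p)) (det3_swap (c x) (c z) (c y)).
move: wx xy; rewrite -/x -/y.
move: (D z w x) (D z x y) (D x y p) (D w x y) (D z x p) (D w x p) => A B C E F G hA hB e hE hG hF.
rewrite ltNge; apply/negP => hC.
have := mulr_ge0 (ltW hA) hC; have := mulr_ge0 hE hF; have := mulr_gt0 (_ : 0 < - G) hB.
by rewrite oppr_gt0 => /(_ hG); lra.
Qed.

Lemma opposite_cone_prev w p : w \in L -> D (nx w) (nx (nx w)) p < 0 -> D z (nx w) p <= 0 ->
  D w (nx w) p < 0.
Proof.
move=> wL; case/edgeP: (edge_nx wL) => wI xI wx h _.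
case/edgeP: (edge_nx (nx_L wL)); set x := nx w; set y := nx x => _ yI xy _ _.
have := h y yI; have := plucker (c x) (c w) (c z) (c y) (c p).
have -> : D x w z = D z x w by rewrite det3_cyc det3_cyc.
rewrite (det3_swapr (c z) (c x)) (det3_swap (c x) (c w) (c y)) (det3_swap (c x) (c z) (c p))
  (det3_swap (c x) (c w) (c p)) (det3_swap (c x) (c z) (c y)).
move: wx xy; rewrite -/x -/y.
move: (D z w x) (D z x y) (D x y p) (D w x y) (D z x p) (D w x p) => A B C E F G hA hB e hE hC hF.
rewrite ltNge; apply/negP => hG.
have := mulr_gt0 hA (_ : 0 < - C); have := mulr_ge0 hE (_ : 0 <= - F); have := mulr_ge0 hG (ltW hB).
by rewrite oppr_gt0 oppr_ge0 => h1 /(_ hF) h2 /(_ hC) h3; lra.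
Qed.

(** The points of bnd Q in the sector of w, closed at w and open at the next
    vertex. *)
Definition fibre_of w : {set T} := [set p in bnd Q | (0 <= D z w p) && (0 < D z p (nx w))].
Local Notation fibre := fibre_of.

Lemma fibre_exists p : p \in bnd Q -> exists2 w, w \in L & p \in fibre w.
Proof.
move=> pb; have pz := bnd_neq (inner_nwsep zI1) pb.
have [a [b [e h1 h2]]] := sector_exists oI pz; have [aL _] := edge_bnd e.
by exists a => //; rewrite inE pb (nxtE cI oI e) h1.
Qed.

Lemma fibre_unique v w p : v \in L -> w \in L -> p \in fibre v -> p \in fibre w -> v = w.
Proof.
suff gen v' w' : v' \in L -> w' \in L -> p \in fibre v' -> p \in fibre w' -> 0 <= D z v' w' -> w' = v'.
  move=> vL wL pv pw; case: (leP 0 (D z v w)) => h; first by apply/esym/gen.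
  by apply: gen => //; rewrite det3_swapr oppr_ge0 ltW.
move=> vL wL; rewrite !inE => /and3P[_ h1 h2] /and3P[_ h3 h4] h5.
have e := edge_nx vL; case/edgeP: (e) => _ _ vx _ _.
apply: (bnd_in_sector cI oI e wL h5); rewrite ltNge; apply/negP => l.
case/edgeP: (edge_nx wL) => _ _ wx _ _.
have := plucker (c z) (c v') (c (nx v')) (c w') (c p).
rewrite (det3_swapr (c z) (c (nx v')) (c p)) (det3_swapr (c z) (c (nx v')) (c w')) => e0.
have := mulr_ge0 (ltW vx) h3; have := mulr_ge0 h5 (ltW h2).
have := mulr_ge0 h1 (_ : 0 <= - D z w' (nx v')); rewrite oppr_ge0 => /(_ l) m1 m2 m3.
have wp : D z v' (nx v') * D z w' p = 0 by lra.
have {}wp : D z w' p = 0 by move/eqP: wp; rewrite mulf_eq0 gt_eqF //= => /eqP.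
have pw : D z p w' = 0 by rewrite det3_swapr wp oppr0.
by have := ray_turn pw wx h4 h2; rewrite ltNge l.
Qed.

End Cut.
End Gain.

(** * Runs of edges *)

Section Runs.
Variable R : realFieldType.
Local Notation pt := (R * R)%type.
Variables (T : finType) (c : T -> pt).
Implicit Types (Q S W X : {set T}) (o : pt) (a b q r v w x y z m p : T) (h : pt * R).
Local Notation "'D' p q r" := (det3 (c p) (c q) (c r))
  (at level 10, p, q, r at level 9).
Local Notation inner := (interior c).
Local Notation bnd := (boundary c).
Local Notation closed := (convex_closed c).
Hypothesis cI : injective c.
Hypothesis H5 : forall S, five_exposed c S -> exists2 p : T, p \notin S & ~ ssep c S (c p).

Lemma nxt_id o Q v : v \notin bnd Q -> nxt c o Q v = v.
Proof.
by move=> vb; rewrite /nxt; case: pickP => //= x /edge_bnd[]; rewrite (negbTE vb).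
Qed.

Variables (Q : {set T}) (z : T).
Hypothesis cQ : closed Q.
Hypothesis zI : z \in inner (inner Q).
Local Notation nx := (nxt c (c z) (inner Q)).
Local Notation L := (bnd (inner Q)).
Local Notation beyond := (beyond_of c Q z).
Local Notation beyonds := (beyonds_of c Q z).
Local Notation ends := (ends_of c Q z).
Local Notation fibre := (fibre_of c Q z).

Let oI := inner_nwsep zI.
Let zI1 := innerQ zI.

Lemma nx_inj : injective nx.
Proof.
move=> v w e; have [vL|vL] := boolP (v \in L); have [wL|wL] := boolP (w \in L).
- exact: (nxt_inj cI oI).
- by move: (wL); rewrite -(nxt_id (c z) wL) -e (nx_L cI zI vL).
- by move: (vL); rewrite -(nxt_id (c z) vL) e (nx_L cI zI wL).
by rewrite -(nxt_id (c z) vL) e nxt_id.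
Qed.

Lemma iter_nx_L i w : w \in L -> iter i nx w \in L.
Proof. by move=> wL; elim: i => //= i; apply: nx_L. Qed.

Lemma iter_nx_inj i : injective (iter i nx).
Proof. by elim: i => // i ih v w /= /nx_inj /ih. Qed.

Lemma iter_nx_sub i j v w : (i <= j)%N -> iter i nx v = iter j nx w -> v = iter (j - i) nx w.
Proof. by move=> le; rewrite -{1}(subnKC le) iterD => /iter_nx_inj. Qed.

Lemma L_reach v w : v \in L -> w \in L -> exists i, w = iter i nx v.
Proof.
move=> vL wL; pose X := [set u in L | `[< exists i, u = iter i nx v >]].
have XE : X = L.
  apply: (nxt_connected cI oI); [apply/set0Pn; exists v|by apply/subsetP => u; rewrite inE => /andP[]|].
    by rewrite inE vL; apply/asboolP; exists 0%N.
  move=> u; rewrite [u \in X]inE [nx u \in X]inE => /andP[uL /asboolP[i ->]].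
  by rewrite (nx_L cI zI) ?iter_nx_L //=; apply/asboolP; exists i.+1.
by move: wL; rewrite -XE inE => /andP[_ /asboolP].
Qed.

(** Two points of a fibre are one on the ray of w and one strictly inside,
    since neither place holds two. *)
Lemma fibre_le1 w : w \in L -> ~ unflanked c z Q w -> (#|fibre w| <= 1)%N.
Proof.
move=> wL un; rewrite leqNgt; apply/negP => /card_gt1P[p [q [pf qf pq]]].
have e := edge_nx cI zI wL; case/edgeP: (e) => _ _ wx _ _.
move: pf qf; rewrite [p \in _]inE [q \in _]inE => /and3P[pb p1 p2] /and3P[qb q1 q2].
have gen a b : a \in bnd Q -> b \in bnd Q -> 0 = D z w a -> 0 < D z w b -> 0 < D z a (nx w) -> 0 < D z b (nx w) -> False.
  by move=> ab bb a0 b0 a1 b1; apply: un; exists (nx w), a, b; split.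
move: p1 q1; rewrite !le_eqVlt => /orP[/eqP p1|p1] /orP[/eqP q1|q1].
- case/eqP: pq; apply: (bnd_same_ray cI (inner_nwsep zI1) pb qb _ p2 q2).
  by apply: (line_trans wx).
- exact: (gen p q).
- exact: (gen q p).
by case/eqP: pq; apply: (sector_unique cI H5 cQ zI1 e pb qb).
Qed.

(** The points beyond the edge of w that are at or past its second end;
    rest_left consists of the points beyond the next edge that are before its
    first end.  Both sets are beyond the two edges at that vertex. *)
Definition rest_right_of w := [set p in beyond w | 0 <= D z (nx w) p].
Local Notation rest_right := rest_right_of.
Definition rest_left_of w := [set p in beyond (nx w) | D z (nx w) p < 0].
Local Notation rest_left := rest_left_of.

Lemma rest_card w : w \in L ->
  (#|rest_left w| + #|rest_right w| <= #|beyond w :&: beyond (nx w)|)%N.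
Proof.
move=> wL; have disj : rest_left w :&: rest_right w = set0.
  apply/setP => p; rewrite in_set0 in_setI; apply/negP => /andP[].
  by rewrite !in_set => /andP[_ l] /andP[_]; rewrite leNgt l.
rewrite -cardsUI disj cards0 addn0.
apply: subset_leq_card; apply/subsetP => p; rewrite in_setU in_setI.
move=> /orP[]; rewrite in_set => /andP[pb l].
  rewrite pb andbT; move: pb; rewrite !in_set => /andP[-> l'] /=.
  exact: (opposite_cone_prev cI zI wL l' (ltW l)).
rewrite pb /=; move: pb; rewrite !in_set => /andP[-> l'] /=.
exact: (opposite_cone_next cI zI wL l' l).
Qed.

(** From an edge of the run, walk towards p: by the opposite cone lemmas p
    stays beyond the edges, until its sector or an end of the run is reached.
    *)
Lemma run_split w k p j : w \in L -> (0 < j <= k)%N -> p \in beyond (iter j nx w) ->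
  [\/ exists2 i, (0 < i <= k)%N & p \in fibre (iter i nx w), p \in rest_left w |
      p \in rest_right (iter k nx w)].
Proof.
move=> wL /andP[j0 jk] pj.
have pb : p \in bnd Q by apply: (beyond_bnd cI zI _ pj); apply: iter_nx_L.
have pQ := bndQ pb.
case: (leP 0 (D z (iter j nx w) p)) => l.
  have [d] := ubnP (k - j); elim: d j j0 jk pj l => // d ih j j0 jk pj l hd.
  case: (ltP 0 (D z p (nx (iter j nx w)))) => l'.
    by constructor 1; exists j; rewrite ?j0 // inE pb l.
  have {}l' : 0 <= D z (iter j.+1 nx w) p by rewrite det3_swapr oppr_ge0.
  move: jk; rewrite leq_eqVlt => /orP[/eqP ejk|jk].
    by constructor 3; rewrite -ejk inE pj.
  apply: (ih j.+1) => //; last first.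
    by rewrite -ltnS; apply: leq_trans hd; rewrite ltnS subnS prednK // subn_gt0.
  move: pj; rewrite !in_set => /andP[_ pj]; rewrite pQ.
  exact: (opposite_cone_next cI zI (iter_nx_L j wL) pj l').
elim: j j0 jk pj l => // j ih _ jk pj l.
case: j ih jk pj l => [|j] ih jk pj l.
  by constructor 2; rewrite inE pj.
have pj' : p \in beyond (iter j.+1 nx w).
  move: pj; rewrite !in_set => /andP[_ pj]; rewrite pQ.
  exact: (opposite_cone_prev cI zI (iter_nx_L j.+1 wL) pj (ltW l)).
case: (leP 0 (D z (iter j.+1 nx w) p)) => l'; last by apply: ih => //; exact: ltnW.
constructor 1; exists j.+1; first by rewrite /= ltnW.
by rewrite inE pb l' /= det3_swapr oppr_gt0.
Qed.

(** The k vertices after w. *)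
Definition run_of w k : {set T} := [set iter i.+1 nx w | i : 'I_k].
Local Notation run := run_of.

Lemma run_sub w k : w \in L -> run w k \subset L.
Proof. by move=> wL; apply/subsetP => _ /imsetP[i _ ->]; apply: (iter_nx_L i.+1 wL). Qed.

Lemma run_inj w k : (forall d, (0 < d <= k)%N -> iter d nx w != w) ->
  injective (fun i : 'I_k.+1 => iter i.+1 nx w).
Proof.
move=> hk; suff gen (i j : 'I_k.+1) : (i < j)%N -> iter i.+1 nx w = iter j.+1 nx w -> False.
  by move=> i j e; apply/val_inj; case: (ltngtP i j) => // l; [case: (gen i j l e)|case: (gen j i l (esym e))].
move=> l e; have ew := iter_nx_sub (ltnW l : (i.+1 <= j.+1)%N) e.
rewrite subSS in ew; have := hk (j - i)%N; rewrite subn_gt0 l -ew eqxx.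
have jk : (j <= k)%N by rewrite -ltnS; apply: ltn_ord.
by rewrite (leq_trans (leq_subr _ _) jk) => /(_ isT).
Qed.

(** k consecutive edges that do not close up have k + 1 ends. *)
Lemma ends_run_card w k : (0 < k)%N -> (forall d, (0 < d <= k)%N -> iter d nx w != w) ->
  (k < #|ends (run w k)|)%N.
Proof.
move=> k0 /run_inj inj; rewrite -ltnS -[k.+1]card_ord -(card_imset _ inj) ltnS.
apply: subset_leq_card; apply/subsetP => _ /imsetP[i _ ->].
have := ltn_ord i; rewrite ltnS leq_eqVlt in_setU => /orP[/eqP ik|ik].
  apply/orP; right; apply/imsetP; exists (iter i nx w) => //.
  have pk : (k.-1 < k)%N by rewrite ltn_predL.
  by apply/imsetP; exists (Ordinal pk); rewrite // ik -[in LHS](prednK k0).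
by apply/orP; left; apply/imsetP; exists (Ordinal ik).
Qed.

Lemma run_card w k : w \in L -> (forall i, (0 < i <= k)%N -> (#|fibre (iter i nx w)| <= 1)%N) ->
  (#|beyonds (run w k)| <= k + #|rest_left w| + #|rest_right (iter k nx w)|)%N.
Proof.
move=> wL hf.
have sub : beyonds (run w k) \subset
  ((\bigcup_(i < k) fibre (iter i.+1 nx w)) :|: rest_left w) :|: rest_right (iter k nx w).
  apply/subsetP => p /bigcupP[_ /imsetP[i _ ->] pi].
  have [|[j /andP[j0 jk] pj]|pl|pr] := @run_split w k p i.+1 wL _ pi; first exact: ltn_ord.
  - rewrite !in_setU; apply/orP; left; apply/orP; left; apply/bigcupP.
    case: j j0 jk pj => // j _ jk pj; by exists (Ordinal jk).
  - by rewrite !in_setU pl orbT.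
  - by rewrite !in_setU pr orbT.
apply: leq_trans (subset_leq_card sub) _.
apply: leq_trans (leq_card_setU _ _) _; rewrite leq_add2r.
apply: leq_trans (leq_card_setU _ _) _; rewrite leq_add2r.
apply: leq_trans (card_bigcup_le _ _) _.
apply: leq_trans (_ : \sum_(i < k) 1 <= _)%N; last by rewrite sum1_card card_ord.
by apply: leq_sum => i _; apply: hf; rewrite ltn_ord.
Qed.

End Runs.

(** * Breaks between runs *)

Section FaceRuns.
Variable R : realFieldType.
Local Notation pt := (R * R)%type.
Variables (T : finType) (c : T -> pt).
Implicit Types (Q S W X : {set T}) (o : pt) (a b q r v w x y z m p : T) (h : pt * R).
Local Notation "'D' p q r" := (det3 (c p) (c q) (c r))
  (at level 10, p, q, r at level 9).
Local Notation inner := (interior c).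
Local Notation bnd := (boundary c).
Local Notation closed := (convex_closed c).
Local Notation face := (face c).
Local Notation on := (on c).
Hypothesis cI : injective c.
Hypothesis H5 : forall S, five_exposed c S -> exists2 p : T, p \notin S & ~ ssep c S (c p).

Variables (Q : {set T}) (z : T).
Hypothesis cQ : closed Q.
Hypothesis zI : z \in inner (inner Q).
Local Notation nx := (nxt c (c z) (inner Q)).
Local Notation L := (bnd (inner Q)).
Local Notation beyond := (beyond_of c Q z).
Local Notation beyonds := (beyonds_of c Q z).
Local Notation ends := (ends_of c Q z).
Local Notation run := (run_of c Q z).

Let oI := inner_nwsep zI.
Let zI1 := innerQ zI.

Lemma face_center h : face (inner Q) h -> lf h.1 (c z) < h.2.
Proof.
move=> [h0 hf]; rewrite ltNge; apply/negP => le; apply: oI.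
by exists h.1 => // q /hf l; apply: le_trans le.
Qed.

(** On a supporting line, the successor of a vertex is again on the line as
    long as another vertex of the line follows. *)
Lemma face_next h v v' : face (inner Q) h -> v \in L -> v' \in L -> on h v -> on h v' ->
  0 < D z v v' -> on h (nx v) /\ 0 <= D z (nx v) v'.
Proof.
move=> hf vL vL' hv hv' vv.
have e := edge_nx cI zI vL; case/edgeP: (e) => vI xI vx hx _.
have x0 : 0 <= D z (nx v) v'.
  rewrite det3_swapr oppr_ge0 leNgt; apply/negP => l.
  have e' := bnd_in_sector cI oI e vL' (ltW vv) l.
  by move: vv; rewrite e' det3_eqr ltxx.
split=> //; apply/le_anti; case: (hf) => _ hle; rewrite hle //=.
have := lf_bary h.1 (c z) (c v) (c v') (c (nx v)).
have := det3_bary1 (c z) (c v) (c v') (c (nx v)).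
rewrite hv hv' (det3_swapr (c v) (c v')) (det3_cyc (c v') (c z)).
have := hx _ (bndQ vL'); have := face_center hf; move: vv vx x0.
move: (D z v v') (D z v (nx v)) (D z (nx v) v') (D v (nx v) v') => S C B A.
move: (lf h.1 (c z)) (lf h.1 (c (nx v))) h.2 => fz fx k hS hC hB hk hA e1 e2.
have : S * (fx - k) = A * (k - fz) by rewrite -e1 in e2 *; lra.
by move=> e3; rewrite -subr_ge0 -(pmulr_rge0 _ hS) e3 mulr_ge0 ?subr_ge0 ?(ltW hk).
Qed.

Lemma face_ray_unique h v v' : face (inner Q) h -> v \in L -> v' \in L -> on h v -> on h v' ->
  D z v v' = 0 -> v = v'.
Proof.
move=> hf vL vL' hv hv' e; have l := face_center hf.
apply: (same_side_ray (n := h.1) (k := lf h.1 (c z)) cI oI vL vL' (lexx _) _ _ e).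
  by rewrite hv.
by rewrite hv'.
Qed.

Lemma face_last_unique h v v' : face (inner Q) h -> v \in L -> v' \in L -> on h v -> on h v' ->
  ~ on h (nx v) -> ~ on h (nx v') -> v = v'.
Proof.
move=> hf vL vL' hv hv' nv nv'; case: (ltgtP (D z v v') 0) => l.
- case: nv'; have [|//] := face_next hf vL' vL hv' hv.
  by rewrite det3_swapr oppr_gt0.
- by case: nv; have [] := face_next hf vL vL' hv hv' l.
exact: (face_ray_unique hf).
Qed.

Lemma face_beyond h v p : face (inner Q) h -> v \in L -> on h v -> on h (nx v) ->
  (D v (nx v) p < 0) = (h.2 < lf h.1 (c p)).
Proof.
move=> hf vL hv hx; have l := face_center hf.
case/edgeP: (edge_nx cI zI vL) => _ _ vx _ _.
have := lf_bary h.1 (c v) (c (nx v)) (c z) (c p).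
have := det3_bary1 (c v) (c (nx v)) (c z) (c p).
rewrite hv hx -(det3_cyc (c z) (c v) (c (nx v))).
move: l vx; move: (D z v (nx v)) (D v (nx v) p) (lf h.1 (c z)) (lf h.1 (c p)) h.2 => S B fz fp k l hS e1 e2.
have e3 : B * (k - fz) = S * (k - fp) by rewrite -e1 in e2 *; lra.
have kz : 0 < k - fz by lra.
by rewrite -(pmulr_llt0 B kz) e3 pmulr_rlt0 // subr_lt0.
Qed.

Hypothesis nogain : forall X, X != set0 -> X \subset L -> (#|ends X| < #|beyonds X|)%N.

Lemma nx_neq v : v \in L -> nx v != v.
Proof.
move=> vL; case/edgeP: (edge_nx cI zI vL) => _ _ vx _ _.
by apply: contraTneq vx => ->; rewrite det3_eqr ltxx.
Qed.

Lemma beyond_gt2 v : v \in L -> (2 < #|beyond v|)%N.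
Proof.
move=> vL; have := @nogain [set v]; rewrite /beyonds_of big_set1 => h.
apply: leq_ltn_trans (h _ _); last by rewrite sub1set.
  by rewrite /ends_of imset_set1 cardsU1 cards1 in_set1 eq_sym nx_neq.
by apply/set0Pn; exists v; rewrite in_set1.
Qed.

Definition break_of w := (#|beyond w :&: beyond (nx w)| <= 1)%N.
Local Notation break := break_of.
(** The edge of w and the next one share at most one point beyond them;
    otherwise the two sets of points beyond, each collinear, are on one line.
    *)
Definition breaks_of := [set w in L | break w].
Local Notation breaks := breaks_of.

(** Consecutive edges on one supporting line have the same points beyond them,
    at least three. *)
Lemma face_no_break h v : face (inner Q) h -> v \in L -> on h v -> on h (nx v) ->
  on h (nx (nx v)) -> v \notin breaks.
Proof.
move=> hf vL h1 h2 h3; rewrite inE vL /= /break -ltnNge.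
have -> : beyond v = beyond (nx v).
  apply/setP => p; rewrite !in_set (face_beyond p hf vL h1 h2).
  by rewrite (face_beyond p hf (nx_L cI zI vL) h2 h3).
by rewrite setIid; apply: ltnW; apply: beyond_gt2; apply: nx_L.
Qed.

Lemma break_run w : w \in breaks -> exists k, [/\ (0 < k)%N, iter k nx w \in breaks &
  forall j, (0 < j < k)%N -> iter j nx w \notin breaks].
Proof.
move=> wB; have ex : exists k, (0 < k)%N && (iter k nx w \in breaks).
  by exists (order nx w); rewrite order_gt0 iter_order //; apply: nx_inj.
case: (ex_minnP ex) => k /andP[k0 kB] kmin; exists k; split=> // j /andP[j0 jk].
by apply/negP => jB; have := kmin j; rewrite j0 jB => /(_ isT); rewrite leqNgt jk.
Qed.

Lemma line_extend p q s t r : p != q -> s != t -> D p q s = 0 -> D p q t = 0 ->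
  D s t r = 0 -> D p q r = 0.
Proof.
move=> pq st ps pt_ str; have tt := pt_sub_sqr cI st.
have : (((c t).1 - (c s).1) ^+ 2 + ((c t).2 - (c s).2) ^+ 2) * D p q r = 0.
  have -> : (((c t).1 - (c s).1) ^+ 2 + ((c t).2 - (c s).2) ^+ 2) * D p q r =
    (((c t).1 - (c s).1) ^+ 2 + ((c t).2 - (c s).2) ^+ 2) * D p q s +
    (((c t).1 - (c s).1) * ((c r).1 - (c s).1) + ((c t).2 - (c s).2) * ((c r).2 - (c s).2)) * (D p q t - D p q s)
    + D s t r * (((c q).1 - (c p).1) * ((c t).1 - (c s).1) + ((c q).2 - (c p).2) * ((c t).2 - (c s).2)).
    by rewrite !det3E; ring.
  by rewrite ps pt_ str; ring.
by move/eqP; rewrite mulf_eq0 gt_eqF //= => /eqP.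
Qed.

Lemma beyond_next_line p q v : v \in L -> v \notin breaks -> p != q ->
  (forall r, r \in beyond v -> D p q r = 0) -> forall r, r \in beyond (nx v) -> D p q r = 0.
Proof.
move=> vL; rewrite inE vL /= /break -ltnNge => /card_gt1P[s [t [sI tI st]]] pq h r rI.
move: sI tI; rewrite !in_setI => /andP[s1 s2] /andP[t1 t2].
apply: (line_extend pq st (h _ s1) (h _ t1)).
exact: (beyond_collinear cI H5 cQ zI (nx_L cI zI vL)).
Qed.

Variable M : nat.
Hypothesis Mgt0 : (0 < M)%N.
Hypothesis lineM : forall p q, p != q -> (#|[set r | D p q r == 0%R]| <= M)%N.

Lemma beyond_line v : v \in L -> exists p q, p != q /\ forall r, r \in beyond v -> D p q r = 0.
Proof.
move=> vL; have /card_gt1P[p [q [pv qv pq]]] := ltnW (beyond_gt2 vL).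
by exists p, q; split=> // r; apply: (beyond_collinear cI H5 cQ zI vL).
Qed.

(** The line does not change along a run, since consecutive sets share two
    points. *)
Lemma run_line w k : w \in L -> (forall j, (0 < j < k)%N -> iter j nx w \notin breaks) ->
  (#|beyonds (run w k)| <= M)%N.
Proof.
move=> wL hk; have [p [q [pq hpq]]] := beyond_line (nx_L cI zI wL).
have all i : (0 < i <= k)%N -> forall r, r \in beyond (iter i nx w) -> D p q r = 0.
  elim: i => // i ih; case: i ih => [|i] ih ik; first exact: hpq.
  apply: (@beyond_next_line p q (iter i.+1 nx w)) => //; first exact: (iter_nx_L cI zI i.+1 wL).
    by apply: hk; case/andP: ik => _ ik; rewrite /= ik.
  by apply: ih; rewrite /= ltnW.
apply: leq_trans (lineM pq); apply: subset_leq_card; apply/subsetP => r.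
case/bigcupP => _ /imsetP[i _ ->] /all h; rewrite in_set; apply/eqP/h.
exact: ltn_ord.
Qed.

Lemma bnd_beyond p : p \in bnd Q -> exists2 v, v \in L & p \in beyond v.
Proof.
move=> pb; have [v vL] := fibre_exists cI zI pb.
rewrite in_set => /and3P[_ h1 h2]; exists v => //; rewrite in_set (bndQ pb).
apply: (beyond_edge cQ zI1 _ (edge_nx cI zI vL) h1 h2).
by apply/negP; apply: bnd_inner pb.
Qed.

Lemma no_break_card : breaks = set0 -> (#|bnd Q| <= M)%N.
Proof.
move=> B0; have [v0 v0L] := set0Pn _ (bnd_neq0 zI).
have [p [q [pq hpq]]] := beyond_line v0L.
pose X := [set v in L | [forall r in beyond v, D p q r == 0]].
have XE : X = L.
  apply: (nxt_connected cI oI); [apply/set0Pn; exists v0|by apply/subsetP => u; rewrite in_set => /andP[]|].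
    by rewrite in_set v0L; apply/forall_inP => r /hpq ->.
  move=> u; rewrite [u \in X]in_set [nx u \in X]in_set => /andP[uL /forall_inP hu].
  rewrite (nx_L cI zI uL); apply/forall_inP => r /(beyond_next_line uL _ pq) ->; rewrite ?eqxx //.
    by rewrite B0 in_set0.
  by move=> s /hu /eqP.
apply: leq_trans (lineM pq); apply: subset_leq_card; apply/subsetP => r /bnd_beyond[v].
by rewrite -XE !in_set => /andP[_ /forall_inP h] /andP[rQ l]; apply: h; rewrite in_set rQ.
Qed.

End FaceRuns.

(** * The number of boundary points *)

Section BoundaryBound.
Variable R : realFieldType.
Local Notation pt := (R * R)%type.
Variables (T : finType) (c : T -> pt).
Implicit Types (Q S W X : {set T}) (o : pt) (a b q r v w x y z m p : T) (h : pt * R).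
Local Notation "'D' p q r" := (det3 (c p) (c q) (c r))
  (at level 10, p, q, r at level 9).
Local Notation inner := (interior c).
Local Notation bnd := (boundary c).
Local Notation closed := (convex_closed c).
Local Notation face := (face c).
Local Notation on := (on c).
Hypothesis cI : injective c.
Hypothesis H5 : forall S, five_exposed c S -> exists2 p : T, p \notin S & ~ ssep c S (c p).
Variable M : nat.
Hypothesis Mgt0 : (0 < M)%N.
Hypothesis lineM : forall p q, p != q -> (#|[set r | D p q r == 0%R]| <= M)%N.

Section Tight.
Variables (Q : {set T}) (z : T).
Hypothesis cQ : closed Q.
Hypothesis zI : z \in inner (inner Q).
Hypothesis im : innermost c Q z.
Local Notation nx := (nxt c (c z) (inner Q)).
Local Notation L := (bnd (inner Q)).
Local Notation beyonds := (beyonds_of c Q z).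
Local Notation ends := (ends_of c Q z).
Local Notation fibre := (fibre_of c Q z).
Local Notation run := (run_of c Q z).
Local Notation rest_left := (rest_left_of c Q z).
Local Notation rest_right := (rest_right_of c Q z).
Local Notation breaks := (breaks_of c Q z).
Hypothesis nogain : forall X, X != set0 -> X \subset L -> (#|ends X| < #|beyonds X|)%N.


Let nx_inj := nx_inj cI zI.

Lemma breakL w : w \in breaks -> w \in L.
Proof. by rewrite in_set => /andP[]. Qed.

Variable len : T -> nat.
Hypothesis lenP : forall w, w \in breaks -> [/\ (0 < len w)%N, iter (len w) nx w \in breaks &
  forall j, (0 < j < len w)%N -> iter j nx w \notin breaks].
Local Notation last_ w := (iter (len w) nx w).

Lemma run_owner_unique w w' i j : w \in breaks -> w' \in breaks ->
  (0 < i <= len w)%N -> (0 < j <= len w')%N -> iter i nx w = iter j nx w' -> w = w' /\ i = j.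
Proof.
suff gen v v' k l : v \in breaks -> v' \in breaks -> (0 < k <= l)%N -> (l <= len v')%N ->
    iter k nx v = iter l nx v' -> v = v' /\ k = l.
  move=> wB wB' /andP[i0 ik] /andP[j0 jk] e; case: (leqP i j) => le.
    by apply: (gen w w' i j) => //; rewrite i0.
  have [|e1 e2] := gen w' w j i wB' wB _ ik (esym e); first by rewrite j0 ltnW.
  by rewrite e1 e2.
move=> vB vB' /andP[k0 kl] ll e.
have ev := iter_nx_sub cI zI kl e.
case: (ltnP 0 (l - k)) => d.
  have [_ _ hm] := lenP vB'; have := hm (l - k)%N; rewrite -ev vB.
  have -> : (0 < l - k < len v')%N by lia.
  by move=> /(_ isT).
have ekl : k = l by apply/eqP; rewrite eqn_leq kl -subn_eq0 -leqn0.
by split=> //; rewrite ev ekl subnn.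
Qed.

(** len w is the number of edges from the break at w to the next break; every
    vertex belongs to exactly one such run. *)
Lemma run_owner v : breaks != set0 -> v \in L -> exists w i, [/\ w \in breaks,
  (0 < i <= len w)%N & v = iter i nx w].
Proof.
move=> /set0Pn[b0 b0B] vL.
have ex : exists k, (0 < k)%N && [exists w in breaks, v == iter k nx w].
  have [m mE] := L_reach cI zI (breakL b0B) vL.
  exists (m + order nx b0)%N; rewrite addn_gt0 order_gt0 orbT /=.
  by apply/exists_inP; exists b0 => //; rewrite iterD iter_order //; apply/eqP.
case: (ex_minnP ex) => m /andP[m0 /exists_inP[w wB /eqP mE]] mmin.
exists w, m; split=> //; rewrite m0 leqNgt; apply/negP => l.
have [k0 kB _] := lenP wB.
have := mmin (m - len w)%N; rewrite subn_gt0 l => /(_ _).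
have -> : [exists w0 in breaks, v == iter (m - len w) nx w0].
  apply/exists_inP; exists (last_ w) => //.
  by rewrite -iterD subnK ?mE // ltnW.
by move=> /(_ isT); rewrite leqNgt ltn_subrL k0 m0.
Qed.

Lemma boundary_le_breaks : breaks != set0 -> (#|bnd Q| <= #|breaks| * M)%N.
Proof.
move=> B0; have sub : bnd Q \subset \bigcup_(w in breaks) beyonds (run w (len w)).
  apply/subsetP => p /(bnd_beyond cI cQ zI)[v vL pv].
  have [w [i [wB /andP[i0 ik] ev]]] := run_owner B0 vL.
  apply/bigcupP; exists w => //; apply/bigcupP; exists v => //.
  case: i i0 ik ev => // i _ ik ->; by apply/imsetP; exists (Ordinal ik).
apply: leq_trans (subset_leq_card sub) _.
apply: leq_trans (card_bigcup_le _ _) _.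
rewrite -sum_nat_const; apply: leq_sum => w wB; have [_ _ h] := lenP wB.
exact: (run_line cI H5 cQ zI nogain lineM (breakL wB) h).
Qed.

Lemma single_run w : w \in breaks -> last_ w = w -> #|breaks| = 1%N.
Proof.
move=> wB e; apply/eqP/cards1P; exists w; apply/setP => v; rewrite in_set1.
apply/idP/eqP => [vB|-> //].
pose X := [set iter i.+1 nx w | i : 'I_(len w)].
have [k0 _ hmin] := lenP wB.
have XE : X = L.
  apply: (nxt_connected cI (inner_nwsep zI)).
  - by apply/set0Pn; exists (nx w); apply/imsetP; exists (Ordinal k0).
  - by apply/subsetP => _ /imsetP[i _ ->]; apply: (iter_nx_L cI zI i.+1); apply: breakL.
  move=> _ /imsetP[i _ ->]; have : (i.+1 <= len w)%N by exact: ltn_ord.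
  rewrite leq_eqVlt => /orP[/eqP ei|li].
    by apply/imsetP; exists (Ordinal k0); rewrite //= -iterS ei e.
  by apply/imsetP; exists (Ordinal li).
have := breakL vB; rewrite -XE => /imsetP[i _ ev].
have : (i.+1 <= len w)%N by exact: ltn_ord.
rewrite leq_eqVlt => /orP[/eqP ei|li]; first by rewrite ev ei e.
by have := hmin i.+1 li; rewrite -ev vB.
Qed.

(** No sector of the run contains two boundary points of Q. *)
Definition pure w := [forall i : 'I_(len w), #|fibre (iter i.+1 nx w)| <= 1]%N.

(** The two rests at a break are disjoint and contained in a set of at most
    one point. *)
Lemma rest_le1 w : w \in breaks -> (#|rest_left w| + #|rest_right w| <= 1)%N.
Proof.
move=> wB; apply: leq_trans (rest_card cI zI (breakL wB)) _.
by move: wB; rewrite in_set => /andP[].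
Qed.

(** A cut along a run of k edges exposes k + 1 points, so it removes at least
    k + 2; the sectors of a pure run hold only k of them, and each end holds
    at most one. *)
Lemma pure_rests w : w \in breaks -> last_ w != w -> pure w ->
  (0 < #|rest_left w|)%N /\ (0 < #|rest_right (last_ w)|)%N.
Proof.
move=> wB ne /forallP pw; have wL := breakL wB; have [k0 kB hmin] := lenP wB.
have h1 : (#|beyonds (run w (len w))| <= len w + #|rest_left w| + #|rest_right (last_ w)|)%N.
  apply: (run_card cI zI wL) => i /andP[i0 ik]; case: i i0 ik => // i _ ik.
  exact: (pw (Ordinal ik)).
have h2 : (len w < #|ends (run w (len w))|)%N.
  apply: (ends_run_card cI zI k0) => d /andP[d0]; rewrite leq_eqVlt => /orP[/eqP ->//|dk].
  by apply: contraTneq wB => e; rewrite -e hmin ?d0.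
have h3 : (#|ends (run w (len w))| < #|beyonds (run w (len w))|)%N.
  apply: nogain; last exact: run_sub.
  by apply/set0Pn; exists (nx w); apply/imsetP; exists (Ordinal k0).
have := rest_le1 wB; have := rest_le1 kB.
by split; lia.
Qed.

Lemma impure_unflanked w : w \in breaks -> ~~ pure w -> exists i, (0 < i <= len w)%N /\
  unflanked c z Q (iter i nx w).
Proof.
move=> wB /forallPn[i hi]; exists i.+1; split; first exact: ltn_ord.
apply: contrapT => un; case/negP: hi.
by apply: (fibre_le1 cI H5 cQ zI _ un); apply: (iter_nx_L cI zI i.+1 (breakL wB)).
Qed.

(** Between two edges on one supporting line there is no break. *)
Lemma face_same_run h v v' w i : face (inner Q) h -> v \in L -> v' \in L -> on h v -> on h v' ->
  on h (nx v) -> on h (nx v') -> 0 < D z v v' -> w \in breaks -> (0 < i <= len w)%N ->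
  v = iter i nx w -> exists2 j, (0 < j <= len w)%N & v' = iter j nx w.
Proof.
move=> hf + vL' + hv' + hx'.
have [n] := ubnP #|[set q in L | (0 < D z v q) && (0 < D z q v')]|.
elim: n v i => // n ih v i hn vL hv hx vv wB ik ev.
have [_ x0] := face_next cI zI hf vL vL' hv hv' vv.
have xL := nx_L cI zI vL.
have nb : on h (nx (nx v)) -> (i < len w)%N.
  move=> hxx; have := face_no_break cI zI nogain hf vL hv hx hxx.
  case/andP: ik => i0; rewrite leq_eqVlt => /orP[/eqP e|//].
  by rewrite ev e; have [_ -> _] := lenP wB.
move: x0; rewrite le_eqVlt => /orP[/eqP e|x0].
  have xv := face_ray_unique cI zI hf xL vL' hx hv' (esym e).
  by exists i.+1; rewrite /= ?nb ?xv // -xv ev.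
have [hxx _] := face_next cI zI hf xL vL' hx hv' x0.
apply: (ih (nx v) i.+1) => //; [|by rewrite /= nb|by rewrite ev].
rewrite -ltnS; apply: leq_trans hn; rewrite ltnS; apply: proper_card; apply/properP.
case/edgeP: (edge_nx cI zI vL) => _ _ vx _ _.
split; last first.
  exists (nx v); first by rewrite in_set xL vx x0.
  by rewrite in_set det3_eqr ltxx andbF.
apply/subsetP => q; rewrite [q \in _]in_set [in X in _ -> X]in_set => /and3P[-> h1 h2] /=.
by rewrite h2 andbT; apply: (cone_trans vx x0 vv h1 h2).
Qed.

(** An unflanked vertex is on one of six lines.  On each line, one vertex may
    have its successor off the line, and all the others belong to one run. *)
Lemma impure_card : (#|[set w in breaks | ~~ pure w]| <= 12)%N.
Proof.
have [s [s6 sf sU]] := unflanked_cover cI H5 cQ im zI.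
pose I := [set w in breaks | ~~ pure w].
pose h0 : pt * R := ((0, 0), 0).
have /choice[u hu] : forall w, exists ui : T * nat * nat, w \in I ->
  [/\ (0 < ui.1.2 <= len w)%N, ui.1.1 = iter ui.1.2 nx w, ui.1.1 \in L, (ui.2 < size s)%N & on (nth h0 s ui.2) ui.1.1].
  move=> w; have [wI|wI] := boolP (w \in I); last by exists (w, 0%N, 0%N).
  move: wI; rewrite in_set => /andP[wB ip].
  have [i [ik un]] := impure_unflanked wB ip.
  have [|h hs hon] := sU (iter i nx w); first by rewrite in_set; apply/asboolP.
  exists (iter i nx w, i, index h s) => _ /=; split=> //.
  - exact: (iter_nx_L cI zI i (breakL wB)).
  - by rewrite index_mem.
  - by rewrite nth_index.
pose tag w : 'I_6 * bool := (inord (u w).2, `[< on (nth h0 s (u w).2) (nx (u w).1.1) >]).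
have inj : {in I &, injective tag}.
  move=> w w' wI wI'; have [ik ev vL us hv] := hu w wI; have [ik' ev' vL' us' hv'] := hu w' wI'.
  move=> /pair_equal_spec[/(congr1 val) /=]; rewrite !inordK ?(leq_trans us) ?(leq_trans us') // => es eb.
  have wB : w \in breaks by move: wI; rewrite in_set => /andP[].
  have wB' : w' \in breaks by move: wI'; rewrite in_set => /andP[].
  have hf : face (inner Q) (nth h0 s (u w).2) by apply: sf; apply: mem_nth.
  rewrite -es in hv' eb.
  have [b|b] := pselect (on (nth h0 s (u w).2) (nx (u w).1.1)); last first.
    have b' : ~ on (nth h0 s (u w).2) (nx (u w').1.1).
      by move=> /asboolP b'; apply: b; apply/asboolP; rewrite eb.
    have e := face_last_unique cI zI hf vL vL' hv hv' b b'.
    by rewrite ev ev' in e; have [] := run_owner_unique wB wB' ik ik' e.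
  have b' : on (nth h0 s (u w).2) (nx (u w').1.1).
    by apply/asboolP; rewrite -eb; apply/asboolP.
  case: (ltgtP (D z (u w).1.1 (u w').1.1) 0) => l.
  - have l' : 0 < D z (u w').1.1 (u w).1.1 by rewrite det3_swapr oppr_gt0.
    have [j jk ej] := face_same_run hf vL' vL hv' hv b' b l' wB' ik' ev'.
    by rewrite ev in ej; have [] := run_owner_unique wB wB' ik jk ej.
  - have [j jk ej] := face_same_run hf vL vL' hv hv' b b' l wB ik ev.
    by rewrite ev' in ej; have [-> ] := run_owner_unique wB' wB ik' jk ej.
  have e := face_ray_unique cI zI hf vL vL' hv hv' l.
  by rewrite ev ev' in e; have [] := run_owner_unique wB wB' ik ik' e.
rewrite -/I -(card_in_imset inj); apply: leq_trans (max_card _) _.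
by rewrite card_prod card_ord card_bool.
Qed.

(** A pure run is followed by an impure one: both rests at the break between
    two pure runs would be nonempty, against rest_le1.  Hence there are at
    most 12 + 12 runs. *)
Lemma tight_boundary : (#|bnd Q| <= 24 * M)%N.
Proof.
have [B0|B0] := eqVneq breaks set0.
  by apply: leq_trans (no_break_card cI H5 cQ zI nogain lineM B0) _; lia.
apply: leq_trans (boundary_le_breaks B0) _; rewrite leq_mul2r; apply/orP; right.
have [B1|B1] := leqP #|breaks| 1; first by apply: leq_trans B1 _.
have ne w : w \in breaks -> last_ w != w.
  by move=> wB; apply/eqP => /(single_run wB) e; rewrite e in B1.
rewrite -(cardsID [set w in breaks | pure w] breaks).
have -> : breaks :\: [set w in breaks | pure w] = [set w in breaks | ~~ pure w].
  apply/setP => w; move: (breaks) => F; rewrite in_setD !in_set.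
  by case: (w \in F); case: (pure w).
have -> : breaks :&: [set w in breaks | pure w] = [set w in breaks | pure w].
  by apply/setIidPr; apply/subsetP => w; rewrite in_set => /andP[].
suff le : (#|[set w in breaks | pure w]| <= #|[set w in breaks | ~~ pure w]|)%N.
  by have := impure_card; move: le; lia.
have inj : {in [set w in breaks | pure w] &, injective (fun w => last_ w)}.
  move=> w w'; rewrite in_set => /andP[wB _]; rewrite in_set => /andP[wB' _] e.
  have [k0 _ _] := lenP wB; have [k0' _ _] := lenP wB'.
  by have [] := run_owner_unique (i := len w) (j := len w') wB wB' _ _ e; rewrite ?k0 ?k0' ?leqnn.
rewrite -(card_in_imset inj); apply: subset_leq_card; apply/subsetP => _ /imsetP[w + ->].
rewrite in_set => /andP[wB pw]; have [k0 kB _] := lenP wB.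
rewrite in_set kB /=; apply/negP => pk.
have [_ h1] := pure_rests wB (ne _ wB) pw; have [h2 _] := pure_rests kB (ne _ kB) pk.
by have := rest_le1 kB; lia.
Qed.

End Tight.

(** For a smallest counterexample every cut removes more points than it
    exposes, which is the hypothesis of tight_boundary; sets with fewer than
    three layers are covered by at most six lines. *)
Theorem boundary_bound Q : closed Q -> (#|bnd Q| <= 24 * M)%N.
Proof.
have [n] := ubnP #|Q|; elim: n Q => // n ih Q hn cQ; rewrite leqNgt; apply/negP => big.
have count k W : face_cover c k Q W -> (k <= 24)%N -> bnd Q \subset W -> False.
  move=> cov k24 /subset_leq_card sub; move: big; rewrite ltnNge => /negP; apply.
  apply: leq_trans sub _; apply: leq_trans (cover_card Mgt0 lineM cov) _.
  by rewrite leq_mul2r k24 orbT.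
have cJ := inner_closed cQ.
have [I0|[z1 z1I]] := set_0Vmem (inner Q).
  exact: (count 4%N Q (coreless_cover cI H5 cQ I0) isT (bnd_sub c Q)).
have [I2|[z2 z2I]] := set_0Vmem (inner (inner Q)).
  exact: (count 6%N _ (core_boundary_cover cI H5 cQ z1I I2) isT (subxx _)).
have [|z zQ im] := @innermost_exists _ _ c Q.
  by apply/set0Pn; exists z1; apply: innerQ z1I.
have zI : z \in inner (inner Q).
  by have [/= e|//] := im 2; rewrite e in_set0 in z2I.
have nogain X : X != set0 -> X \subset bnd (inner Q) -> (#|ends_of c Q z X| < #|beyonds_of c Q z X|)%N.
  move=> X0 XL; have [cQ' le] := gain cI cQ zI XL.
  have E0 : (0 < #|ends_of c Q z X|)%N.
    by rewrite card_gt0; case/set0Pn: X0 => x xX; apply/set0Pn; exists x; rewrite in_setU xX.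
  have [Y0|Y0] := posnP #|beyonds_of c Q z X|.
    move: le; rewrite Y0; move/eqP: Y0; rewrite cards_eq0 => /eqP ->; rewrite setD0; lia.
  have lt : (#|Q :\: beyonds_of c Q z X| < n)%N.
    rewrite -ltnS; apply: leq_trans hn; rewrite ltnS; apply: proper_card; apply/properP.
    split; first exact: subsetDl.
    move: Y0; rewrite card_gt0 => /set0Pn[y yY]; exists y; last by rewrite in_setD yY.
    by case/bigcupP: yY => w _; rewrite in_set => /andP[].
  have := ih _ lt cQ'; move: le big; lia.
have /choice[len lenP] : forall w, exists k, w \in breaks_of c Q z ->
  [/\ (0 < k)%N, iter k (nxt c (c z) (inner Q)) w \in breaks_of c Q z &
  forall j, (0 < j < k)%N -> iter j (nxt c (c z) (inner Q)) w \notin breaks_of c Q z].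
  move=> w; have [wB|wB] := boolP (w \in breaks_of c Q z); last by exists 0%N.
  by have [k hk] := break_run cI zI wB; exists k.
have := tight_boundary cQ zI im nogain lenP; rewrite leqNgt big.
by [].
Qed.

End BoundaryBound.

(** * Closed sets that pin the outer points to few lines *)

Section Pinned.
Variable R : realFieldType.
Local Notation pt := (R * R)%type.
Variables (T : finType) (c : T -> pt).
Implicit Types (Q S W X : {set T}) (o : pt) (a b q r v w x y z m p : T) (h : pt * R).
Local Notation "'D' p q r" := (det3 (c p) (c q) (c r))
  (at level 10, p, q, r at level 9).
Local Notation inner := (interior c).
Local Notation bnd := (boundary c).
Local Notation closed := (convex_closed c).
Hypothesis cI : injective c.
Hypothesis H5 : forall S, five_exposed c S -> exists2 p : T, p \notin S & ~ ssep c S (c p).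
Variable M : nat.
Hypothesis lineM : forall p q, p != q -> (#|[set r | D p q r == 0%R]| <= M)%N.

(** What remains of the geometry once all points outside Q are known to be on
    one line for each boundary point. *)
Definition pinned Q := #|bnd (inner Q)| = #|bnd Q| /\ (#|~: Q| <= #|bnd Q| * M)%N.

Variables (Q : {set T}) (z : T).
Hypothesis cQ : closed Q.
Hypothesis zI : z \in inner (inner Q).
Local Notation nx := (nxt c (c z) (inner Q)).
Local Notation L := (bnd (inner Q)).
Local Notation fibre := (fibre_of c Q z).

Let oI := inner_nwsep zI.
Let zI1 := innerQ zI.
Let oQ := inner_nwsep zI1.

Lemma on_segment_before a b q s : D a b q = 0 -> 0 < D a b s -> 0 < D a q s ->
  0 < D z a b -> 0 < D z a q.
Proof.
move=> e bs qs ab; have := plucker (c a) (c z) (c s) (c b) (c q).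
rewrite e mulr0 sub0r (det3_swap _ (c z) (c b)) (det3_swap _ (c z) (c q))
  (det3_swapr _ (c s) (c q)) (det3_swapr _ (c s) (c b)) => e0.
by rewrite -(pmulr_lgt0 _ bs); have := mulr_gt0 ab qs; lra.
Qed.

Lemma on_segment_after a b q s : D a b q = 0 -> 0 < D a b s -> 0 < D b s q ->
  0 < D z a b -> 0 < D z q b.
Proof.
move=> e bs qs ab; have := plucker (c b) (c z) (c s) (c a) (c q).
have -> : D b a q = 0 by rewrite det3_swap e oppr0.
rewrite mulr0 sub0r (det3_cyc (c b) (c z) (c a)) (det3_cyc (c b) (c z) (c q)).
have -> : D b s a = D a b s by rewrite det3_cyc det3_cyc.
by move=> e0; rewrite -(pmulr_lgt0 _ bs); have := mulr_gt0 ab qs; lra.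
Qed.

(** The outer side a b is an edge of Q, so the quadrilateral contains no point
    of T except on the inner side. *)
Lemma quad_outward_empty w x a b p : hull_edge c (c z) (inner Q) w x -> hull_edge c (c z) Q a b ->
  0 < D b x w -> 0 < D x w a -> D a b p < 0 -> 0 < D w a p -> 0 < D b x p -> False.
Proof.
move=> e e' bxw xwa; case/edgeP: (e) => wI xI wx h _; case/edgeP: (e') => aQ bQ ab h' h2.
have abx := edge_inner_pos e' xI; have abw := edge_inner_pos e' wI.
have wab : 0 < D w a b by rewrite det3_cyc.
move=> p1 p2 p3.
apply: (@quad_no_point_beyond _ _ _ cI H5 a b x w abx bxw xwa wab _ p p1 p3 p2).
move=> q q1 q2 q3 q4; have [qI|qI] := boolP (q \in inner Q).
  by have := h q qI; rewrite leNgt det3_swap oppr_lt0 q3.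
have [u [hu hu']] := outer_support cQ qI.
have [l|l] := leP (D w b q) 0; last first.
  by apply: (@max_not_in_triangle _ u (c w) (c b) (c x) (c q));
    [dsgn|dsgn|dsgn|exact: hu'|exact: hu|exact/ltW/hu'].
have [qQ|qQ] := boolP (q \in Q); last first.
  have [t ht] := cQ qQ.
  by apply: (@max_not_in_triangle _ t (c b) (c w) (c a) (c q));
    [dsgn|dsgn|dsgn|exact: ht|exact/ltW/ht/innerQ/wI|exact/ltW/ht].
move: q1; rewrite le_eqVlt => /orP[/eqP q1|q1]; last first.
  by apply: (@max_not_in_triangle _ u (c w) (c a) (c b) (c q));
    [dsgn|dsgn|dsgn|exact: hu'|exact: hu|exact: hu].
have aq : 0 < D z a q by apply: (on_segment_before (esym q1) abw _ ab); dsgn.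
have qb : 0 < D z q b by apply: (on_segment_after (esym q1) abx q2 ab).
by have := h2 q qQ aq qb; rewrite -q1 ltxx.
Qed.

Variable al : T -> T.
Hypothesis al_fib : forall w, w \in L -> al w \in fibre w.
Hypothesis fib_al : forall w p, w \in L -> p \in fibre w -> p = al w.
Hypothesis al_next : forall w, w \in L -> D w (nx w) (al (nx w)) < 0.

Let nL := nx_L cI zI.

Lemma al_spec w : w \in L -> [/\ al w \in bnd Q, 0 <= D z w (al w) & 0 < D z (al w) (nx w)].
Proof. by move=> /al_fib; rewrite in_set => /and3P[]. Qed.

Lemma nx_pos w : w \in L -> 0 < D z w (nx w).
Proof. by move=> /(edge_nx cI zI) /edgeP[]. Qed.

(** A point of the sector of nx w that is beyond the line of the edge of w is
    less than half a turn past w; by al_next this applies to al (nx w). *)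
Lemma al_turn w : w \in L -> 0 < D z (al w) (al (nx w)).
Proof.
move=> wL; have wx := nx_pos wL; have [_ a1 a2] := al_spec wL; have [_ b1 b2] := al_spec (nL wL).
have wb : 0 < D z w (al (nx w)).
  have := al_next wL; rewrite (det3_split (c z)) (det3_swapr (c z) (c (al (nx w))) (c w)).
  by move: wx b1; lra.
have := plucker (c z) (c w) (c (al w)) (c (nx w)) (c (al (nx w))) => e0.
rewrite -(pmulr_rgt0 _ wx).
by have := mulr_ge0 a1 b1; have := mulr_gt0 wb a2; lra.
Qed.

(** The points of the transversal occur on the boundary of Q in the cyclic
    order of their sectors, and there are no others. *)
Lemma al_edge w : w \in L -> hull_edge c (c z) Q (al w) (al (nx w)).
Proof.
move=> wL; have [ab a1 a2] := al_spec wL; have [bb b1 b2] := al_spec (nL wL).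
have wx := nx_pos wL; have xy := nx_pos (nL wL); have tt := al_turn wL.
have e := edge_nxt cI oQ ab; have [_ nb] := edge_bnd e.
set b := nxt c (c z) Q (al w) in e nb *.
case/edgeP: (e) => _ _ sb _ _.
suff -> : al (nx w) = b by [].
have [v vL bv] := fibre_exists cI zI nb.
have [l|l] := ltP 0 (D z (al (nx w)) b).
  have E' := bnd_in_sector cI oQ e bb (ltW tt) l.
  by move: tt; rewrite E' det3_eqr ltxx.
have {}l : 0 <= D z b (al (nx w)) by rewrite det3_swapr oppr_ge0.
move: l; rewrite le_eqVlt => /orP[/eqP l|l].
  pose r : pt := ((c z).1 + ((c z).1 - (c (al w)).1), (c z).2 + ((c z).2 - (c (al w)).2)).
  have rE q : det3 (c z) (c q) r = D z (al w) q by rewrite !det3E /r /=; ring.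
  by apply/esym/(@bnd_same_ray _ _ _ _ _ _ _ r cI oQ); rewrite ?rE.
have [l'|l'] := ltP 0 (D z b (nx w)).
  have wb : 0 < D z w b.
    have := plucker (c z) (c w) (c (al w)) (c b) (c (nx w)) => e0.
    rewrite -(pmulr_lgt0 _ a2).
    by have := mulr_ge0 a1 (ltW l'); have := mulr_gt0 wx sb; lra.
  have E' : b = al w by apply: fib_al => //; rewrite in_set nb (ltW wb).
  by move: sb; rewrite E' det3_eqr ltxx.
have {}l' : 0 <= D z (nx w) b by rewrite det3_swapr oppr_ge0.
have by_ : 0 < D z b (nx (nx w)).
  have := plucker (c z) (c (nx w)) (c b) (c (al (nx w))) (c (nx (nx w))) => e0.
  have := mulr_ge0 l' (ltW b2); have := mulr_gt0 xy l => m1 m2.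
  rewrite ltNge; apply/negP => le; have := mulr_ge0 b1 (_ : 0 <= - D z b (nx (nx w))).
  by rewrite oppr_ge0 => /(_ le); lra.
by apply/esym/fib_al; rewrite ?nL // in_set nb l'.
Qed.

Lemma al_next_beyond w : w \in L -> 0 < D (nx w) w (al w) /\ 0 < D (al (nx w)) (nx w) w.
Proof.
move=> wL; have [ab a1 a2] := al_spec wL; split.
  rewrite det3_swap oppr_gt0; apply: (beyond_edge cQ zI1 _ (edge_nx cI zI wL) a1 a2).
  by apply/negP; apply: bnd_inner ab.
by rewrite det3_cyc det3_swap oppr_gt0; apply: al_next.
Qed.

(** At the vertex o' of Q, between its neighbours v' and n', the point w' is
    inside; a point p' beyond the edge to n' but not beyond the edge from v'
    is on one side of the line through w' and o'.  In side_exit the roles of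
    the edges are exchanged, and p' is on the other side. *)
Lemma side_enter (o' n' v' w' p' : pt) : 0 <= det3 o' n' v' -> 0 < det3 o' n' w' ->
  0 < det3 v' o' w' -> 0 <= det3 v' o' p' -> det3 o' n' p' < 0 -> 0 < det3 w' o' p'.
Proof.
rewrite (det3_swap v' o' w') (det3_swap v' o' p') (det3_swap w' o' p').
have := plucker o' n' v' w' p'.
move: (det3 o' n' v') (det3 o' n' w') (det3 o' v' w') (det3 o' v' p') (det3 o' n' p') (det3 o' w' p').
move=> A B C E F G e hA hB hC hE hF; rewrite oppr_gt0 ltNge; apply/negP => hG.
have := mulr_ge0 hA hG; have := mulr_ge0 (ltW hB) hE.
have := mulr_gt0 hC (_ : 0 < - F); rewrite oppr_gt0 => /(_ hF); lra.
Qed.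

Lemma side_exit (o' n' v' w' p' : pt) : 0 <= det3 o' n' v' -> 0 < det3 o' n' w' ->
  0 < det3 v' o' w' -> det3 v' o' p' < 0 -> 0 <= det3 o' n' p' -> det3 w' o' p' < 0.
Proof.
rewrite (det3_swap v' o' w') (det3_swap v' o' p') (det3_swap w' o' p').
have := plucker o' n' v' w' p'.
move: (det3 o' n' v') (det3 o' n' w') (det3 o' v' w') (det3 o' v' p') (det3 o' n' p') (det3 o' w' p').
move=> A B C E F G e hA hB hC hE hF; rewrite oppr_lt0 ltNge; apply/negP => hG.
have E0 : 0 < E by lra.
have G0 : 0 <= - G by lra.
by have := mulr_ge0 hA G0; have := mulr_gt0 hB E0; have := mulr_ge0 (ltW hC) hF; lra.
Qed.

(** Follow the edges of Q visible from p.  At the first one p is to the left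
    of the line through w and al w, at the last one to the right; by
    quad_outward_empty it cannot change sides without being on such a line. *)
Lemma outside_on_line p : p \notin Q -> exists2 w, w \in L & D w (al w) p = 0.
Proof.
move=> pQ; apply: contrapT => no.
have s0 w : w \in L -> D w (al w) p != 0.
  by move=> wL; apply/eqP => e; apply: no; exists w.
have corner w : w \in L -> [/\ 0 <= D (al (nx w)) (al (nx (nx w))) (al w),
    0 < D (al (nx w)) (al (nx (nx w))) (nx w) & 0 < D (al w) (al (nx w)) (nx w)].
  move=> wL; have xL := nL wL; have e := al_edge xL; have xI := bndQ xL.
  split; [|exact: edge_inner_pos e xI|exact: edge_inner_pos (al_edge wL) xI].
  by have [ab _ _] := al_spec wL; case/edgeP: e => _ _ _ h _; apply: h; apply: bndQ ab.
have enter w : w \in L -> 0 <= D (al w) (al (nx w)) p -> D (al (nx w)) (al (nx (nx w))) p < 0 ->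
    0 < D (nx w) (al (nx w)) p.
  by move=> wL h1 h2; have [c1 c2 c3] := corner w wL; apply: side_enter c1 c2 c3 h1 h2.
have exit_ w : w \in L -> D (al w) (al (nx w)) p < 0 -> 0 <= D (al (nx w)) (al (nx (nx w))) p ->
    D (nx w) (al (nx w)) p < 0.
  by move=> wL h1 h2; have [c1 c2 c3] := corner w wL; apply: side_exit c1 c2 c3 h1 h2.
have as_al a b : hull_edge c (c z) Q a b -> exists2 w, w \in L & a = al w /\ b = al (nx w).
  move=> e; have [ab _] := edge_bnd e; have [w wL aw] := fibre_exists cI zI ab.
  exists w => //; have ea := fib_al wL aw; split=> //.
  by apply: (edge_fun cI oQ e); rewrite ea; apply: al_edge.
have pz : c p != c z by apply: contraNneq pQ => /cI ->; apply: innerQ zI1.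
have [u0 u0L hid] : exists2 w, w \in L & 0 <= D (al w) (al (nx w)) p.
  pose d : pt := ((c z).1 + ((c z).1 - (c p).1), (c z).2 + ((c z).2 - (c p).2)).
  have dz : d != c z.
    apply: contra pz; rewrite /d; case: (c z) (c p) => [x y] [x' y'] /=.
    by move=> /eqP[h1 h2]; apply/eqP; congr pair; lra.
  have [a [b [e h1 h2]]] := sector_exists oQ dz; have [w wL [ea eb]] := as_al a b e.
  exists w => //; rewrite -ea -eb; case/edgeP: e => _ _ ab _ _.
  have -> : D a b p = D z a b + det3 (c z) d (c b) + det3 (c z) (c a) d.
    by rewrite !det3E /d /=; ring.
  by lra.
have [u1 u1L seen] : exists2 w, w \in L & D (al w) (al (nx w)) p < 0.
  have [a [b [e h1 h2]]] := sector_exists oQ pz; have [w wL [ea eb]] := as_al a b e.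
  exists w => //; rewrite -ea -eb ltNge; apply/negP => h3.
  case/edgeP: e => aQ bQ ab _ _; have [t ht] := cQ pQ.
  by apply: (@max_not_in_triangle _ t (c a) (c b) (c z) (c p));
    [dsgn|dsgn|dsgn|exact: ht|exact/ltW/ht|exact/ltW/ht/innerQ/zI1].
have [v vL [hv hx]] : exists2 v, v \in L & 0 <= D (al v) (al (nx v)) p /\
    D (al (nx v)) (al (nx (nx v))) p < 0.
  apply: contrapT => no'.
  pose Y := [set w in L | 0 <= D (al w) (al (nx w)) p].
  have YL : Y = L.
    apply: (nxt_connected cI oI).
    - by apply/set0Pn; exists u0; rewrite in_set u0L.
    - by apply/subsetP => w; rewrite in_set => /andP[].
    move=> w; rewrite [w \in Y]in_set [nx w \in Y]in_set => /andP[wL h]; rewrite nL //=.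
    by rewrite leNgt; apply/negP => l; apply: no'; exists w.
  by move: u1L; rewrite -YL in_set leNgt seen andbF.
pose X := [set w in L | (D (al w) (al (nx w)) p < 0) && (0 < D w (al w) p)].
have XL : X = L.
  apply: (nxt_connected cI oI).
  - by apply/set0Pn; exists (nx v); rewrite in_set nL // hx; apply: enter.
  - by apply/subsetP => w; rewrite in_set => /andP[].
  move=> w; rewrite [w \in X]in_set [nx w \in X]in_set => /and3P[wL vw sw]; rewrite nL //=.
  have sx : 0 < D (nx w) (al (nx w)) p.
    rewrite lt_neqAle eq_sym s0 ?nL //= leNgt; apply/negP => l.
    have [k1 k2] := al_next_beyond wL.
    apply: (quad_outward_empty (edge_nx cI zI wL) (al_edge wL) k2 k1 vw sw).
    by rewrite det3_swap oppr_gt0.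
  rewrite sx andbT ltNge; apply/negP => l.
  by have := exit_ w wL vw l; rewrite ltNge (ltW sx).
by move: u0L; rewrite -XL in_set ltNge hid andbF.
Qed.

(** The transversal is a bijection from the vertices of inner Q to bnd Q. *)
Lemma transversal_pinned : pinned Q.
Proof.
have inj : {in L &, injective al}.
  move=> v w vL wL e; apply: (fibre_unique cI zI vL wL (al_fib vL)).
  by rewrite e; apply: al_fib.
have im : al @: L = bnd Q.
  apply/setP => p; apply/imsetP/idP => [[w wL ->]|pb]; first by case: (al_spec wL).
  by have [w wL pw] := fibre_exists cI zI pb; exists w => //; apply: fib_al.
have LA : #|L| = #|bnd Q| by rewrite -im card_in_imset.
split=> //; rewrite -LA.
have sub : ~: Q \subset \bigcup_(w in L) [set p | D w (al w) p == 0].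
  apply/subsetP => p; rewrite in_setC => /outside_on_line[w wL e].
  by apply/bigcupP; exists w => //; rewrite in_set e.
apply: leq_trans (subset_leq_card sub) _.
apply: leq_trans (card_bigcup_le _ _) _.
rewrite -sum_nat_const; apply: leq_sum => w wL; apply: lineM.
apply/eqP => e; have [ab _ _] := al_spec wL; rewrite -e in ab.
exact: bnd_inner ab (bndQ wL).
Qed.

End Pinned.

(** * Reflection *)

Section Mirror.
Variable R : realFieldType.
Local Notation pt := (R * R)%type.
Variables (T : finType) (c : T -> pt).
Implicit Types (Q S W X : {set T}) (a b q r v w x y z : T).

(** Reflection reverses orientation and keeps layers, so every statement about
    the counterclockwise order has a clockwise version. *)
Definition mir (p : pt) : pt := (p.1, - p.2).
Definition cmir (t : T) : pt := mir (c t).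

Lemma mirK : involutive mir.
Proof. by move=> [x y]; rewrite /mir /= opprK. Qed.

Lemma det3_mir p1 p2 p3 : det3 (mir p1) (mir p2) (mir p3) = - det3 p1 p2 p3.
Proof. by rewrite !det3E /mir /=; ring. Qed.

Lemma lf_mir u p : lf u (mir p) = lf (mir u) p.
Proof. by rewrite /lf /mir /=; ring. Qed.

Lemma mir_neq0 u : u != 0 -> mir u != 0.
Proof.
move=> /pt_neq0 h; apply: sqr_pt_neq0; rewrite /mir /=.
by rewrite sqrrN.
Qed.

Lemma cmir_inj : injective c -> injective cmir.
Proof. by move=> cI; apply: (inj_comp (can_inj mirK)). Qed.

Lemma wsep_mir Q p : wsep cmir Q (mir p) <-> wsep c Q p.
Proof.
split=> -[u u0 hu]; exists (mir u); rewrite ?mir_neq0 // => q /hu; rewrite /cmir.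
  by rewrite !lf_mir.
by rewrite !lf_mir !mirK.
Qed.

Lemma ssep_mir Q p : ssep cmir Q (mir p) <-> ssep c Q p.
Proof.
split=> -[u hu]; exists (mir u) => q /hu; rewrite /cmir; first by rewrite !lf_mir.
by rewrite !lf_mir !mirK.
Qed.

Lemma inner_mir Q : interior cmir Q = interior c Q.
Proof.
apply/setP => z; apply/innerP/innerP => -[zQ h]; split=> // h'; apply: h.
  exact/wsep_mir.
by move/wsep_mir: h'.
Qed.

Lemma bnd_mir Q : boundary cmir Q = boundary c Q.
Proof. by rewrite /boundary inner_mir. Qed.

Lemma closed_mir Q : convex_closed c Q -> convex_closed cmir Q.
Proof. by move=> h p /h; rewrite -ssep_mir. Qed.

Lemma iter_inner_mir Q j : iter j (interior cmir) Q = iter j (interior c) Q.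
Proof. by elim: j => //= j ->; rewrite inner_mir. Qed.

Lemma innermost_mir Q z : innermost c Q z -> innermost cmir Q z.
Proof. by move=> h j; rewrite iter_inner_mir. Qed.

Lemma five_exposed_mir S : five_exposed cmir S -> five_exposed c S.
Proof. by move=> [h1 h2]; split=> // x /h2 /ssep_mir. Qed.

Lemma edge_mir z Q a b : hull_edge cmir (cmir z) Q a b = hull_edge c (c z) Q b a.
Proof.
suff gen (d : T -> pt) (x y : T) : hull_edge d (d z) Q x y -> hull_edge (mir \o d) (mir (d z)) Q y x.
  apply/idP/idP; last exact: gen.
  move/gen; suff -> : mir \o cmir = c by rewrite /cmir mirK.
  by apply/funext => t; rewrite /cmir /= mirK.
move=> /edgeP[xQ yQ xy h1 h2]; apply/edgeP; split=> //.
- by rewrite det3_mir -det3_swapr.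
- by move=> r /h1; rewrite det3_mir -det3_swap.
move=> r rQ; rewrite !det3_mir.
rewrite -(det3_swapr (d z) (d r)) -(det3_swapr (d z) (d x)) -(det3_swap (d x)).
by move=> l1 l2; apply: h2.
Qed.

End Mirror.

(** * Transversals of the sectors *)

Section Stuck.
Variable R : realFieldType.
Local Notation pt := (R * R)%type.
Variables (T : finType) (c : T -> pt).
Implicit Types (Q S W X : {set T}) (o : pt) (a b q r v w x y z m p : T) (h : pt * R).
Local Notation "'D' p q r" := (det3 (c p) (c q) (c r))
  (at level 10, p, q, r at level 9).
Local Notation inner := (interior c).
Local Notation bnd := (boundary c).
Local Notation closed := (convex_closed c).
Local Notation c' := (cmir c).
Hypothesis cI : injective c.
Hypothesis H5 : forall S, five_exposed c S -> exists2 p : T, p \notin S & ~ ssep c S (c p).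
Variable M : nat.
Hypothesis lineM : forall p q, p != q -> (#|[set r | D p q r == 0%R]| <= M)%N.

Lemma mir_H5 S : five_exposed c' S -> exists2 p : T, p \notin S & ~ ssep c' S (c' p).
Proof. by move=> /five_exposed_mir /H5[p pS h]; exists p => // /ssep_mir. Qed.

Lemma mir_lineM p q : p != q -> (#|[set r | det3 (c' p) (c' q) (c' r) == 0%R]| <= M)%N.
Proof.
move=> pq; apply: leq_trans (lineM pq); apply: subset_leq_card.
by apply/subsetP => r; rewrite !in_set det3_mir oppr_eq0.
Qed.

(** A functional that is constant on the boundary of Q is constant on Q. *)
Lemma bnd_not_collinear Q z p q : z \in inner Q -> p != q ->
  (forall r, r \in bnd Q -> D p q r = 0) -> False.
Proof.
move=> zI pq h; have oI := inner_nwsep zI.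
have n0 : nrm (c p) (c q) != 0 by rewrite nrm_neq0 // (inj_eq cI).
have top (n : pt) : n != 0 -> exists2 t, t \in bnd Q & lf n (c z) < lf n (c t).
  move=> nn; have [t tQ tmax] := @ex_max R T (mem Q) (fun r => lf n (c r)) z (innerQ zI).
  exists t; first by apply/bndE; split=> //; exists n.
  by rewrite ltNge; apply/negP => le; apply: oI; exists n => // r /tmax l; apply: le_trans le.
have n1 : - nrm (c p) (c q) != 0 by rewrite oppr_eq0.
have [t /h et lt_] := top _ n0; have [s /h es ls] := top _ n1.
move: et es lt_ ls; rewrite -!lf_nrm !lfN; lra.
Qed.

Variables (Q : {set T}) (z : T).
Hypothesis cQ : closed Q.
Hypothesis zI : z \in inner (inner Q).
Local Notation nx := (nxt c (c z) (inner Q)).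
Local Notation L := (bnd (inner Q)).
Local Notation beyond := (beyond_of c Q z).
Local Notation beyonds := (beyonds_of c Q z).
Local Notation ends := (ends_of c Q z).
Local Notation fibre := (fibre_of c Q z).

Let oI := inner_nwsep zI.
Let zI1 := innerQ zI.
Let oQ := inner_nwsep zI1.
Let nL := nx_L cI zI.

Hypothesis nogain : forall X, X \subset L -> (#|ends X| <= #|beyonds X|)%N.

Section Transversal.
Variable al : T -> T.
Hypothesis al_fib : forall w, w \in L -> al w \in fibre w.
Hypothesis fib_al : forall w p, w \in L -> p \in fibre w -> p = al w.

Lemma fibre_beyond w p : w \in L -> p \in fibre w -> D w (nx w) p < 0.
Proof.
move=> wL; rewrite in_set => /and3P[pb h1 h2].
apply: (beyond_edge cQ zI1 _ (edge_nx cI zI wL) h1 h2).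
by apply/negP; apply: bnd_inner pb.
Qed.

Let alS := al_spec al_fib.

Let nxp w : w \in L -> 0 < D z w (nx w).
Proof. by move=> /(edge_nx cI zI) /edgeP[]. Qed.

(** If every boundary point of Q is on the ray of a vertex, it is beyond both
    edges at that vertex. *)
Lemma aligned_pinned : (forall w, w \in L -> D z w (al w) = 0) -> pinned c M Q.
Proof.
move=> al0; apply: (transversal_pinned cI H5 lineM cQ zI al_fib fib_al) => w wL.
apply: (opposite_cone_prev cI zI wL); last by rewrite al0 ?nL.
exact: fibre_beyond (nL wL) (al_fib (nL wL)).
Qed.

Hypothesis strict : forall w, w \in L -> 0 < D z w (al w).

(** Suppose the boundary point al u in the sector of u is not beyond the edge
    that ends in u.  A point p of Q beyond that edge and past u would leave al
    u inside the triangle z u p. *)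
Lemma no_rest_right e : e \in L -> ~~ (D e (nx e) (al (nx e)) < 0) -> rest_right_of c Q z e = set0.
Proof.
move=> eL; rewrite -leNgt => h; have uL := nL eL.
apply/setP => p; rewrite in_set0 in_set; apply/negP => /andP[pe up].
have pb := beyond_bnd cI zI eL pe.
move: pe; rewrite in_set => /andP[_ ep].
set u := nx e in h uL up ep *; have ux := nxp uL.
have [ab a1 a2] := alS uL; have us := strict uL.
have [px|px] := ltP 0 (D z p (nx u)).
  have E' : p = al u by apply: fib_al => //; rewrite in_set pb up.
  by move: ep; rewrite E' ltNge h.
have xp : 0 <= D z (nx u) p by rewrite det3_swapr oppr_ge0.
have uxp := opposite_cone_next cI zI eL ep up; rewrite -/u in uxp.
have {}up : 0 < D z u p.
  by move: uxp; rewrite (det3_split (c z)) (det3_swapr (c z) (c p) (c u)); lra.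
have ap : 0 < D z (al u) p.
  have := plucker (c z) (c u) (c (al u)) (c (nx u)) (c p) => e0.
  rewrite -(pmulr_rgt0 _ ux).
  by have := mulr_ge0 (ltW us) xp; have := mulr_gt0 up a2; lra.
have le := bnd_not_in_triangle oQ ab (innerQ (bndQ uL)) (bndQ pb) a1 (ltW ap) up.
have := det3_bary (c z) (c u) (c p) (c (al u)) (c e) (c u).
rewrite det3_eqr mulr0 addr0 -(det3_cyc (c z) (c e) (c u)).
have := nxp eL; rewrite -/u; move: le us ep up h.
move: (D u p (al u)) (D z u (al u)) (D e u p) (D z u p) (D e u (al u)) (D z e u).
move=> A B C E F G hA hB hC hE hF hG e0.
have := mulr_ge0 (ltW hE) hF; have := mulr_gt0 hB (_ : 0 < - C).
have := mulr_ge0 (_ : 0 <= - A) (ltW hG).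
by rewrite oppr_gt0 oppr_ge0 => h1 h2; have := h1 hA; have := h2 hC; lra.
Qed.

Lemma no_rest_left w : w \in L -> ~~ (D (nx w) (nx (nx w)) (al w) < 0) -> rest_left_of c Q z w = set0.
Proof.
move=> wL; rewrite -leNgt => h; have vL := nL wL.
apply/setP => p; rewrite in_set0 in_set; apply/negP => /andP[pe vp].
have pb := beyond_bnd cI zI vL pe.
move: pe; rewrite in_set => /andP[_ ep].
set v := nx w in h vL vp ep *; have wv : 0 < D z w v := nxp wL.
have [ab a1 a2] := alS wL; have ws := strict wL; rewrite -/v in a2.
have pv : 0 < D z p v by rewrite det3_swapr oppr_gt0.
have [wp|wp] := leP 0 (D z w p).
  have E' : p = al w by apply: fib_al => //; rewrite in_set pb wp.
  by move: ep; rewrite E' ltNge h.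
have pw : 0 < D z p w by rewrite det3_swapr oppr_gt0.
have pa : 0 < D z p (al w).
  have := plucker (c z) (c p) (c w) (c (al w)) (c v) => e0.
  rewrite -(pmulr_lgt0 _ wv).
  by have := mulr_gt0 pw a2; have := mulr_gt0 pv ws; lra.
have le := bnd_not_in_triangle oQ ab (bndQ pb) (innerQ (bndQ vL)) (ltW pa) (ltW a2) pv.
have := det3_bary (c z) (c p) (c v) (c (al w)) (c v) (c (nx v)).
rewrite det3_eqm mulr0 addr0 -(det3_cyc (c z) (c v) (c (nx v))) (det3_cyc (c v) (c z)).
have := nxp vL; move: le a2 ep pv h.
move: (D p v (al w)) (D z (al w) v) (D v (nx v) p) (D z p v) (D v (nx v) (al w)) (D z v (nx v)).
move=> A B C E F G hA hB hC hE hF hG e0.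
have := mulr_ge0 (ltW hE) hF; have := mulr_gt0 hB (_ : 0 < - C).
have := mulr_ge0 (_ : 0 <= - A) (ltW hG).
by rewrite oppr_gt0 oppr_ge0 => h1 h2; have := h1 hA; have := h2 hC; lra.
Qed.

(** Otherwise cut along the edges from nx w to nx e.  By the two preceding
    lemmas nothing outside the k sectors of these edges is removed, while k +
    1 points are exposed. *)
Lemma next_or_prev e w : e \in L -> w \in L -> e != w ->
  (D e (nx e) (al (nx e)) < 0) \/ (D (nx w) (nx (nx w)) (al w) < 0).
Proof.
move=> eL wL ew; apply: contrapT => /not_orP[/negP h1 /negP h2].
have ex : exists k, (0 < k)%N && (e == iter k nx w).
  have [k ek] := L_reach cI zI wL eL; exists k; rewrite ek eqxx andbT.
  by rewrite lt0n; apply: contra ew => /eqP k0; rewrite ek k0.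
case: (ex_minnP ex) => k /andP[k0 /eqP ek] kmin.
have ne d : (0 < d <= k)%N -> iter d nx w != w.
  move=> /andP[d0 dk]; apply/eqP => dw.
  have ek' : e = iter (k - d) nx w by rewrite ek -{1}(subnK dk) iterD dw.
  have [kd|kd] := posnP (k - d)%N; first by rewrite kd /= in ek'; rewrite ek' eqxx in ew.
  have := kmin (k - d)%N; rewrite kd {1}ek' eqxx => /(_ isT).
  by rewrite leqNgt ltn_subrL d0 k0.
have big := ends_run_card cI zI k0 ne.
have := run_card cI zI (k := k) wL; rewrite -ek no_rest_right // no_rest_left // !cards0 !addn0.
move=> small; have := leq_trans big (nogain (run_sub cI zI k wL)).
rewrite ltnNge small // => i _; rewrite leqNgt; apply/negP => /card_gt1P[p [q [pf qf]]].
have iL := iter_nx_L cI zI i wL.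
by rewrite (fib_al iL pf) (fib_al iL qf) eqxx.
Qed.

(** With a single exception w0, the points al w and al (nx w) are both beyond
    the edges next to them, so consecutive collinear sets share two points,
    and all boundary points are on one line. *)
Lemma chain_collinear w0 : w0 \in L ->
  (forall e, e \in L -> e != w0 -> D e (nx e) (al (nx e)) < 0) ->
  (forall w, w \in L -> w != w0 -> D (nx w) (nx (nx w)) (al w) < 0) -> False.
Proof.
move=> w0L T2 T3; set v0 := nx w0; have v0L : v0 \in L := nL w0L.
have ne w : w \in L -> al w != al (nx w).
  move=> wL; apply/eqP => e; have xL := nL wL.
  have E' : w = nx w by apply: (fibre_unique cI zI wL xL (al_fib wL)); rewrite e; apply: al_fib.
  by have := nxp wL; rewrite -E' det3_eqr ltxx.
pose on_line q := D (al v0) (al (nx v0)) q == 0.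
pose X := [set w in L | on_line (al w) && on_line (al (nx w))].
have XL : X = L.
  apply: (nxt_connected cI oI).
  - by apply/set0Pn; exists v0; rewrite in_set v0L /on_line det3_eqm det3_eqr eqxx.
  - by apply/subsetP => w; rewrite in_set => /andP[].
  move=> w; rewrite [w \in X]in_set [nx w \in X]in_set => /and3P[wL ow ox]; rewrite nL // ox /=.
  have xL := nL wL; have yL := nL xL.
  have [ye|yn] := eqVneq (nx (nx w)) v0; first by rewrite /on_line ye det3_eqm.
  have [xe|xn] := eqVneq (nx w) v0; first by rewrite /on_line xe det3_eqr.
  have xw0 : nx w != w0 by apply: contra yn => /eqP ->.
  have ww0 : w != w0 by apply: contra xn => /eqP ->.
  apply/eqP; apply: (line_extend cI (ne _ v0L) (ne _ wL) (eqP ow) (eqP ox)).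
  have mem q : q \in bnd Q -> D (nx w) (nx (nx w)) q < 0 -> q \in beyond (nx w).
    by move=> qb l; rewrite in_set (bndQ qb).
  have [wb _ _] := alS wL; have [xb _ _] := alS xL; have [yb _ _] := alS yL.
  apply: (beyond_collinear cI H5 cQ zI xL); apply: mem => //; [exact: T3|exact: fibre_beyond (al_fib xL)|exact: T2].
apply: (bnd_not_collinear zI1 (ne _ v0L)) => r rb.
have [w wL rw] := fibre_exists cI zI rb; rewrite (fib_al wL rw).
by move: wL; rewrite -XL in_set => /and3P[_ /eqP].
Qed.

End Transversal.
End Stuck.

(** * Sets without gainful cuts *)

Section Dichotomy.
Variable R : realFieldType.
Local Notation pt := (R * R)%type.
Variables (T : finType) (c : T -> pt).
Implicit Types (Q S W X : {set T}) (o : pt) (a b q r v w x y z m p : T) (h : pt * R).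
Local Notation "'D' p q r" := (det3 (c p) (c q) (c r))
  (at level 10, p, q, r at level 9).
Local Notation inner := (interior c).
Local Notation bnd := (boundary c).
Local Notation closed := (convex_closed c).
Local Notation c' := (cmir c).
Hypothesis cI : injective c.
Hypothesis H5 : forall S, five_exposed c S -> exists2 p : T, p \notin S & ~ ssep c S (c p).
Variable M : nat.
Hypothesis lineM : forall p q, p != q -> (#|[set r | D p q r == 0%R]| <= M)%N.

Lemma pinned_mir Q : pinned c' M Q -> pinned c M Q.
Proof. by rewrite /pinned inner_mir !bnd_mir. Qed.

(** All fibres have exactly one point, because there are at least as many
    boundary points as vertices of inner Q and no fibre has two.  If the point
    of one fibre is strictly inside its sector, then so is that of the next
    one, for lack of unflanked vertices in the mirrored order; hence all are
    aligned or none is.  In the second case, by next_or_prev and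
    chain_collinear, each point is beyond the edge before its sector, or each
    is beyond the edge after it; reflection exchanges the two cases. *)
Lemma stuck_pinned Q z : closed Q -> z \in inner (inner Q) ->
  (forall X, X \subset bnd (inner Q) -> (#|ends_of c Q z X| <= #|beyonds_of c Q z X|)%N) ->
  (forall w, ~ unflanked c z Q w) -> (forall w, ~ unflanked c' z Q w) -> pinned c M Q.
Proof.
move=> cQ zI nogain noU noU'.
pose nx := nxt c (c z) (inner Q); pose L := bnd (inner Q).
have nL w : w \in L -> nx w \in L := @nx_L _ _ _ cI _ _ zI w.
have oI := inner_nwsep zI.
have f1 w : w \in L -> (#|fibre_of c Q z w| <= 1)%N.
  by move=> wL; apply: (fibre_le1 cI H5 cQ zI wL); apply: noU.
have LA : (#|L| <= #|bnd Q|)%N.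
  apply: leq_trans (_ : #|ends_of c Q z L| <= _)%N; first exact: subset_leq_card (subsetUl _ _).
  apply: leq_trans (nogain L (subxx _)) _; apply: subset_leq_card; apply/subsetP => p.
  by case/bigcupP => w wL; apply: beyond_bnd.
have f0 w : w \in L -> fibre_of c Q z w != set0.
  move=> wL; apply/eqP => w0; have : (#|bnd Q| <= #|L :\ w|)%N.
    have sub : bnd Q \subset \bigcup_(v in L :\ w) fibre_of c Q z v.
      apply/subsetP => p pb; have [v vL pv] := fibre_exists cI zI pb.
      apply/bigcupP; exists v => //; rewrite in_setD1 vL andbT.
      by apply/eqP => e; move: pv; rewrite e w0 in_set0.
    apply: leq_trans (subset_leq_card sub) _.
    apply: leq_trans (card_bigcup_le _ _) _.
    by rewrite -sum1_card; apply: leq_sum => v; rewrite in_setD1 => /andP[_ /f1].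
  move=> le; move: LA; rewrite (cardsD1 w L) wL add1n => LA.
  by have := leq_trans LA le; rewrite ltnn.
have /choice[al hal] : forall w, exists p, w \in L -> p \in fibre_of c Q z w.
  move=> w; have [wL|wL] := boolP (w \in L); last by exists w.
  by have /set0Pn[p pw] := f0 w wL; exists p.
have fal w p : w \in L -> p \in fibre_of c Q z w -> p = al w.
  move=> wL pw; have := f1 w wL; rewrite leqNgt => /card_gt1P h; apply: contrapT => /eqP ne.
  by apply: h; exists p, (al w); split=> //; apply: hal.
have nxp w : w \in L -> 0 < D z w (nx w).
  by move=> /(edge_nx cI zI) /edgeP[].
have alS w : w \in L -> [/\ al w \in bnd Q, 0 <= D z w (al w) & 0 < D z (al w) (nx w)].
  exact: al_spec.
have edge' v : v \in L -> hull_edge c' (c' z) (interior c' Q) (nx v) v.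
  by move=> vL; rewrite inner_mir edge_mir; apply: edge_nx.
have mD (p1 p2 p3 : T) : det3 (c' p1) (c' p2) (c' p3) = - D p1 p2 p3 by apply: det3_mir.
have prop v : v \in L -> 0 < D z v (al v) -> 0 < D z (nx v) (al (nx v)).
  move=> vL vs; have xL := nL v vL; have [_ a1 a2] := alS v vL; have [xb b1 b2] := alS _ xL.
  rewrite lt_neqAle b1 andbT; apply/eqP => e; have [ab _ _] := alS v vL.
  apply: (noU' (nx v)); exists v, (al (nx v)), (al v); rewrite !mD bnd_mir; split=> //.
  - exact: edge'.
  - rewrite -e oppr0 -det3_swapr; split=> //.
    have := plucker (c z) (c v) (c (nx v)) (c (al (nx v))) (c (nx (nx v))).
    rewrite -e mulr0 addr0 => e0; rewrite -(pmulr_lgt0 _ (nxp _ xL)).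
    by have := mulr_gt0 (nxp _ vL) b2; lra.
  by rewrite -!det3_swapr.
pose X := [set w in L | 0 < D z w (al w)].
have XC w : w \in X -> nx w \in X.
  by rewrite [w \in X]in_set [nx w \in X]in_set => /andP[wL h]; rewrite nL //= prop.
have [X0|X0] := eqVneq X set0.
  apply: (aligned_pinned cI H5 lineM cQ zI hal fal) => w wL; have [_ a1 _] := alS w wL.
  apply/le_anti; rewrite a1 andbT leNgt; apply/negP => l.
  by have := in_set0 w; rewrite -X0 in_set wL l.
have XL : X = L.
  by apply: (nxt_connected cI oI) => //; apply/subsetP => w; rewrite in_set => /andP[].
have strict w : w \in L -> 0 < D z w (al w) by rewrite -{1}XL in_set => /andP[].
have [T2|nT2] := pselect (forall e, e \in L -> D e (nx e) (al (nx e)) < 0).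
  exact: (transversal_pinned cI H5 lineM cQ zI hal fal T2).
have [e0 e0L e0n] : exists2 e, e \in L & ~~ (D e (nx e) (al (nx e)) < 0).
  by apply: contrapT => h; apply: nT2 => e eL; apply: contrapT => /negP h'; apply: h; exists e.
have T3' w : w \in L -> w != e0 -> D (nx w) (nx (nx w)) (al w) < 0.
  move=> wL we; have [|l|//] := next_or_prev cI zI nogain hal fal strict e0L wL; first by rewrite eq_sym.
  by rewrite l in e0n.
have [T3e|nT3e] := boolP (D (nx e0) (nx (nx e0)) (al e0) < 0); last first.
  have T2' e : e \in L -> e != e0 -> D e (nx e) (al (nx e)) < 0.
    move=> eL ee; have [//|l] := next_or_prev cI zI nogain hal fal strict eL e0L ee.
    by rewrite l in nT3e.
  by case: (chain_collinear cI H5 cQ zI hal fal e0L T2' T3').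
have T3 w : w \in L -> D (nx w) (nx (nx w)) (al w) < 0.
  by move=> wL; have [->|] := eqVneq w e0 => //; apply: T3'.
apply: pinned_mir.
have zI' : z \in interior c' (interior c' Q) by rewrite !inner_mir.
pose pv := nxt c' (c' z) (interior c' Q).
have cI' := cmir_inj cI.
have oI' := inner_nwsep zI'.
have pvE v : v \in L -> pv (nx v) = v.
  by move=> vL; apply: (nxtE cI' oI'); apply: edge'.
have Lp w : w \in boundary c' (interior c' Q) -> exists2 v, v \in L & w = nx v.
  by rewrite bnd_mir inner_mir => wL; have [v vL <-] := nxt_surj cI oI wL; exists v.
apply: (@transversal_pinned _ _ c' cI' (mir_H5 H5) M (mir_lineM lineM) Q z (closed_mir cQ) zI' (fun w => al (pv w))).
- move=> _ /Lp[v vL ->]; rewrite -/pv pvE //; have [ab a1 a2] := alS v vL.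
  by rewrite in_set bnd_mir ab -/pv pvE // !mD -!det3_swapr (ltW a2) strict.
- move=> _ p /Lp[v vL ->]; rewrite in_set -/pv pvE // bnd_mir !mD -!det3_swapr => /and3P[pb h1 h2].
  move: h1; rewrite le_eqVlt => /orP[/eqP h1|h1]; last by apply: fal => //; rewrite in_set pb (ltW h2).
  have xL := nL v vL; have px : p = al (nx v).
    apply: fal => //; rewrite in_set pb /=; apply/andP; split.
      by rewrite det3_swapr -h1 oppr0.
    have := plucker (c z) (c v) (c (nx v)) (c p) (c (nx (nx v))).
    rewrite (det3_swapr (c z) (c (nx v)) (c p)) -h1 oppr0 mulr0 addr0 => e0'.
    rewrite -(pmulr_rgt0 _ (nxp _ vL)).
    by have := mulr_gt0 h2 (nxp _ xL); rewrite /nx; lra.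
  by have := strict _ xL; rewrite -px det3_swapr -h1 oppr0 ltxx.
move=> _ /Lp[v vL ->]; rewrite -/pv pvE //.
have [u uL uv] := nxt_surj cI oI vL; rewrite -uv pvE // mD oppr_lt0.
by rewrite det3_swap oppr_gt0; apply: T3.
Qed.

End Dichotomy.

(** * The number of points *)

Section Count.
Variable R : realFieldType.
Local Notation pt := (R * R)%type.
Variables (T : finType) (c : T -> pt).
Implicit Types (Q S W X : {set T}) (a b q r v w x y z m p : T).
Local Notation "'D' p q r" := (det3 (c p) (c q) (c r))
  (at level 10, p, q, r at level 9).
Local Notation inner := (interior c).
Local Notation bnd := (boundary c).
Local Notation closed := (convex_closed c).
Local Notation c' := (cmir c).
Hypothesis cI : injective c.
Hypothesis H5 : forall S, five_exposed c S -> exists2 p : T, p \notin S & ~ ssep c S (c p).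
Variable M : nat.
Hypothesis lineM : forall p q, p != q -> (#|[set r | D p q r == 0%R]| <= M)%N.
Hypothesis M2 : (2 <= M)%N.

Let M0 : (0 < M)%N := ltnW M2.

Lemma unflanked_bound Q z w : closed Q -> innermost c Q z -> z \in inner (inner Q) ->
  unflanked c z Q w -> (#|Q| <= 24 * M * M)%N.
Proof.
move=> cQ im zI un.
have h := unflanked_card cI H5 (boundary_bound cI H5 M0 lineM) cQ im zI un.
apply: leq_trans h _; rewrite leq_mul2l; apply/orP; right.
have zw : z != w.
  by move: un => [x [a [a' [/edgeP[_ _ wx _ _] _ _ _]]]]; apply: contraTneq wx => ->; rewrite det3_eql ltxx.
apply: leq_trans (lineM zw); apply: subset_leq_card.
by apply/subsetP => q; rewrite !in_set => /andP[_].
Qed.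

(** With b boundary points, this is 2 #|Q| + b (b - 1) <= K (K - 1) + 2 K M
    for K = 24 * M, written without subtraction.  A gainful cut removes at
    most b points and increases b, so the left side does not decrease. *)
Lemma count_unpinned Q : closed Q ->
  (forall S, S \subset Q -> closed S -> ~ pinned c M S) ->
  (2 * #|Q| + #|bnd Q| * #|bnd Q| + 24 * M <= (24 * M) * (24 * M) + 2 * (24 * M * M) + #|bnd Q|)%N.
Proof.
have [n] := ubnP #|Q|; elim: n Q => // n ih Q hn cQ nopin.
have bK := boundary_bound cI H5 M0 lineM cQ.
have bK1 := boundary_bound cI H5 M0 lineM (inner_closed cQ).
have small : (2 * #|Q| <= 2 * (24 * M * M))%N \/ (#|Q| <= #|bnd Q| + 24 * M)%N ->
  (2 * #|Q| + #|bnd Q| * #|bnd Q| + 24 * M <= (24 * M) * (24 * M) + 2 * (24 * M * M) + #|bnd Q|)%N.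
  have sq : (#|bnd Q| * #|bnd Q| + 24 * M <= 24 * M * (24 * M) + #|bnd Q|)%N by nia.
  have sq2 : (#|bnd Q| * #|bnd Q| <= 24 * M * (24 * M))%N by apply: leq_mul.
  have KM : (24 * M * 2 <= 24 * M * M)%N by rewrite leq_mul2l M2 orbT.
  by move: sq sq2 KM bK; move: (#|bnd Q| * #|bnd Q|)%N (24 * M * (24 * M))%N (24 * M * M)%N => B KK KM; lia.
have [I2|[z2 z2I]] := set_0Vmem (inner (inner Q)).
  apply: small; right; rewrite {1}(card_bnd_inner c Q) leq_add2l.
  by rewrite (card_bnd_inner c (inner Q)) I2 cards0 addn0.
have [|z zQ im] := @innermost_exists _ _ c Q.
  by apply/set0Pn; exists z2; apply: innerQ (innerQ z2I).
have zI : z \in inner (inner Q).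
  by have [/= e|//] := im 2; rewrite e in_set0 in z2I.
have [[w un]|noU] := pselect (exists w, unflanked c z Q w).
  by apply: small; left; rewrite leq_mul2l; apply: unflanked_bound im zI un.
have [[w un]|noU'] := pselect (exists w, unflanked c' z Q w).
  apply: small; left; rewrite leq_mul2l.
  have zI' : z \in interior c' (interior c' Q) by rewrite !inner_mir.
  have bK' S : convex_closed c' S -> (#|boundary c' S| <= 24 * M)%N.
    exact: (boundary_bound (cmir_inj cI) (mir_H5 H5) M0 (mir_lineM lineM)).
  have h := unflanked_card (cmir_inj cI) (mir_H5 H5) bK' (closed_mir cQ) (innermost_mir im) zI' un.
  apply: leq_trans h _; rewrite leq_mul2l; apply/orP; right.
  have zw : z != w.
    by move: un => [x [a [a' [/edgeP[_ _ wx _ _] _ _ _]]]]; apply: contraTneq wx => ->; rewrite det3_eql ltxx.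
  apply: leq_trans (mir_lineM lineM zw); apply: subset_leq_card.
  by apply/subsetP => q; rewrite !in_set => /andP[_].
have [nogain|gainX] := pselect (forall X, X \subset bnd (inner Q) -> (#|ends_of c Q z X| <= #|beyonds_of c Q z X|)%N).
  case: (nopin Q (subxx _) cQ); apply: (stuck_pinned cI H5 lineM cQ zI nogain).
    by move=> w un; apply: noU; exists w.
  by move=> w un; apply: noU'; exists w.
have [X [XL lt]] : exists X, X \subset bnd (inner Q) /\ (#|beyonds_of c Q z X| < #|ends_of c Q z X|)%N.
  apply: contrapT => h; apply: gainX => X XL; rewrite leqNgt; apply/negP => l.
  by apply: h; exists X.
have [cQ' le] := gain cI cQ zI XL; set Q' := Q :\: _ in cQ' le *.
have bX : beyonds_of c Q z X \subset bnd Q.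
  apply/subsetP => p /bigcupP[w wX]; apply: (beyond_bnd cI zI); exact: (subsetP XL).
have QX : #|Q| = (#|Q'| + #|beyonds_of c Q z X|)%N.
  by rewrite -(cardsID (beyonds_of c Q z X) Q) (setIidPr (subset_trans bX (bnd_sub c Q))) addnC.
have pos : (0 < #|beyonds_of c Q z X|)%N.
  rewrite lt0n; apply/eqP => Y0; move: le lt; rewrite /Q'; move/eqP: (Y0).
  by rewrite cards_eq0 => /eqP ->; rewrite setD0 cards0; lia.
have lt_n : (#|Q'| < n)%N by move: hn pos; rewrite QX; lia.
have nopin' S : S \subset Q' -> closed S -> ~ pinned c M S.
  by move=> SQ; apply: nopin; apply: subset_trans SQ (subsetDl _ _).
have := ih Q' lt_n cQ' nopin'.
have bX' := subset_leq_card bX.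
have lb : (#|bnd Q| < #|bnd Q'|)%N by move: le lt; lia.
have sq : (#|bnd Q| * #|bnd Q| + 2 * #|bnd Q| + #|bnd Q'| <= #|bnd Q'| * #|bnd Q'| + #|bnd Q|)%N.
  have -> : #|bnd Q'| = (#|bnd Q| + 1 + (#|bnd Q'| - #|bnd Q| - 1))%N by lia.
  by nia.
rewrite QX; move: sq bX' lb; move: (#|bnd Q| * #|bnd Q|)%N (#|bnd Q'| * #|bnd Q'|)%N (24 * M * (24 * M))%N (24 * M * M)%N.
by move=> B B' KK KM; lia.
Qed.

(** Outside a smallest pinned set S there are at most #|bnd S| * M points, and
    inner S, with the same number of boundary points, contains no pinned set.
    *)
Theorem card_bound : (#|T| < 328 * M.+1 ^ 2)%N.
Proof.
have cT : closed [set: T] by move=> p; rewrite in_setT.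
have fin (B N : nat) :
    (2 * N + B * B + 24 * M <= 24 * M * (24 * M) + 2 * (24 * M * M) + B)%N ->
    (#|T| <= B + N + B * M)%N -> (#|T| < 328 * M.+1 ^ 2)%N.
  move=> h1 h2.
  have sq : (B * (2 * M + 3) <= B * B + (M + 2) * (M + 2))%N.
    by have [+ _] := nat_Cauchy B (M + 2); rewrite -!mulnn; lia.
  rewrite -mulnn; lia.
have [ex|no] := pselect (exists S, closed S /\ pinned c M S); last first.
  have h := @count_unpinned [set: T] cT (fun S _ cS pS => no (ex_intro _ S (conj cS pS))).
  move: h; rewrite cardsT => h.
  apply: (fin 0%N #|T|); last by rewrite mul0n addn0 add0n.
  have : (#|bnd [set: T]| <= #|bnd [set: T]| * #|bnd [set: T]|)%N.
    by case: #|bnd [set: T]| => // k; rewrite leq_pmulr.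
  rewrite muln0 addn0; move: h; move: (#|bnd [set: T]| * #|bnd [set: T]|)%N; lia.
have [S0 [cS0 pS0]] := ex.
have [n] := ubnP #|S0|; elim: n S0 cS0 pS0 => // n ih S cS pS hn.
have [[S' [S'S [cS' pS']]]|minS] := pselect (exists S', (#|S'| < #|S|)%N /\ closed S' /\ pinned c M S').
  by apply: (ih S') => //; rewrite -ltnS; apply: leq_trans hn.
have [pb pc] := pS.
have TS : #|T| = (#|S| + #|~: S|)%N by rewrite cardsC.
have SbI := card_bnd_inner c S.
have [I0|[z zI]] := set_0Vmem (inner S).
  have e0 : #|bnd S| = 0%N.
    by rewrite -pb I0; apply/eqP; rewrite cards_eq0 -subset0 (subset_trans (bnd_sub c _)).
  by move: pc; rewrite TS SbI e0 I0 cards0 mul0n leqn0 => /eqP ->; rewrite muln_gt0 expn_gt0.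
apply: (fin #|bnd S| #|inner S|); last by rewrite TS SbI leq_add2l.
rewrite -{1 2 3}pb; apply: count_unpinned; first exact: inner_closed.
move=> S' S'S cS' pS'; apply: minS; exists S'; split=> //.
exact: leq_ltn_trans (subset_leq_card S'S) (inner_lt zI).
Qed.

End Count.

(** * Convex hulls and lines in the plane of row vectors *)

Section RowVectors.
Variable R : realType.
Implicit Types (P X : {fset 'rV[R]_2}).

Definition xy (p : 'rV[R]_2) : R * R := (p ord0 ord0, p ord0 ord_max).

Lemma row2_eq (p q : 'rV[R]_2) : p ord0 ord0 = q ord0 ord0 ->
  p ord0 ord_max = q ord0 ord_max -> p = q.
Proof.
move=> h0 h1; apply/rowP => i; case: i => -[|[|//]] hi.
  by rewrite (_ : Ordinal hi = ord0) //; apply/val_inj.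
by rewrite (_ : Ordinal hi = ord_max) //; apply/val_inj.
Qed.

Lemma xy_inj : injective xy.
Proof. by move=> p q [h0 h1]; apply: row2_eq. Qed.

Definition crd P (t : P) : R * R := xy (val t).

Lemma crd_inj P : injective (@crd P).
Proof. by apply: inj_comp; [exact: xy_inj|exact: val_inj]. Qed.

Lemma halfplane_convex (u : R * R) (k : R) :
  convex_set ([set y | lf u (xy y) < k]%classic : set 'rV[R]_2).
Proof.
apply/convex_setW => x y /set_mem /= hx /set_mem /= hy l l0 l1; apply/mem_set => /=.
have -> : lf u (xy (conv l x y)) = l%:num * lf u (xy x) + (1 - l%:num) * lf u (xy y).
  by rewrite /conv /= /lf /xy /= !mxE /onem; ring.
have : l%:num * lf u (xy x) < l%:num * k by rewrite ltr_pM2l.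
have : (1 - l%:num) * lf u (xy y) < (1 - l%:num) * k by rewrite ltr_pM2l // subr_gt0.
by lra.
Qed.

(** All that is needed about convex hulls: they contain the set and stay in
    the open half-planes that contain it. *)
Lemma hull_halfplane (X : set 'rV[R]_2) u k : (forall y, X y -> lf u (xy y) < k) ->
  forall y, convex_hull X y -> lf u (xy y) < k.
Proof.
by move=> h; apply: (smallest_sub (@halfplane_convex u k)).
Qed.

(** Separation makes each of the five points a corner and keeps the other
    points of P out of the hull. *)
Lemma exposed_empty_gon P (S : {set P}) : five_exposed (@crd P) S ->
  (forall p : P, p \notin S -> ssep (@crd P) S (crd p)) ->
  empty_gon 5 P [fset val x | x in S]%fset.
Proof.
move=> [S5 ex] sep; set X := imfset _ _ _.
have XP y : y \in X -> exists2 x : P, x \in S & y = val x by move/imfsetP => [x xS ->]; exists x.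
have memX (x : P) : x \in S -> val x \in X by move=> xS; apply/imfsetP; exists x.
have subX : (X `<=` P)%fset by apply/fsubsetP => y /XP[x _ ->]; apply: valP.
split=> //.
  split.
    rewrite card_imfset /=; last exact: val_inj.
    by rewrite -S5 cardE; congr size; apply: eq_enum.
  move=> y /= /XP[x xS ->]; split; first exact: memX.
  have [u hu] := ex x xS => e.
  have : convex_hull ([set` X] `\ val x)%classic (val x).
    by rewrite e; apply: sub_gen_smallest => /=; apply: memX.
  move/(@hull_halfplane _ u (lf u (crd x))) => h.
  suff : lf u (xy (val x)) < lf u (crd x) by rewrite ltxx.
  apply: h => z [/= /XP[t tS ->]] tx; apply: hu; rewrite in_setD1 tS andbT.
  by apply/eqP => tx'; apply: tx; rewrite tx'.
apply/seteqP; split=> [y [/= yP hy]|y /= yX]; last first.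
  split; first by apply: (fsubsetP subX).
  exact: sub_gen_smallest.
pose p : P := [` yP]%fset; have -> : y = val p by [].
have [pS|pS] := boolP (p \in S); first exact: memX.
have [u hu] := sep p pS.
have := @hull_halfplane _ u (lf u (crd p)) _ y hy.
rewrite -/(crd p) => h; suff : lf u (xy y) < lf u (crd p) by rewrite ltxx.
by apply: h => z /= /XP[t tS ->]; apply: hu.
Qed.

Lemma det3_on_line (p q r : R * R) : 0 < (q.1 - p.1) ^+ 2 + (q.2 - p.2) ^+ 2 ->
  det3 p q r = 0 -> exists t, r.1 = p.1 + t * (q.1 - p.1) /\ r.2 = p.2 + t * (q.2 - p.2).
Proof.
set n := _ + _ => n0 e; have n1 : n != 0 by rewrite gt_eqF.
pose d := (r.1 - p.1) * (q.1 - p.1) + (r.2 - p.2) * (q.2 - p.2).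
have tn : d / n * n = d by rewrite divfK.
exists (d / n); split; apply: (mulfI n1).
  transitivity (n * p.1 + d / n * n * (q.1 - p.1) - det3 p q r * (q.2 - p.2)).
    by rewrite tn /d /n det3E; ring.
  by rewrite e; ring.
transitivity (n * p.2 + d / n * n * (q.2 - p.2) + det3 p q r * (q.1 - p.1)).
  by rewrite tn /d /n det3E; ring.
by rewrite e; ring.
Qed.

Lemma line_contains_collinear P (p q : P) l : p != q ->
  (l <= #|[set r : P | det3 (crd p) (crd q) (crd r) == 0%R]|)%N -> contains_collinear l P.
Proof.
move=> pq le; set E := [set r | _] in le.
exists [fset x in [seq val r | r <- take l (enum E)]]%fset; split.
- by apply/fsubsetP => y; rewrite in_fset => /mapP[r _ ->]; apply: valP.
- rewrite card_fseq undup_id; first by rewrite size_map size_takel // -cardE.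
  by rewrite map_inj_uniq ?take_uniq ?enum_uniq //; apply: val_inj.
exists [set val p + t *: (val q - val p) | t in [set: R]]%classic; split.
  exists (val p), (val q - val p); split=> //.
  by rewrite subr_eq0 eq_sym (inj_eq val_inj).
move=> y /=; rewrite in_fset => /mapP[r /mem_take]; rewrite mem_enum in_set => /eqP e ->.
have [t [h1 h2]] := det3_on_line (pt_sub_sqr (@crd_inj P) pq) e.
by exists t => //; apply: row2_eq; rewrite !mxE.
Qed.

End RowVectors.

Theorem theorem1 (R : realType) (l : nat) (P : {fset 'rV[R]_2}) :
  (0 < l)%N ->
  (328 * l ^ 2 <= #|` P|)%N ->
  (exists X : {fset 'rV[R]_2}, empty_gon 5 P X) \/ contains_collinear l P.
Proof.
move=> l0 big; apply: contrapT => /not_orP[nogon noline].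
have cI := @crd_inj R P.
have PT : #|{: P}| = #|` P| by rewrite cardfE.
have line (p q : P) : p != q -> (#|[set r : P | det3 (crd p) (crd q) (crd r) == 0%R]| < l)%N.
  by move=> pq; rewrite ltnNge; apply/negP => /(line_contains_collinear pq).
have H5 (S : {set P}) : five_exposed (@crd R P) S ->
    exists2 p : P, p \notin S & ~ ssep (@crd R P) S (crd p).
  move=> S5; apply: contrapT => no; apply: nogon.
  exists [fset val x | x in S]%fset; apply: exposed_empty_gon => // p pS.
  by apply: contrapT => h; apply: no; exists p.
have P2 : (1 < #|{: P}|)%N.
  by rewrite PT (leq_trans _ big) // (@leq_trans (328 * 1)) // leq_mul2l expn_gt0 l0.
have l3 : (2 < l)%N.
  have /card_gt1P[p [q [_ _ pq]]] := P2.
  apply: leq_trans (line p q pq); rewrite ltnS.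
  apply/card_gt1P; exists p, q; split=> //; by rewrite in_set ?det3_eqm ?det3_eqr eqxx.
have lineM (p q : P) : p != q -> (#|[set r : P | det3 (crd p) (crd q) (crd r) == 0%R]| <= l.-1)%N.
  by move=> pq; rewrite -ltnS prednK // line.
have M2 : (2 <= l.-1)%N by rewrite -ltnS prednK.
have := card_bound cI H5 lineM M2; rewrite prednK // ltnNge => /negP; apply.
by rewrite PT.
Qed.
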